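(* A finite simple graph $H$ has a finite addition host if and only if $H$ has at least one edge.
   Context: All graphs are simple and undirected. A finite addition host for $H$ is a finite non-complete graph $J$ that contains no induced subgraph isomorphic to $H$ and such that, for every nonedge $f$ of $J$ (unordered pair of distinct nonadjacent vertices), the graph $J+f$ obtained by adding the edge $f$ contains an induced subgraph isomorphic to $H$. *)

(* Defs.v *)
From mathcomp Require Import all_boot.

Set Implicit Arguments.
Unset Strict Implicit.
Unset Printing Implicit Defensive.

(* Finite simple undirected graphs. The vertex set may be empty. *)
Record sgraph := SGraph {
  vertex :> finType;
  adj : rel vertex;
  adj_sym : symmetric adj;
  adj_irrefl : irreflexive adj }.

Arguments adj {s}.

Definition nonedge (G : sgraph) (x y : G) : bool := (x != y) && ~~ adj x y.

Definition complete (G : sgraph) : Prop :=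
  forall x y : G, x != y -> adj x y.

Definition has_edge (G : sgraph) : Prop := exists x y : G, adj x y.

Definition isomorphic (G H : sgraph) : Prop :=
  exists2 f : G -> H, bijective f & forall x y, adj (f x) (f y) = adj x y.

Section Induced.
Variables (G : sgraph) (S : {set G}).

Definition induced_adj : rel {x : G | x \in S} :=
  fun u v => adj (val u) (val v).

Fact induced_sym : symmetric induced_adj.
Proof. by move=> u v; rewrite /induced_adj adj_sym. Qed.

Fact induced_irrefl : irreflexive induced_adj.
Proof. by move=> u; rewrite /induced_adj adj_irrefl. Qed.

Definition induced : sgraph := SGraph induced_sym induced_irrefl.
End Induced.

Definition contains_induced (G H : sgraph) : Prop :=
  exists S : {set G}, isomorphic (induced S) H.

Section AddEdge.
Variables (G : sgraph) (x y : G).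

Definition add_edge_adj : rel G :=
  fun u v => adj u v || (u != v) && ([set u; v] == [set x; y]).

Fact add_edge_sym : symmetric add_edge_adj.
Proof. by move=> u v; rewrite /add_edge_adj adj_sym eq_sym setUC. Qed.

Fact add_edge_irrefl : irreflexive add_edge_adj.
Proof. by move=> u; rewrite /add_edge_adj adj_irrefl eqxx. Qed.

Definition add_edge : sgraph := SGraph add_edge_sym add_edge_irrefl.
End AddEdge.

Definition addition_host (H J : sgraph) : Prop :=
  [/\ ~ complete J,
      ~ contains_induced J H
    & forall x y : J, nonedge x y -> contains_induced (add_edge x y) H].

(* Main.v *)
Require Import Defs.
From mathcomp Require Import all_boot all_fingroup.

Set Implicit Arguments.
Unset Strict Implicit.
Unset Printing Implicit Defensive.

(* Let [j] be an [H]-free graph with a nonempty symmetric set [N] of "frozen"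
   nonedges such that adding any pair of [N] to [j] creates an induced copy of
   [H] all of whose other nonedges are frozen.  A maximal [H]-free supergraph of
   [j] avoiding [N] is then a host.  Such pairs [(j, N)] come from three sources.

   Amalgams: for an edge [uv], copies of [H - uv] are glued along nonedges,
   every nonedge of a copy being the place of the missing [uv] in another copy.
   A finite group without short cycles of cosets keeps this finite and locally
   tree-like, so a small set of vertices lies in one copy or is divided by at
   most two vertices, which are nonadjacent; pairs that share no copy are all
   nonadjacent, or all adjacent.  Hence if [X] cannot be divided in this way and
   [H[X]] does not embed into [H - uv], the amalgam is [H]-free.

   Intersection graphs: for triangle-free [H], vertices are sets of [c] points,
   adjacent when they meet; at such a vertex the neighbourhood is covered by
   [c] cliques, so that it cannot represent a vertex of larger degree.

   Circulant graphs for seven small [H].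

   If [H] or its complement is indivisible the amalgam applies.  Otherwise, up
   to at most two nonadjacent vertices, [H] is a join; when both sides have
   three vertices, the join is the only large indivisible set.  In the remaining
   cases [H] is a vertex or two adjacent to all of a set [R], plus at most two
   more vertices, and the structure of [R] decides between the constructions;
   a few families with [#|R| <= 4] are checked by computation. *)

(** Infinitely many copies of [H - uv], glued along a tree, would create no cycle of pieces; the
    obstacle is to fold such a tree into a finite graph without closing a short one. Pieces are
    therefore indexed by a finite group, and a vertex is a label with a coset of the subgroup
    generated by the moves at this label. Large girth of the group is not enough, since a step of a
    cycle may be any element of such a subgroup: cyclic chains of 3 to [#|H| + 3] cosets must
    degenerate. Two universal extensions achieve this, one controlling words between two labels, the
    next words at one label. Adjacency across different pieces is a free bit [b], so the same graph
    answers separations into disconnected parts and into joins. Outside the computed cases, the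
    classification looks for a set [X], inseparable for one value of [b], whose embeddings into
    [H - uv] are forced to have image [X]; a count of edges then excludes them. *)

(** * Embeddings and frozen nonedges *)

Definition embeds (A B : finType) (a : rel A) (b : rel B) : bool :=
  [exists f : {ffun A -> B},
    injectiveb f && [forall x, forall y, b (f x) (f y) == a x y]].

Lemma embedsP (A B : finType) (a : rel A) (b : rel B) :
  reflect (exists2 f : A -> B, injective f & forall x y, b (f x) (f y) = a x y)
          (embeds a b).
Proof.
apply: (iffP existsP) => [[f /andP[/injectiveP f_inj /forallP fP]]|[f f_inj fP]].
  by exists f => // x y; apply/eqP/(forallP (fP x)).
exists [ffun x => f x]; apply/andP; split.
  by apply/injectiveP => x y; rewrite !ffunE => /f_inj.
by apply/forallP => x; apply/forallP => y; rewrite !ffunE fP.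
Qed.

Lemma contains_inducedP (G H : sgraph) :
  contains_induced G H <-> embeds (@adj H) (@adj G).
Proof.
split=> [[S [f [g fK gK] fP]]|/embedsP[f f_inj fP]].
  apply/embedsP; exists (fun x => val (g x)).
    by move=> x y /val_inj /(can_inj gK).
  by move=> x y; rewrite -{2}(gK x) -{2}(gK y) fP.
exists [set f x | x : H].
have fS x : f x \in [set f x | x : H] by apply: imset_f.
pose h (x : H) : induced [set f x | x : H] := exist _ (f x) (fS x).
have h_inj : injective h by move=> x y /(congr1 val)/f_inj.
have h_surj y : exists x, h x == y.
  case: y => y yS; have /imsetP[x _ Ey] := yS.
  by exists x; apply/eqP/val_inj; rewrite /= -Ey.
pose g y := xchoose (h_surj y).
have gK : cancel g h by move=> y; apply/eqP/(xchooseP (h_surj y)).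
exists g; first by exists h => // x; apply: h_inj; rewrite gK.
by move=> x y; rewrite -{2}(gK x) -{2}(gK y) /= /induced_adj /= fP.
Qed.

Lemma set2_eq (T : finType) (u v x y : T) :
  ([set u; v] == [set x; y]) = ((u == x) && (v == y)) || ((u == y) && (v == x)).
Proof.
apply/eqP/idP => [E|/orP[/andP[/eqP-> /eqP->]|/andP[/eqP-> /eqP->]] //]; last first.
  by rewrite setUC.
have Eu : u \in [set x; y] by rewrite -E set21.
have Ev : v \in [set x; y] by rewrite -E set22.
have Ex : x \in [set u; v] by rewrite E set21.
have Ey : y \in [set u; v] by rewrite E set22.
move: Eu Ev Ex Ey; rewrite !inE ![x == _]eq_sym ![y == _]eq_sym.
by do 4![case: (_ == _) => //=].
Qed.

Definition edge_rel (T : finType) (x y : T) : rel T :=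
  fun u v => ((u == x) && (v == y)) || ((u == y) && (v == x)).

Lemma edge_rel_inj (A B : finType) (f : A -> B) (u v a b : A) :
  injective f -> edge_rel (f u) (f v) (f a) (f b) = edge_rel u v a b.
Proof. by move=> f_inj; rewrite /edge_rel !(inj_eq f_inj). Qed.

Lemma edge_relC (T : finType) (x y u v : T) : edge_rel x y u v = edge_rel x y v u.
Proof. by rewrite /edge_rel orbC andbC [X in _ || X]andbC. Qed.

Lemma add_edgeE (G : sgraph) (x y : G) (u v : add_edge x y) :
  x != y -> adj u v = @adj G u v || edge_rel x y u v.
Proof.
move=> xy; rewrite -[LHS]/(add_edge_adj x y u v) /add_edge_adj set2_eq /edge_rel.
case: (@adj G u v) => //=; have [<-|//] := eqVneq u v.
by apply/esym; apply: contraNF xy => /orP[]/andP[/eqP<- /eqP<-].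
Qed.

Definition del (H : sgraph) (u v : H) : rel H :=
  fun x y => @adj H x y && ~~ edge_rel u v x y.

(* [N] is a set of nonedges that can never be added: a maximal [H]-free
   supergraph of [J0] avoiding [N] is then a host. *)
Lemma host_of_frozen (H : sgraph) (T : finType) (j N : rel T) :
  symmetric j -> irreflexive j -> symmetric N ->
  (forall x y, N x y -> (x != y) && ~~ j x y) ->
  (exists x y, N x y) ->
  ~~ embeds (@adj H) j ->
  (forall x y, N x y -> exists u v (f : H -> T),
    [/\ adj u v, injective f, f u = x & f v = y] /\
    [/\ forall a b, adj a b -> ~~ edge_rel u v a b -> j (f a) (f b)
      & forall a b, a != b -> ~~ adj a b -> N (f a) (f b)]) ->
  exists J : sgraph, addition_host H J.
Proof.
move=> j_sym j_irr N_sym Nj [x0 [y0 N0]] jH cov.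
pose rl (A : {set T * T}) : rel T := fun x y => (x, y) \in A.
pose good (A : {set T * T}) :=
  [&& [forall x, forall y, rl A x y == rl A y x], [forall x, ~~ rl A x x],
      [forall x, forall y, N x y ==> ~~ rl A x y],
      [forall x, forall y, j x y ==> rl A x y] & ~~ embeds (@adj H) (rl A)].
have goodj : good [set p | j p.1 p.2].
  have E x y : rl [set p | j p.1 p.2] x y = j x y by rewrite /rl inE.
  apply/and5P; split.
  - by apply/forallP => x; apply/forallP => y; rewrite !E j_sym.
  - by apply/forallP => x; rewrite E j_irr.
  - by apply/forallP => x; apply/forallP => y; apply/implyP; rewrite E => /Nj/andP[].
  - by apply/forallP => x; apply/forallP => y; rewrite E implybb.
  apply: contra jH => /embedsP[f f_inj fP]; apply/embedsP.
  by exists f => // x y; rewrite -fP E.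
have [A /maxsetP[gA Amax] _] := maxset_exists goodj.
have /and5P[/forallP As /forallP Ai /forallP AN /forallP Aj AH] := gA.
have A_sym : symmetric (rl A) by move=> x y; apply/eqP/(forallP (As x)).
have A_irr : irreflexive (rl A) by move=> x; apply/negbTE/Ai.
exists (SGraph A_sym A_irr); split.
- move=> /(_ x0 y0); have /andP[-> _] := Nj _ _ N0 => /(_ isT) /=.
  by apply/negP; apply: (implyP (forallP (AN x0) y0)).
- by move=> /contains_inducedP; apply/negP.
move=> x y /andP[xy nxy]; apply/contains_inducedP; rewrite /= in nxy.
(* A frozen pair: the other nonedges of the given copy are frozen too, hence still absent from [A],
   so adding [xy] makes the copy induced. *)
have [Nxy|nNxy] := boolP (N x y).
  have [u [v [f [[uv f_inj fu fv] [fE fN]]]]] := cov _ _ Nxy.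
  apply/embedsP; exists f => // a b.
  rewrite (@add_edgeE (SGraph A_sym A_irr)) // -fu -fv edge_rel_inj //=.
  have [ab|nab] := boolP (adj a b).
    have [_|abuv] := boolP (edge_rel u v a b); first by rewrite orbT.
    by rewrite (implyP (forallP (Aj _) _)) // fE.
  have [->|anb] := eqVneq a b.
    rewrite A_irr /=; apply: contraTF uv => /orP[]/andP[/eqP<- /eqP<-];
    by rewrite adj_irrefl.
  rewrite (negbTE (implyP (forallP (AN _) _) (fN _ _ anb nab))) /=.
  apply: contraNF nab => /orP[]/andP[/eqP-> /eqP->] //.
  by rewrite adj_sym.
(* A pair that is not frozen: if it created no copy, [A] with [xy] added would still be [good],
   against maximality. *)
apply: contraT => nH; case/negP: nxy.
pose B := A :|: [set p | edge_rel x y p.1 p.2].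
have BE u v : rl B u v = rl A u v || edge_rel x y u v by rewrite /rl /B !inE.
suff gB : good B.
  have := Amax B gB (subsetUl _ _) => E.
  by rewrite /adj /= /rl -E !inE /= /edge_rel !eqxx orbT.
apply/and5P; split.
- by apply/forallP => u; apply/forallP => v; rewrite !BE A_sym edge_relC.
- apply/forallP => u; rewrite BE A_irr /=; apply/negP => /orP[]/andP[/eqP-> /eqP E];
  by rewrite E eqxx in xy.
- apply/forallP => u; apply/forallP => v; apply/implyP => Nuv; rewrite BE.
  rewrite (negbTE (implyP (forallP (AN _) _) Nuv)) /=.
  apply/negP => /orP[]/andP[/eqP E1 /eqP E2]; subst; first by rewrite Nuv in nNxy.
  by rewrite N_sym Nuv in nNxy.
- by apply/forallP => u; apply/forallP => v; apply/implyP => juv; rewrite BE (implyP (forallP (Aj _) _)).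
apply: contra nH => /embedsP[f f_inj fP]; apply/embedsP; exists f => // a b.
by rewrite -fP BE (@add_edgeE (SGraph A_sym A_irr)).
Qed.

(** * Acyclic groups *)

Local Open Scope group_scope.

Definition wval (E : Type) (gT : finGroupType) (s : E -> gT) (w : seq E) : gT :=
  \prod_(e <- w) s e.

Section Words.
Variables (E : finType) (gT : finGroupType) (s : E -> gT).
Implicit Types (w : seq E) (b : {set E}).

Lemma wval_nil : wval s [::] = 1. Proof. by rewrite /wval big_nil. Qed.

Lemma wval_cons e w : wval s (e :: w) = s e * wval s w.
Proof. by rewrite /wval big_cons. Qed.

Lemma wval_cat w1 w2 : wval s (w1 ++ w2) = wval s w1 * wval s w2.
Proof. by rewrite /wval big_cat. Qed.

Lemma wval_rev w : (forall e, s e * s e = 1) -> wval s (rev w) = (wval s w)^-1.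
Proof.
move=> s_inv; elim: w => [|e w IH]; first by rewrite wval_nil invg1.
rewrite rev_cons -cats1 wval_cat IH !wval_cons wval_nil mulg1 invMg; congr (_ * _).
by apply: (mulIg (s e)); rewrite s_inv mulVg.
Qed.

Definition gp b : {group gT} := generated_group (imset s (mem b)).

(** In a finite group a generated subgroup consists of plain products of generators, so words
    without inverses reach all of [gp b]. *)
Lemma gpP b g :
  reflect (exists2 w, all (mem b) w & g = wval s w) (g \in gp b).
Proof.
apply: (iffP idP) => [/gen_prodgP[n [c cP ->]]|[w + ->]]; last first.
  elim: w => [|e w IH] /=; first by rewrite wval_nil group1.
  case/andP=> eb /IH wb; rewrite wval_cons groupM //.
  by apply/mem_gen/imset_f.
elim: n c cP => [|n IH] c cP; first by exists [::]; rewrite ?big_ord0 ?wval_nil.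
have /imsetP[e eb ce] := cP ord0.
have [w wb wE] := IH (fun i => c (lift ord0 i)) (fun i => cP _).
by exists (e :: w); rewrite /= ?eb // wval_cons big_ord_recl ce wE.
Qed.

Lemma wval_filter0 (a : pred E) w : (forall e, e \in w -> ~~ a e) ->
  wval s (filter a w) = 1.
Proof.
move=> H; suff -> : filter a w = [::] by rewrite wval_nil.
by apply/eqP; rewrite -size_eq0 size_filter -leqn0 leqNgt -has_count; apply/hasPn.
Qed.

End Words.

Lemma wval_perm_if (E T : finType) (a : E -> {perm T}) (P : pred E) (w : seq E) :
  wval (fun e => if P e then a e else 1) w = wval a (filter P w).
Proof.
by elim: w => [|e w IH] /=; rewrite ?wval_nil // wval_cons IH; case: (P e); rewrite ?wval_cons ?mul1g.
Qed.

Lemma wval_pair (E : finType) (g1 g2 : finGroupType) (s1 : E -> g1) (s2 : E -> g2) w :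
  wval (fun e => (s1 e, s2 e)) w = (wval s1 w, wval s2 w).
Proof. by elim: w => [|e w IH]; rewrite ?wval_nil // !wval_cons IH. Qed.

(* The group [{perm}] below acts universally: it kills a word iff every
   admissible action on [M] points does. *)
Section Universal.
Variables (E : finType) (gT : finGroupType) (s : E -> gT).
Variables (F : {set {set E}}) (M : nat).

(** On each [b] in [F] the map [s e |-> a e] has to extend to a homomorphism of the generated
    subgroup. Testing it on the subgroup generated by the pairs [(s e, a e)] turns a condition on
    all words into a finite one. *)
Definition adm (a : {ffun E -> {perm 'I_M}}) : bool :=
  [forall b in F, forall p in gp (fun e => (s e, a e)) b, (p.1 == 1) ==> (p.2 == 1)].

Lemma admP (a : {ffun E -> {perm 'I_M}}) : reflect
  (forall b w, b \in F -> all (mem b) w -> wval s w = 1 -> wval a w = 1) (adm a).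
Proof.
apply: (iffP forall_inP) => [H b w bF wb sw|H b bF].
  have /forall_inP/(_ (wval s w, wval a w)) /= := H b bF.
  rewrite sw eqxx /= => Hp; apply/eqP/Hp; apply/gpP; exists w => //.
  by rewrite wval_pair sw.
apply/forall_inP => p /gpP[w wb ->]; rewrite wval_pair /=.
by apply/implyP => /eqP sw; rewrite (H b w).
Qed.

(** All actions side by side: one copy of ['I_M] for each assignment [a], on which inadmissible
    assignments act trivially. *)
Definition ufun (e : E) (p : {ffun E -> {perm 'I_M}} * 'I_M) :=
  (p.1, if adm p.1 then p.1 e p.2 else p.2).

Lemma ufun_inj e : injective (ufun e).
Proof.
move=> [a i] [a' i'] [/= <-]; case: (adm a) => [/perm_inj->|->] //.
Qed.

Definition univ e := perm (@ufun_inj e).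

Lemma wval_univ w a i : wval univ w (a, i) = (a, if adm a then wval a w i else i).
Proof.
elim: w i => [|e w IH] i; first by rewrite !wval_nil !perm1 if_same.
rewrite !wval_cons !permM permE /ufun /= IH; case: (adm a) => //.
Qed.

Lemma univ1 w : (forall a : {ffun E -> {perm 'I_M}}, adm a -> wval a w = 1) ->
  wval univ w = 1.
Proof.
move=> H; apply/permP => -[a i]; rewrite wval_univ perm1.
by case: ifP => // /H->; rewrite perm1.
Qed.

Lemma univ_adm w (a : {ffun E -> {perm 'I_M}}) : wval univ w = 1 -> adm a -> wval a w = 1.
Proof.
move=> w1 aa; apply/permP => i; have := wval_univ w a i.
by rewrite w1 aa !perm1 => -[].
Qed.

Lemma univ_trivial b w : b \in F -> all (mem b) w -> wval s w = 1 -> wval univ w = 1.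
Proof. by move=> bF wb sw; apply: univ1 => a /admP aa; apply: (aa b). Qed.

(** Making the generators outside [al] act trivially turns an admissible action into an admissible
    one, because the relations over [F] survive the filter; and this new action evaluates a word as
    the old one evaluates the filtered word. *)
Lemma univ_retract (al : pred E) :
  (forall b w, b \in F -> all (mem b) w -> wval s w = 1 -> wval s (filter al w) = 1) ->
  forall w, wval univ w = 1 -> wval univ (filter al w) = 1.
Proof.
move=> Hal w w1; apply: univ1 => a /admP aa.
pose a' := [ffun e => if al e then a e else 1].
have a'E v : wval a' v = wval a (filter al v).
  by rewrite -wval_perm_if /wval; apply: eq_bigr => e _; rewrite ffunE.
rewrite -a'E; apply: univ_adm => //; apply/admP => b v bF vb sv.
rewrite a'E; apply: (aa b) => //; last exact: (Hal b).
by apply/allP => e; rewrite mem_filter => /andP[_ /(allP vb)].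
Qed.

(* An action with a small invariant set [O] on which it is admissible becomes,
   on [O], one of the actions defining [univ]. *)
Lemma univ_action (X : finType) (c : E -> {perm X}) (O : {set X}) :
  #|O| <= M -> (forall e x, x \in O -> c e x \in O) ->
  (forall b w x, b \in F -> all (mem b) w -> wval s w = 1 -> x \in O -> wval c w x = x) ->
  forall w x, wval univ w = 1 -> x \in O -> wval c w x = x.
Proof.
move=> OM Oc Oadm w x w1 xO.
have idx y : y \in O -> index y (enum O) < M.
  by move=> yO; apply: leq_trans OM; rewrite cardE index_mem mem_enum.
have M_gt0 : 0 < M by apply: leq_ltn_trans (idx x xO).
pose i0 : 'I_M := Ordinal M_gt0.
pose g y : 'I_M := insubd i0 (index y (enum O)).
have gE y : y \in O -> g y = index y (enum O) :> nat.
  by move=> yO; rewrite /g val_insubd idx.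
have g_inj : {in O &, injective g}.
  move=> y z yO zO /(congr1 val) /=; rewrite !gE // => E0.
  by rewrite -(nth_index x (s := enum O) (x := y)) ?mem_enum // E0 nth_index ?mem_enum.
pose k (i : 'I_M) := nth x (enum O) i.
have kO (i : 'I_M) : i < #|O| -> k i \in O by move=> iO; rewrite -mem_enum mem_nth -?cardE.
have kg y : y \in O -> k (g y) = y by move=> yO; rewrite /k gE // nth_index ?mem_enum.
have gk (i : 'I_M) : i < #|O| -> g (k i) = i.
  move=> iO; apply: val_inj; rewrite /= gE ?kO // /k index_uniq ?enum_uniq //.
  by rewrite -cardE.
have gO y : y \in O -> g y < #|O| by move=> yO; rewrite gE // cardE index_mem mem_enum.
pose m e (i : 'I_M) : 'I_M := if i < #|O| then g (c e (k i)) else i.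
have m_inj e : injective (m e).
  move=> i j; rewrite /m; case: ifP => iO; case: ifP => jO.
  - move/g_inj; rewrite !Oc ?kO // => /(_ isT isT)/perm_inj E0.
    by rewrite -(gk i) // E0 gk.
  - by move=> E0; rewrite -E0 gO ?Oc ?kO in jO.
  - by move=> E0; rewrite E0 gO ?Oc ?kO in iO.
  - by [].
pose a : {ffun E -> {perm 'I_M}} := [ffun e => perm (@m_inj e)].
have cO v y : y \in O -> wval c v y \in O.
  elim: v y => [|e v IH] y yO; first by rewrite wval_nil perm1.
  by rewrite wval_cons permM IH ?Oc.
have aE v y : y \in O -> wval a v (g y) = g (wval c v y).
  elim: v y => [|e v IH] y yO; first by rewrite !wval_nil !perm1.
  rewrite !wval_cons !permM -IH ?Oc // ffunE permE /m gO // kg //.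
have aN v (i : 'I_M) : #|O| <= i -> wval a v i = i.
  move=> iO; elim: v => [|e v IH]; first by rewrite wval_nil perm1.
  by rewrite wval_cons permM ffunE permE /m ltnNge iO /= IH.
have aadm : adm a.
  apply/admP => b v bF vb sv; apply/permP => i; rewrite perm1.
  have [iO|] := ltnP i #|O|; last exact: aN.
  by rewrite -(gk i iO) aE ?kO // (Oadm b) ?kO.
apply: g_inj => //; first exact: cO.
by rewrite -aE // (univ_adm w1 aadm) perm1.
Qed.

(** The regular action of [gT] on itself is admissible and fits into [M] points. *)
Lemma univ_base w : #|gT| <= M -> wval univ w = 1 -> wval s w = 1.
Proof.
move=> gM w1; pose c e := perm (@mulIg gT (s e)).
have cE v g : wval c v g = g * wval s v.
  elim: v g => [|e v IH] g; first by rewrite !wval_nil perm1 mulg1.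
  by rewrite !wval_cons permM IH permE mulgA.
have := @univ_action gT c setT _ _ _ w 1 w1 (in_setT _).
rewrite cE mul1g cardsT; apply => // b v g _ _ sv _.
by rewrite cE sv mulg1.
Qed.

End Universal.

(** * Two universal extensions: pairs of labels, then stars of labels *)

Section Stages.
Variables (E L : finType) (l1 l2 : E -> L).
Hypothesis l12 : forall e, l1 e != l2 e.

(** The generators are regarded as edges of a multigraph on the labels: [star x] collects those at
    [x], and [pr x y], for distinct labels, those between [x] and [y]. *)
Definition star x := [set e | (l1 e == x) || (l2 e == x)].
Definition pr x y := star x :&: star y.

Lemma prC x y : pr x y = pr y x. Proof. exact: setIC. Qed.

Lemma pr_star e x y z : x != y -> e \in pr x y -> (e \in star z) = (z == x) || (z == y).
Proof.
move=> xy; rewrite !inE ![z == _]eq_sym => /andP[/orP[]/eqP xE /orP[]/eqP yE] //.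
- by move: xy; rewrite -xE -yE eqxx.
- by rewrite xE yE.
- by rewrite xE yE orbC.
- by move: xy; rewrite -xE -yE eqxx.
Qed.

Lemma pr_l e : e \in pr (l1 e) (l2 e).
Proof. by rewrite !inE !eqxx orbT. Qed.

Variables (gT0 : finGroupType) (s0 : E -> gT0) (K : nat).
Hypothesis s0_inv : forall e, s0 e * s0 e = 1.

Definition F1 := [set pr p.1 p.2 | p : L * L & p.1 != p.2].
(** Room for an orbit that meets at most [K] layers in at most [#|gT0|] nodes each, and for the
    regular action of [gT0] even if [K] is zero. *)
Definition M1 := (K.+1 * #|gT0|)%N.
Definition s1 := @univ E gT0 s0 F1 M1.
Local Notation gT1 := {perm {ffun E -> {perm 'I_M1}} * 'I_M1}.
Definition F2 := [set star x | x : L].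
(** Room for all nodes of a chain of at most [K] layers, a node being a subset of ['I_n * gT1]. *)
Definition M2 := (2 ^ (K.+1 * #|{perm {ffun E -> {perm 'I_M1}} * 'I_M1}|))%N.
Definition s2 := @univ E _ s1 F2 M2.

Lemma F1P x y : x != y -> pr x y \in F1.
Proof. by move=> xy; apply/imsetP; exists (x, y); rewrite ?inE. Qed.

Lemma s1_trivial x y w : x != y -> all (mem (pr x y)) w -> wval s0 w = 1 -> wval s1 w = 1.
Proof. by move=> xy; apply: univ_trivial; apply: F1P. Qed.

Lemma s10 w : wval s1 w = 1 -> wval s0 w = 1.
Proof. by apply: univ_base; rewrite /M1 mulSn leq_addr. Qed.

Lemma s2_trivial x w : all (mem (star x)) w -> wval s1 w = 1 -> wval s2 w = 1.
Proof. by apply: univ_trivial; apply: imset_f. Qed.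

Lemma s21 w : wval s2 w = 1 -> wval s1 w = 1.
Proof.
apply: univ_base; apply: ltnW; apply: leq_trans (ltn_expl _ (ltnSn 1)) _.
by rewrite leq_exp2l // mulSn leq_addr.
Qed.

Lemma s1_inv e : s1 e * s1 e = 1.
Proof.
have := @s1_trivial (l1 e) (l2 e) [:: e; e] (l12 e).
by rewrite !wval_cons !wval_nil !mulg1; apply => //=; rewrite !pr_l.
Qed.

Lemma s2_inv e : s2 e * s2 e = 1.
Proof.
have := @s2_trivial (l1 e) [:: e; e].
rewrite !wval_cons !wval_nil !mulg1 s1_inv; apply => //=.
by have := pr_l e; rewrite inE => /andP[->].
Qed.

(** A filter that takes or leaves together all generators between two given labels. Such filters
    preserve relations in [s1] and [s2]. *)
Definition const_on (al : pred E) := forall x y, x != y ->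
  {in pr x y, al =1 predT} \/ {in pr x y, al =1 pred0}.

Lemma const_star z : const_on (mem (star z)).
Proof.
move=> x y xy; case zE: ((z == x) || (z == y)).
  by left=> e /(pr_star z xy) eE; rewrite /= eE zE.
by right=> e /(pr_star z xy) eE; rewrite /= eE zE.
Qed.

Lemma const_pr z t : const_on (mem (pr z t)).
Proof.
move=> x y xy.
have [] := const_star z xy; have [] := const_star t xy => /= ht hz.
- by left=> e exy; rewrite /= inE hz //= ht.
all: right => e exy; rewrite /= inE hz ?andbF //= ht //.
Qed.

Lemma s1_retract al w : const_on al -> wval s1 w = 1 -> wval s1 (filter al w) = 1.
Proof.
move=> hal; apply: univ_retract => _ v /imsetP[[x y] /[!inE] xy ->] /= vb sv.
have [h|h] := hal _ _ xy.
  suff -> : filter al v = v by [].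
  by apply/all_filterP/allP => e /(allP vb); apply: h.
by apply: wval_filter0 => e /(allP vb) /h ->.
Qed.

Lemma s2_retract al w : const_on al -> wval s2 w = 1 -> wval s2 (filter al w) = 1.
Proof.
move=> hal; apply: univ_retract => b v _ _; exact: s1_retract.
Qed.

Section Chain.
Variables (n : nat) (x : nat -> L) (W : nat -> seq E).
Hypothesis nK : n <= K.
Hypothesis WP : forall i, i < n -> all (mem (star (x i))) (W i).

(* The cosets [prefix_val i * gp s1 (star (x i))], for [i < n], are glued into a
   chain, two consecutive ones along [gp s1 (pr (x i) (x i.+1))]; a [node] is a
   point of this space, as the set of its preimages.  A generator [e] moves the
   nodes of the layers [i] with [e \in star (x i)] and fixes the others.  Under
   [ND] a node has at most two preimages, which makes the action well defined.
   The word [W 0 ... W n.-1] drives the start of the chain to its end. *)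
Definition prefix_val i : gT1 := \prod_(j < i) wval s1 (W j).

Lemma prefix_valS i : prefix_val i.+1 = prefix_val i * wval s1 (W i).
Proof. by rewrite /prefix_val big_ord_recr. Qed.

Definition valid i (v : gT1) := (prefix_val i)^-1 * v \in gp s1 (star (x i)).
Definition glue i (v : gT1) := (prefix_val i.+1)^-1 * v \in gp s1 (pr (x i) (x i.+1)).
Definition conn i j v := [|| j == i, (j == i.+1) && glue i v | (i == j.+1) && glue j v].

Hypothesis ND : forall i v, i.+2 < n -> glue i v -> ~~ glue i.+1 v.

Definition node (i : 'I_n) (v : gT1) : {set 'I_n * gT1} := [set p : 'I_n * gT1 | (p.2 == v) && conn i p.1 v].

Lemma conn_sym i j v : conn i j v = conn j i v.
Proof. by rewrite /conn eq_sym; congr (_ || _); rewrite orbC. Qed.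

Lemma conn_sub (i j k : 'I_n) v : conn i j v -> conn i k v -> conn j k v.
Proof.
have le_k := ltn_ord k; have le_j := ltn_ord j; have le_i := ltn_ord i.
rewrite /conn => /or3P[/eqP->|/andP[/eqP jE gi]|/andP[/eqP iE gj]].
- by [].
- case/or3P=> [/eqP kE|/andP[/eqP kE gk]|/andP[/eqP iE gk]].
  + by rewrite kE jE eqxx gi !orbT.
  + by rewrite kE jE eqxx.
  + have kn : k.+2 < n by rewrite -iE -jE.
    by have := ND kn gk; rewrite -iE gi.
- case/or3P=> [/eqP kE|/andP[/eqP kE gk]|/andP[/eqP iE' gk]].
  + by rewrite kE iE eqxx gj !orbT.
  + have jn : j.+2 < n by rewrite -iE -kE.
    by have := ND jn gj; rewrite -iE gk.
  + by move: iE'; rewrite iE => -[<-]; rewrite eqxx.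
Qed.

Lemma node_eq (i j : 'I_n) v : conn i j v -> node i v = node j v.
Proof.
move=> c; apply/setP => -[k u]; rewrite !inE /=; case: eqP => //= _.
by apply/idP/idP; apply: conn_sub => //; rewrite conn_sym.
Qed.

Lemma node_mem (i : 'I_n) v : (i, v) \in node i v.
Proof. by rewrite inE /= /conn !eqxx. Qed.

Lemma node_inj (i j : 'I_n) v u : node i v = node j u -> v = u /\ conn j i v.
Proof. by move=> E0; have := node_mem i v; rewrite E0 inE /= => /andP[/eqP-> ->]. Qed.

Lemma gp_s (b : {set E}) e : e \in b -> s1 e \in gp s1 b.
Proof. by move=> eb; apply/mem_gen/imset_f. Qed.

Lemma valid_s i v e : e \in star (x i) -> valid i v -> valid i (v * s1 e).
Proof. by move=> eb vi; rewrite /valid mulgA groupM // gp_s. Qed.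

Lemma glue_s i v e : e \in pr (x i) (x i.+1) -> glue i v -> glue i (v * s1 e).
Proof. by move=> eb vi; rewrite /glue mulgA groupM // gp_s. Qed.

Lemma conn_s i j v e : e \in star (x i) -> e \in star (x j) ->
  conn i j v -> conn i j (v * s1 e).
Proof.
move=> ei ej; rewrite /conn => /or3P[->//|/andP[/eqP jE gi]|/andP[/eqP iE gj]].
  by rewrite [glue i _]glue_s ?jE ?eqxx ?orbT // in_setI ei -jE.
by rewrite [glue j _]glue_s ?iE ?eqxx ?orbT // in_setI ej -iE.
Qed.

Definition act e (S : {set 'I_n * gT1}) :=
  if [pick p : 'I_n * gT1 | [&& valid p.1 p.2, e \in star (x p.1) & S == node p.1 p.2]]
    is Some p then node p.1 (p.2 * s1 e) else S.

Lemma act_node e (i : 'I_n) v : valid i v -> e \in star (x i) ->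
  act e (node i v) = node i (v * s1 e).
Proof.
move=> vi ei; rewrite /act; case: pickP => [[j u] /and3P[/= _ ej /eqP]|/(_ (i, v))].
  by move/node_inj => [<- c]; apply: node_eq; apply: conn_s.
by rewrite /= vi ei eqxx.
Qed.

Lemma actP e S : (exists (i : 'I_n) v, [/\ valid i v, e \in star (x i), S = node i v &
   act e S = node i (v * s1 e)]) \/ act e S = S.
Proof.
have [[j u] /and3P[/= vj ej /eqP ->]|noS] := pickP (fun p : 'I_n * gT1 =>
  [&& valid p.1 p.2, e \in star (x p.1) & S == node p.1 p.2]).
  by left; exists j, u; split => //; apply: act_node.
by right; rewrite /act; case: pickP => // p; rewrite noS.
Qed.

Lemma act_inv e : involutive (act e).
Proof.
move=> S; have [[i [v [vi ei -> ->]]]|E0] := actP e S; last by rewrite !E0.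
by rewrite act_node ?valid_s // -mulgA s1_inv mulg1.
Qed.

Definition act_perm e := perm (inv_inj (act_inv e)).

Lemma wval_node w (i : 'I_n) v : valid i v -> all (mem (star (x i))) w ->
  wval act_perm w (node i v) = node i (v * wval s1 w).
Proof.
elim: w v => [|e w IH] v vi /=; first by rewrite !wval_nil perm1 mulg1.
case/andP=> ei wi; rewrite !wval_cons permM permE act_node // IH ?valid_s //.
by rewrite mulgA.
Qed.

Definition in_layer z S := [exists p : 'I_n * gT1,
  [&& valid p.1 p.2, x p.1 == z & S == node p.1 p.2]].

Lemma in_layerP z S : reflect (exists (i : 'I_n) v, [/\ valid i v, x i = z & S = node i v]) (in_layer z S).
Proof.
apply: (iffP existsP) => [[[i v] /= /and3P[? /eqP ? /eqP ?]]|[i [v [? <- ->]]]].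
  by exists i, v.
by exists (i, v); rewrite /= !eqxx andbT; apply/andP.
Qed.

Lemma in_layer_act z e S : e \in star z -> in_layer z (act e S) = in_layer z S.
Proof.
move=> ez; suff H S' : in_layer z S' -> in_layer z (act e S').
  by apply/idP/idP => /H; rewrite ?act_inv.
case/in_layerP=> i [v [vi xi ->]]; apply/in_layerP; exists i, (v * s1 e); split => //.
  by rewrite valid_s ?xi.
by rewrite act_node ?xi.
Qed.

Lemma card_bigcup (I T : finType) (A : I -> {set T}) m :
  (forall i, #|A i| <= m) -> #|\bigcup_i A i| <= (#|I| * m)%N.
Proof.
move=> H; apply: (@leq_trans (\sum_(i : I) #|A i|)).
  elim/big_rec2: _ => [|i k S _ IH]; first by rewrite cards0.
  by rewrite (leq_trans (leq_card_setU _ _)) // leq_add2l.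
by rewrite -sum_nat_const; apply: leq_sum.
Qed.

(* The orbit of a node under [star z] meets a layer with another label in a
   coset of [gp s1 (pr (x i) z)], on which [s1] is determined by [s0]. *)
Lemma card_orbit_layer z (i : 'I_n) v1 (A : {set {set 'I_n * gT1}}) :
  x i != z -> valid i v1 ->
  (forall S, S \in A -> exists v, [/\ valid i v, S = node i v & v1^-1 * v \in gp s1 (star z)]) ->
  #|A| <= #|gT0|.
Proof.
move=> xz v1i AP.
pose G := gp (fun e => (s1 e, s0 e)) (pr (x i) z).
have sub : A \subset [set node i (v1 * p.1) | p in G].
  apply/subsetP => S /AP[v [vi -> vz]].
  have /gpP[w wz wE] := vz.
  have : v1^-1 * v \in gp s1 (star (x i)).
    have := groupM (groupVr v1i) vi.
    by rewrite invMg invgK -!mulgA mulKVg.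
  case/gpP=> u ui uE; apply/imsetP.
  exists (wval s1 (filter (mem (star z)) u), wval s0 (filter (mem (star z)) u)).
    apply/gpP; exists (filter (mem (star z)) u); last by rewrite wval_pair.
    by apply/allP => e; rewrite mem_filter /= in_setI => /andP[-> /(allP ui) /= ->].
  rewrite -[v in LHS](mulKVg v1) uE /=; congr (node i (v1 * _)).
  have : wval s1 (u ++ rev w) = 1.
    by rewrite wval_cat -uE wE wval_rev ?mulgV //; apply: s1_inv.
  move=> uw; have := s1_retract (@const_star z) uw.
  have /all_filterP rw : all (mem (star z)) (rev w) by rewrite all_rev.
  rewrite filter_cat rw wval_cat.
  by rewrite -uw wval_cat => /mulIg ->.
apply: leq_trans (subset_leq_card sub) _; apply: leq_trans (leq_imset_card _ _) _.
have sinj : {in G &, injective snd}.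
  move=> p q pG qG; case/gpP: (groupM pG (groupVr qG)) => w wG.
  case: p {pG} => p1 p2; case: q {qG} => q1 q2; rewrite wval_pair => -[E1 E2] /= E3.
  move: E2; rewrite E3 mulgV => /esym/(s1_trivial xz wG) E4.
  by move: E1; rewrite E4 => /eqP; rewrite -eq_mulgV1 => /eqP->.
by rewrite -(card_in_imset sinj) max_card.
Qed.

(** In a layer labelled [z] the word multiplies by its value in [s1]. A node outside these layers
    has an orbit under [star z] that avoids them, hence by [card_orbit_layer] has at most [M1]
    points. On this orbit the action is admissible over [s0], so the universality of [s1]
    applies. *)
Lemma star_fix z w S : all (mem (star z)) w -> wval s1 w = 1 -> wval act_perm w S = S.
Proof.
move=> wz w1; have [/in_layerP[i [v [vi xi ->]]]|lz] := boolP (in_layer z S).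
  by rewrite wval_node ?xi // w1 mulg1.
have [/existsP[[i0 v0] /= /andP[v0i /eqP SE]]|noS] :=
  boolP [exists p : 'I_n * gT1, valid p.1 p.2 && (S == node p.1 p.2)]; last first.
  elim: w {wz w1} => [|e w IH]; first by rewrite wval_nil perm1.
  rewrite wval_cons permM permE; have [[i [v [vi _ SE _]]]|->//] := actP e S.
  by case/existsP: noS; exists (i, v); rewrite /= vi SE eqxx.
pose O := [set (p : {perm {set 'I_n * gT1}}) S | p in gp act_perm (star z)].
have OP S' : S' \in O -> ~~ in_layer z S' /\
   exists (i : 'I_n) v, [/\ valid i v, S' = node i v & v0^-1 * v \in gp s1 (star z)].
  case/imsetP=> _ /gpP[u uz ->] ->.
  elim/last_ind: u uz => [_|u e IH].
    by rewrite wval_nil perm1; split => //; exists i0, v0; rewrite mulVg group1.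
  rewrite all_rcons => /andP[/= ez /IH[lu [i [v [vi iE vG]]]]].
  rewrite -cats1 wval_cat permM wval_cons wval_nil mulg1 permE; split.
    by rewrite in_layer_act.
  have [[j [v' [vj ej SE' ->]]]|->] := actP e (wval act_perm u S); last by exists i, v.
  have vE : v = v' by move: SE'; rewrite iE => /node_inj[].
  exists j, (v' * s1 e); split; rewrite ?valid_s // -vE mulgA groupM //.
  exact: gp_s.
have Ocard : #|O| <= M1.
  pose A (i : 'I_n) := [set S' in O | [exists v, valid i v && (S' == node i v)]].
  have sub : O \subset \bigcup_i A i.
    apply/subsetP => S' S'O; have [_ [i [v [vi iE _]]]] := OP _ S'O.
    apply/bigcupP; exists i => //; rewrite inE S'O; apply/existsP; exists v.
    by rewrite vi iE eqxx.
  apply: leq_trans (subset_leq_card sub) _.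
  apply: (@leq_trans (#|'I_n| * #|gT0|)%N); last first.
    by rewrite card_ord leq_mul // ltnW.
  apply: card_bigcup => i.
  have [->|[S1 /[!inE]/andP[S1O /existsP[v1 /andP[v1i /eqP S1E]]]]] := set_0Vmem (A i).
    by rewrite cards0.
  have tr S' v : S' \in O -> S' = node i v -> v0^-1 * v \in gp s1 (star z).
    by move=> /OP[_ [j [u [_ ->]]]] uG /node_inj[<-].
  have [l1' _] := OP _ S1O.
  apply: (@card_orbit_layer z i v1) => //.
    by apply: contra l1' => /eqP xz; apply/in_layerP; exists i, v1.
  move=> S' /[!inE]/andP[S'O /existsP[v /andP[vi /eqP SE']]]; exists v; split => //.
  have := groupM (groupVr (tr _ _ S1O S1E)) (tr _ _ S'O SE').
  by rewrite invMg invgK !mulgA mulgK.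
(* Generators outside [star z] are made trivial, so that [O] is invariant under all generators. *)
pose c e := if e \in star z then act_perm e else 1.
have cE u : wval c u = wval act_perm (filter (mem (star z)) u) by rewrite -wval_perm_if.
rewrite -[w in LHS](all_filterP wz) -cE.
apply: (@univ_action E gT0 s0 F1 M1 _ c O Ocard) => //; first 1 last.
- move=> _ u S' /imsetP[[a b] /[!inE] ab ->] /= uab su S'O.
  rewrite cE.
  have [l' _] := OP _ S'O.
  (* In a layer labelled [y] the word acts through its value in [s1], which is trivial. Otherwise
     the node lies in no layer labelled [z] or [y], and no generator of [pr z y] moves it. *)
  have key y : y != z -> all (mem (pr z y)) u -> wval act_perm u S' = S'.
    move=> yz uz; have [/in_layerP[i [v [vi xi iE]]]|ly] := boolP (in_layer y S').
      rewrite iE wval_node ?xi //.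
        by rewrite (s1_trivial _ uz su) ?mulg1 // eq_sym.
      by apply/allP => e /(allP uz); rewrite /= in_setI => /andP[].
    elim: u uz {su uab} => [_|e u IH /= /andP[ez /IH uz]]; first by rewrite wval_nil perm1.
    rewrite wval_cons permM permE; have [[i [v [vi ei iE _]]]|->//] := actP e S'.
    move: ei; rewrite (pr_star _ _ ez); last by rewrite eq_sym.
    case/orP=> /eqP xi; first by case/in_layerP: l'; exists i, v.
    by case/in_layerP: ly; exists i, v.
  have [zE|zab] := boolP ((z == a) || (z == b)).
    rewrite (all_filterP _); last first.
      by apply/allP => e /(allP uab) eab; rewrite /= (pr_star z ab eab).
    case/orP: zE => /eqP zE; rewrite -zE in ab uab.
      by apply: (key b) => //; rewrite eq_sym.
    by apply: (key a) => //; rewrite prC.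
  suff -> : filter (mem (star z)) u = [::] by rewrite wval_nil perm1.
  apply/eqP; rewrite -size_eq0 size_filter -leqn0 leqNgt -has_count.
  by apply/hasPn => e /(allP uab) eab; rewrite /= (pr_star z ab eab).
- by apply/imsetP; exists 1; rewrite ?group1 ?perm1.
move=> e S' /imsetP[p pG ->]; rewrite /c; case: ifP => ez; last first.
  by rewrite perm1; apply/imsetP; exists p.
apply/imsetP; exists (p * act_perm e); rewrite ?permM // groupM //.
by apply/mem_gen/imset_f.
Qed.

(** By [star_fix] the chain is an admissible action for [s2], so the word fixes every node; yet it
    carries a node of the first layer to one of the last, and for [n > 2] these layers have no node
    in common. *)
Lemma chain_absurd : 2 < n -> wval s2 (flatten (mkseq W n)) <> 1.
Proof.
move=> n3 w2.
have cardX : #|[set: {set 'I_n * gT1}]| <= M2.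
  rewrite -powersetT card_powerset cardsT card_prod card_ord leq_exp2l // leq_mul2r.
  by rewrite (leq_trans nK) ?orbT.
have fix0 (S : {set 'I_n * gT1}) : wval act_perm (flatten (mkseq W n)) S = S.
  apply: (univ_action cardX _ _ w2) => // _ u S' /imsetP[z _ ->] uz u1 _.
  exact: (star_fix _ uz u1).
pose i0 : 'I_n := Ordinal (ltn_trans (ltnW (ltnSn 1)) n3).
have walk i (hi : i < n) :
    wval act_perm (flatten (mkseq W i.+1)) (node i0 1) = node (Ordinal hi) (prefix_val i.+1)
    /\ valid i (prefix_val i.+1).
  have vS j (hj : j < n) : valid j (prefix_val j.+1).
    by rewrite /valid prefix_valS mulKg; apply/gpP; exists (W j); rewrite ?WP.
  split; last exact: vS.
  have v0 j : valid j (prefix_val j) by rewrite /valid mulVg group1.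
  elim: i hi => [|i IH] hi.
    rewrite /mkseq /= cats0 (_ : node i0 1 = node (Ordinal hi) (prefix_val 0)); last first.
      by rewrite /prefix_val big_ord0; apply: node_eq; rewrite /conn eqxx.
    by rewrite wval_node // ?WP // -prefix_valS.
  rewrite /mkseq -addn1 iotaD map_cat flatten_cat wval_cat permM add0n.
  have hi' : i < n by apply: ltnW.
  rewrite (IH hi') /= cats0 (_ : node (Ordinal hi') _ = node (Ordinal hi) (prefix_val i.+1)).
    by rewrite wval_node // ?WP // -prefix_valS addn1.
  by apply: node_eq; rewrite /conn /= eqxx /glue mulVg group1 orbT.
have hn : n.-1 < n by rewrite prednK // (leq_trans _ n3).
have nE : n.-1.+1 = n by rewrite prednK // (leq_trans _ n3).
have [+ _] := walk _ hn; rewrite nE fix0 => /node_inj[_].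
rewrite /conn /= => /orP[/eqP E0|/andP[/eqP E0 _]]; have := n3.
  by rewrite -nE -E0.
by rewrite -nE E0.
Qed.

End Chain.

(** By [chain_absurd] some group element is glued on both sides of layer [i.+1]. Compared with the
    two prefix values around [W i.+1], it factors [W i.+1] into a word over each of the two pairs of
    labels. This relation of [s1] lies in one star, so it holds in [s2]. *)
Lemma chain_degenerate n x W : 2 < n <= K ->
  (forall i, i < n -> all (mem (star (x i))) (W i)) ->
  wval s2 (flatten (mkseq W n)) = 1 ->
  exists i u v, [/\ i.+2 < n, all (mem (pr (x i) (x i.+1))) u,
    all (mem (pr (x i.+1) (x i.+2))) v & wval s2 (W i.+1 ++ rev (u ++ v)) = 1].
Proof.
move=> /andP[n3 nK] WP w1.
have [/existsP[i /existsP[v /and3P[i2 gi gi1]]]|noD] := boolP [exists i : 'I_n,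
    exists v, [&& i.+2 < n, glue x W i v & glue x W i.+1 v]]; last first.
  case: (chain_absurd nK WP _ n3 w1) => i v i2 gi; apply: contra noD => gi1.
  have i_n : i < n by apply: ltn_trans i2; apply: ltnW.
  by apply/existsP; exists (Ordinal i_n); apply/existsP; exists v; apply/and3P.
have [u uP uE] := gpP _ _ _ gi; have [u' uP' uE'] := gpP _ _ _ gi1.
exists i, u, (rev u'); split; rewrite ?all_rev //.
apply: (@s2_trivial (x i.+1)).
  rewrite all_cat WP ?(ltnW i2) // all_rev all_cat all_rev /=.
  apply/andP; split; [move: uP|move: uP']; apply: sub_all => e;
  by rewrite /= in_setI => /andP[].
rewrite wval_cat wval_rev ?wval_cat ?wval_rev //; try exact: s1_inv.
rewrite -uE -uE' (prefix_valS _ i.+1); set a := prefix_val W _; set b := wval _ _.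
by rewrite !invMg !invgK !mulgA mulgV mul1g mulgK mulVg.
Qed.

End Stages.

Section AcyclicGroup.
Variables (E L I : finType) (l1 l2 : E -> L) (s0 : E -> {perm I}) (K : nat).
Hypothesis l12 : forall e, l1 e != l2 e.
Hypothesis s0_inv : forall e, s0 e * s0 e = 1.
Local Notation star := (star l1 l2).
Local Notation pr := (pr l1 l2).

Theorem acyclic_group : exists (gT : finGroupType) (s : E -> gT) (phi : gT -> {perm I}),
  [/\ {morph phi : g h / g * h}, forall e, phi (s e) = s0 e,
      forall e, s e * s e = 1,
      forall al w, const_on l1 l2 al -> wval s w = 1 -> wval s (filter al w) = 1
    & forall n x W, 2 < n <= K ->
      (forall i, i < n -> all (mem (star (x i))) (W i)) ->
      wval s (flatten (mkseq W n)) = 1 ->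
      exists i u v, [/\ i.+2 < n, all (mem (pr (x i) (x i.+1))) u,
        all (mem (pr (x i.+1) (x i.+2))) v & wval s (W i.+1 ++ rev (u ++ v)) = 1]].
Proof.
pose t := s2 l1 l2 s0 K.
(* Keeping [s0] as a second component makes [phi] a projection, without affecting which words are
   trivial. *)
pose s e := (t e, s0 e).
have sE w : wval s w = 1 <-> wval t w = 1.
  rewrite wval_pair; split=> [[-> //]|tw].
  by rewrite tw (s10 (s21 tw)).
exists _, s, snd; split=> //.
- by move=> e; rewrite /s; congr (_, _); [apply: s2_inv | apply: s0_inv].
- by move=> al w hal /sE tw; apply/sE; apply: s2_retract.
move=> n x W nK WP /sE tw; have [i [u [v [i2 uP vP uv]]]] := chain_degenerate l12 s0_inv nK WP tw.
by exists i, u, v; split => //; apply/sE.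
Qed.

End AcyclicGroup.

(** * Small sets in a space of glued pieces *)

Section Local.
Variables (E L : finType) (l1 l2 : E -> L).
Hypothesis l12 : forall e, l1 e != l2 e.
Local Notation star := (star l1 l2).
Local Notation pr := (pr l1 l2).
Variables (gT : finGroupType) (s : E -> gT) (K : nat).
Hypothesis s_inv : forall e, s e * s e = 1.
Hypothesis retr : forall al w, const_on l1 l2 al -> wval s w = 1 -> wval s (filter al w) = 1.
Hypothesis acyc : forall n x W, 2 < n <= K ->
  (forall i, i < n -> all (mem (star (x i))) (W i)) ->
  wval s (flatten (mkseq W n)) = 1 ->
  exists i u v, [/\ i.+2 < n, all (mem (pr (x i) (x i.+1))) u,
    all (mem (pr (x i.+1) (x i.+2))) v & wval s (W i.+1 ++ rev (u ++ v)) = 1].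

Variables (V : finType) (lab : V -> L) (inp : gT -> V -> bool).
Hypothesis inp_coset : forall h k v, inp h v -> inp k v -> h^-1 * k \in gp s (star (lab v)).
Hypothesis inp_mul : forall h g v, inp h v -> g \in gp s (star (lab v)) -> inp (h * g) v.
Hypothesis inp_lab : forall h u v, inp h u -> inp h v -> lab u = lab v -> u = v.

(** Read [inp h v] as: the piece at [h] contains [v]. The elements [h] with this property form a
    left coset of the subgroup of the label of [v], or the empty set. *)
Definition co u v := [exists h, inp h u && inp h v].

Lemma coP u v : reflect (exists h, inp h u /\ inp h v) (co u v).
Proof.
by apply: (iffP existsP) => -[h] => [/andP[? ?]|[? ?]]; exists h => //; apply/andP.
Qed.

Lemma coC u v : co u v = co v u.
Proof. by apply/coP/coP => -[h [? ?]]; exists h. Qed.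

Lemma gp_mono (b b' : {set E}) g : b \subset b' -> g \in gp s b -> g \in gp s b'.
Proof. by move=> sb; apply/subsetP/genS/imsetS. Qed.

(** When a word over [star x] equals a word over [star y], filtering their quotient by [star y]
    keeps the second word and cuts the first one down to [pr x y]. *)
Lemma gp_meet x y g : x != y -> g \in gp s (star x) -> g \in gp s (star y) ->
  g \in gp s (pr x y).
Proof.
move=> xy /gpP[u ux uE] /gpP[w wy wE]; apply/gpP.
exists (filter (mem (star y)) u).
  by apply/allP => e; rewrite mem_filter /= in_setI => /andP[-> /(allP ux) /= ->].
have uw : wval s (u ++ rev w) = 1 by rewrite wval_cat wval_rev // -uE -wE mulgV.
have := retr (const_star l1 l2 y) uw.
have /all_filterP rw : all (mem (star y)) (rev w) by rewrite all_rev.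
by rewrite filter_cat rw wval_cat -uw wval_cat uE => /mulIg ->.
Qed.

(** The passage from one shared piece to the next at a vertex multiplies by an element of the
    subgroup of its label, and around the cycle the product is 1. The factorisation provided by
    [acyc] then yields a piece through three consecutive vertices. *)
Lemma cycle_common d (vs : seq V) : 2 < size vs <= K ->
  (forall i, i.+1 < size vs -> co (nth d vs i) (nth d vs i.+1)) ->
  co (last d vs) (head d vs) ->
  exists i, i.+2 < size vs /\
    exists h, [/\ inp h (nth d vs i), inp h (nth d vs i.+1) & inp h (nth d vs i.+2)].
Proof.
set n := size vs => nK co_next co_last.
have n_gt0 : 0 < n by case/andP: nK => /ltnW/ltnW.
pose nxt i := if i.+1 == n then 0 else i.+1.
pose P i h := inp h (nth d vs i) && inp h (nth d vs (nxt i)).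
pose hh i := odflt 1 [pick h | P i h].
have hhP i : i < n -> P i (hh i).
  move=> i_n; rewrite /hh; case: pickP => //= nP.
  suff /coP[h [h1 h2]] : co (nth d vs i) (nth d vs (nxt i)).
    by have := nP h; rewrite /P h1 h2.
  rewrite /nxt; case: eqP => [E0|/eqP ne]; last by apply: co_next; rewrite ltn_neqAle ne.
  by rewrite nth0 (_ : i = n.-1) ?nth_last // -E0.
(* Index 0 refers back to the last piece, so that the product around the cycle telescopes to 1. *)
pose g i := (hh (if i is i'.+1 then i' else n.-1))^-1 * hh i.
have gG i : i < n -> g i \in gp s (star (lab (nth d vs i))).
  move=> i_n; apply: inp_coset; last by case/andP: (hhP i i_n).
  case: i i_n => [|i] i_n.
    have /hhP/andP[_] : n.-1 < n by rewrite prednK.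
    by rewrite /nxt prednK // eqxx.
  by have /andP[_] := hhP i (ltnW i_n); rewrite /nxt ltn_eqF.
have exW i : exists w, (i < n) ==> (all (mem (star (lab (nth d vs i)))) w && (wval s w == g i)).
  have [/gG/gpP[w wP ->]|_] := ltnP i n; last by exists [::].
  by exists w; rewrite wP eqxx.
pose W i := xchoose (exW i).
have WP i : i < n -> all (mem (star (lab (nth d vs i)))) (W i) /\ wval s (W i) = g i.
  by move=> i_n; have /implyP/(_ i_n)/andP[? /eqP] := xchooseP (exW i).
have prodW m : m < n -> wval s (flatten (mkseq W m.+1)) = (hh n.-1)^-1 * hh m.
  elim: m => [|m IH] m_n.
    by rewrite /mkseq /= cats0; case: (WP _ m_n).
  rewrite /mkseq -addn1 iotaD map_cat flatten_cat wval_cat add0n.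
  rewrite (IH (ltnW m_n)) /= cats0; case: (WP _ m_n) => _ ->.
  by rewrite /g mulgA mulgK.
have [|i [u [v [i2 uP vP]]]] := @acyc n (fun i => lab (nth d vs i)) W nK (fun i h => (WP i h).1).
  by rewrite -[n in mkseq W n]prednK // prodW ?prednK // mulVg.
have [_ WE] := WP i.+1 (ltnW i2).
rewrite wval_cat wval_rev // WE wval_cat /g => gE.
exists i; split => //; exists (hh i * wval s u).
have i_n : i < n by apply: ltnW; apply: ltnW.
have /andP[h1 h2] := hhP i i_n; have /andP[h3 h4] := hhP i.+1 (ltnW i2).
rewrite /nxt ltn_eqF ?(ltnW i2) // in h2; rewrite /nxt ltn_eqF // in h4.
have uG : wval s u \in gp s (pr (lab (nth d vs i)) (lab (nth d vs i.+1))).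
  by apply/gpP; exists u.
have vG : wval s v \in gp s (pr (lab (nth d vs i.+1)) (lab (nth d vs i.+2))).
  by apply/gpP; exists v.
split.
- by apply: inp_mul => //; apply: gp_mono uG; apply: subsetIl.
- by apply: inp_mul => //; apply: gp_mono uG; apply: subsetIr.
have -> : hh i * wval s u = hh i.+1 * (wval s v)^-1.
  apply: (canRL (mulgK _)); rewrite -mulgA; apply: (canLR (mulKVg _)).
  by move/eqP: gE; rewrite -eq_mulgV1 => /eqP->.
by apply: inp_mul => //; rewrite groupV; apply: gp_mono vG; apply: subsetIr.
Qed.

Lemma co_book h z d1 d2 : 2 < K -> ~~ inp h z -> inp h d1 -> inp h d2 ->
  co z d1 -> co z d2 ->
  exists k, [/\ inp k z, inp k d1, inp k d2, h^-1 * k != 1 &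
    d1 != d2 -> h^-1 * k \in gp s (pr (lab d1) (lab d2))].
Proof.
move=> K3 hz h1 h2 z1 z2.
have [||i [i2 [k [k1 kz k2]]]] := @cycle_common z [:: d1; z; d2] K3.
- by move=> [|[|i]] //= _; rewrite // coC.
- by apply/coP; exists h.
have i0 : i = 0 by case: i i2 {k1 kz k2}.
rewrite {i i2}i0 /= in k1 kz k2; exists k; split => //.
  by apply: contra hz => /eqP hk; rewrite -[h]mulg1 -hk mulKVg.
move=> d12; apply: gp_meet; try exact: inp_coset.
by apply: contra d12 => /eqP /(inp_lab h1 h2) ->.
Qed.

(* A vertex outside a piece cannot be joined to three of its vertices: the
   three connecting elements lie in [gp s (pr _ _)] for distinct pairs. *)
Lemma co_book3 h z d1 d2 d3 : 2 < K -> ~~ inp h z -> inp h d1 -> inp h d2 -> inp h d3 ->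
  co z d1 -> co z d2 -> co z d3 -> d1 != d2 -> d2 != d3 -> d3 != d1 -> False.
Proof.
move=> K3 hz h1 h2 h3 z1 z2 z3 d12 d23 d31.
have [k [kz k1 k2 hk /(_ d12) aG]] := co_book K3 hz h1 h2 z1 z2.
have [m [mz m2 m3 _ /(_ d23) bG]] := co_book K3 hz h2 h3 z2 z3.
have nl u v g : inp g u -> inp g v -> u != v -> lab u != lab v.
  by move=> gu gv; apply: contra => /eqP/(inp_lab gu gv) ->.
have nz d : inp h d -> z != d by move=> hd; apply: contra hz => /eqP->.
have cG : k^-1 * m \in gp s (pr (lab z) (lab d2)).
  by apply: gp_meet; rewrite ?inp_coset // (nl _ _ k) ?nz.
have [a aP aE] := gpP _ _ _ aG; have [b bP bE] := gpP _ _ _ bG.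
have [c cP cE] := gpP _ _ _ cG.
have : wval s (a ++ c ++ rev b) = 1.
  by rewrite !wval_cat wval_rev // -aE -bE -cE invMg invgK !mulgA mulgK mulgK mulVg.
move/(retr (const_pr l1 l2 (lab d1) (lab d2))).
have l_12 := nl _ _ _ h1 h2 d12; have l_23 := nl _ _ _ h2 h3 d23.
have l_31 := nl _ _ _ h3 h1 d31.
have l_z1 := nl _ _ _ kz k1 (nz _ h1); have l_z2 := nl _ _ _ kz k2 (nz _ h2).
rewrite !filter_cat !wval_cat (all_filterP aP) -aE.
rewrite (@wval_filter0 _ _ s _ c); last first.
  move=> e /(allP cP) /= ec; rewrite in_setI (pr_star _ l_z2 ec).
  by rewrite eq_sym (negbTE l_z1) (negbTE l_12).
rewrite (@wval_filter0 _ _ s _ (rev b)) ?mulg1; first by move/eqP; rewrite (negbTE hk).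
move=> e; rewrite mem_rev => /(allP bP) /= eb; rewrite in_setI (pr_star _ l_23 eb).
by rewrite (negbTE l_12) eq_sym (negbTE l_31).
Qed.

Section Split.
Variable S : {set V}.
Hypothesis SK : #|S| + 3 <= K.
Let K3 : 2 < K. Proof. by apply: leq_trans SK; rewrite addnC. Qed.

Section Component.
Variables (h : gT) (a : V).
Hypotheses (aS : a \in S) (ha : ~~ inp h a).

Definition out := [set v in S | ~~ inp h v].
Definition oute u v := [&& u \in out, v \in out & co u v].
Definition component := [set z | connect oute a z].
Definition attach := [set d in S | inp h d && [exists z in component, co z d]].

Lemma component_out z : z \in component -> z \in out.
Proof.
rewrite inE => /connectP[p]; elim/last_ind: p => [_ ->|p y _].
  by rewrite inE aS.
by rewrite last_rcons rcons_path => /andP[_ /and3P[_ yo _]] ->.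
Qed.

Definition walk d z m := [exists p : m.-tuple V, path oute z p && co (last z p) d].

Lemma walkP d z m :
  reflect (exists p, [/\ size p = m, path oute z p & co (last z p) d]) (walk d z m).
Proof.
apply: (iffP existsP) => [[p /andP[? ?]]|[p [/eqP sp ? ?]]].
  by exists p; rewrite size_tuple.
by exists (Tuple sp); apply/andP.
Qed.

(** A shortest walk from [z] to [d] closes up through the piece at [h] and any [d'] in [D]. Three
    consecutive vertices in one piece would shorten the walk unless they are [d'], [z], [z1]; so all
    of [D] is attached to [z1] as well, and the induction advances along the walk. *)
Lemma walk_common d (D : {set V}) z m : d \in S -> inp h d ->
  {in D, forall d', [/\ inp h d', d' \in S & co z d']} -> z \in component ->
  walk d z m -> (forall m', m' < m -> ~~ walk d z m') -> m + 3 <= K ->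
  exists2 z', z' \in component & co z' d && [forall d' in D, co z' d'].
Proof.
move=> dS hd; elim: m z => [|m IH] z DP zC wz wmin mK.
  have /walkP[p [/size0nil-> _ /= zd]] := wz; exists z => //; rewrite zd.
  by apply/forall_inP => d' /DP[].
have /walkP[[|z1 p] [// [sp] /= /andP[zz1 pz1] pd]] := wz.
have wz1 : walk d z1 m by apply/walkP; exists p.
have z1C : z1 \in component.
  by rewrite inE; apply: connect_trans (connect1 zz1); rewrite inE in zC.
apply: (IH z1) => //; last 2 first.
- move=> m' m'm; apply: contra (wmin m'.+1 m'm) => /walkP[q [sq qz1 qd]].
  by apply/walkP; exists (z1 :: q); split; rewrite /= ?sq //; apply/andP.
- by apply: leq_trans mK; rewrite leq_add2r.
move=> d' d'D; have [hd' d'S zd'] := DP d' d'D; split => //.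
pose vs := d' :: z :: z1 :: rcons p d.
have svs : size vs = m + 4 by rewrite /= size_rcons sp !addnS addn0.
have pathvs : path co d' (behead vs).
  rewrite /= coC zd' /= rcons_path pd andbT.
  have sub : subrel oute co by move=> u v /and3P[].
  by rewrite (sub _ _ zz1) (sub_path sub pz1).
have [|||i [i2 [k [k1 k2 k3]]]] := @cycle_common d vs.
- by rewrite svs !addnS addn0; rewrite !addnS addn0 in mK.
- by move=> i Hi; apply: (pathP d pathvs); rewrite -ltnS.
- by rewrite /vs /= last_rcons; apply/coP; exists h.
case: i i2 k1 k2 k3 => [|i] i2 k1 k2 k3; first by apply/coP; exists k.
exfalso.
pose r := z1 :: p.
have sr : size r = m.+1 by rewrite /= sp.
have pr0 : path oute z r by apply/andP.
have last_take j : j <= m.+1 -> last z (take j r) = nth d vs j.+1.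
  move=> jm; have st : size (take j r) = j by rewrite size_takel ?sr.
  rewrite (last_nth d) st -[z :: take j r]/(take j.+1 (z :: r)) nth_take //.
  have -> : nth d vs j.+1 = nth d ((z :: r) ++ [:: d]) j by rewrite /vs /r -cats1.
  by rewrite nth_cat /= sp ltnS jm.
have pr1 j : path oute z (take j r) by move: pr0; rewrite -{1}(cat_take_drop j r) cat_path => /andP[].
have i_m : i < m.+1 by rewrite svs !addnS addn0 !ltnS in i2.
(* A shortcut: if the three vertices end with [d], the walk can stop one vertex earlier; otherwise
   its middle one is skipped. *)
have [im|im] := ltnP i m; last first.
  have iE : i = m by apply/eqP; rewrite eqn_leq im andbT -ltnS.
  case/negP: (wmin i i_m); apply/walkP; exists (take i r); split => //.
    by rewrite size_takel // sr ltnW.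
  rewrite last_take; last by apply: ltnW.
  apply/coP; exists k; split => //; move: k3; rewrite iE.
  by rewrite /vs /= nth_rcons sp ltnn eqxx.
have i1 : i.+1 < size r by rewrite sr ltnS.
have dropE : drop i.+1 r = nth d r i.+1 :: drop i.+2 r by rewrite -drop_nth.
have yE : last z (take i.+2 r) = nth d r i.+1.
  by rewrite (take_nth d) // last_rcons.
case/negP: (wmin m (ltnSn m)); apply/walkP; exists (take i r ++ drop i.+1 r); split.
- by rewrite size_cat size_drop size_takel sr ?subSS ?subnKC // ltnW.
- rewrite cat_path pr1 dropE /=; apply/andP; split => //.
    have ro j : 0 < j <= m.+1 -> last z (take j r) \in out.
      case: j => // j /andP[_ jm]; have := pr1 j.+1; rewrite (take_nth d) ?sr //.
      by rewrite rcons_path last_rcons => /andP[_ /and3P[]].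
    apply/and3P; split.
    - case: (i) im => [|j] jm; first by rewrite take0 /=; apply: component_out.
      by rewrite ro //= ltnW // ltnS ltnW.
    - by rewrite -[nth d p i]/(nth d r i.+1) -yE ro.
    rewrite -[nth d p i]/(nth d r i.+1) -yE !last_take //; last by apply: ltnW.
    by apply/coP; exists k.
  move: pr0; rewrite -{1}(cat_take_drop i.+2 r) cat_path => /andP[_].
  by rewrite yE.
rewrite last_cat dropE /= -[last _ _]/(last z (nth d r i.+1 :: drop i.+2 r)) -dropE.
have -> : last z (drop i.+1 r) = last z r.
  by rewrite -[in RHS](cat_take_drop i.+1 r) last_cat dropE.
by [].
Qed.

Lemma oute_sym : connect_sym oute.
Proof.
apply: sym_connect_sym => u v; rewrite /oute coC.
by case: (u \in out); case: (v \in out).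
Qed.

(** A vertex of the component with the most attachments has all of them: otherwise [walk_common]
    gives a vertex that keeps these and gains a missing one. *)
Lemma attach_common :
  exists2 z, z \in component & {in attach, forall d, co z d}.
Proof.
have aC : a \in component by rewrite inE.
pose N z := [set d in attach | co z d].
have [z zC zmax] := @arg_maxnP _ a (mem component) (fun z => #|N z|) aC.
exists z => // d dA; apply: contraT => zd.
have /[!inE]/and3P[dS hd /exists_inP[z0 z0C z0d]] := dA.
have zz0 : connect oute z z0.
  by move: zC z0C; rewrite !inE oute_sym; apply: connect_trans.
have /connectP[p0 p0P z0E] := zz0.
case/shortenP: p0P z0E => p pP pU _ z0E {p0}.
have ex : exists m, walk d z m.
  by exists (size p); apply/walkP; exists p; rewrite -z0E.
case: (ex_minnP ex) => m wm mmin.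
have mp : m <= size p by apply: mmin; apply/walkP; exists p; rewrite -z0E.
have pS : {subset z :: p <= S}.
  have zo : z \in out by apply: component_out.
  move=> y yp; suff : y \in out by rewrite inE => /andP[].
  move: yp; rewrite inE => /orP[/eqP->//|].
  elim: p z {zC zmax zd zz0 pU z0E ex wm mmin mp zo} pP => //= y' p IH z /andP[/and3P[_ yo _] pP].
  by rewrite inE => /orP[/eqP->//|]; apply: (IH y').
have mK : m + 3 <= K.
  apply: leq_trans SK; rewrite leq_add2r; apply: leq_trans mp _.
  apply: ltnW; rewrite -[_ < _]/(size (z :: p) <= _) -(card_uniqP pU).
  by apply: subset_leq_card; apply/subsetP.
have [||z' z'C /andP[z'd /forall_inP z'N]] := @walk_common d (N z) z m dS hd _ zC wm _ mK.
- by move=> d'; rewrite !inE => /andP[/and3P[-> -> _] ->].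
- by move=> m' m'm; apply/negP => /mmin; rewrite leqNgt m'm.
have := zmax z' z'C; rewrite /= leqNgt => /negP[]; apply: proper_card.
apply/properP; split; last by exists d; rewrite inE dA /=.
by apply/subsetP => d' d'N; rewrite inE z'N // andbT; move: d'N; rewrite inE => /andP[].
Qed.

End Component.

(** Take a piece containing as much of [S] as possible and a component of [S] outside it. The
    attachments of the component, at most two by [co_book3], cut it off from the rest. If the piece
    contained nothing but attachments, some piece would contain them together with a further vertex
    [z], against maximality. *)
Lemma local_split : 1 < #|S| ->
  (exists h, {in S, forall v, inp h v}) \/
  exists D A : {set V},
    [/\ D \subset S, #|D| <= 2,
        {in D &, forall d d', d != d' -> co d d' && (pr (lab d) (lab d') != set0)},
        A \subset S :\: D &
        [/\ A != set0, S :\: D :\: A != set0 &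
            {in A & S :\: D :\: A, forall x y, ~~ co x y}]].
Proof.
move=> S2.
pose Q h := [set v in S | inp h v].
have [h _ hmax] := @arg_maxnP _ (1 : gT) predT (fun h => #|Q h|) isT.
have [SQ|] := boolP (S \subset Q h).
  by left; exists h => v /(subsetP SQ); rewrite inE => /andP[].
case/subsetPn => a aS; rewrite inE aS /= => ha; right.
have [z zC zA] := attach_common aS ha.
have hz : ~~ inp h z by move: (component_out aS ha zC); rewrite inE => /andP[].
have zS : z \in S by move: (component_out aS ha zC); rewrite inE => /andP[].
have AQ d : d \in attach h a -> inp h d /\ d \in S by rewrite inE => /and3P[].
have A2 : #|attach h a| <= 2.
  rewrite leqNgt; apply/negP => /card_gt2P[d1 [d2 [d3 [[D1 D2 D3] [n1 n2 n3]]]]].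
  have [h1 _] := AQ _ D1; have [h2 _] := AQ _ D2; have [h3 _] := AQ _ D3.
  by apply: (co_book3 K3 hz h1 h2 h3); rewrite ?zA.
have [QA|/subsetPn[b bQ bA]] := boolP (Q h \subset attach h a); last first.
  exists (attach h a), (component h a); split=> //.
  - by apply/subsetP => d /AQ[].
  - move=> d d' dA d'A dd'; have [hd _] := AQ _ dA; have [hd' _] := AQ _ d'A.
    have [k [_ _ _ kn /(_ dd')/gpP[w wP kE]]] := co_book K3 hz hd hd' (zA _ dA) (zA _ d'A).
    apply/andP; split; first by apply/coP; exists h.
    case: w wP kE => [_ kE|e w /= /andP[ew _] _]; first by rewrite kE wval_nil eqxx in kn.
    by apply/set0Pn; exists e.
  - apply/subsetP => c /(component_out aS ha); rewrite !inE => /andP[-> hc].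
    by rewrite (negbTE hc).
  split.
  - by apply/set0Pn; exists a; rewrite inE.
  - apply/set0Pn; exists b; move: bQ; rewrite !in_setD bA inE => /andP[-> hb].
    by rewrite !andbT; apply: contraL hb => /(component_out aS ha); rewrite inE => /andP[].
  move=> c y cC; rewrite !in_setD => /and3P[yC yA yS]; apply/negP => cy.
  have [hy|hy] := boolP (inp h y).
    by case/negP: yA; rewrite inE yS hy /=; apply/exists_inP; exists c.
  case/negP: yC; rewrite inE; apply: (@connect_trans _ _ c).
    by rewrite inE in cC.
  by apply: connect1; rewrite /oute (component_out aS ha cC) cy inE yS hy.
(* If the maximum is zero, no vertex of [S] lies in any piece, and [a] alone can be split off. *)
have [Q0|Q0] := posnP #|Q h|.
  exists set0, [set a]; rewrite sub0set cards0 setD0 sub1set aS; split => //.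
    by move=> d d'; rewrite inE.
  split.
  - by apply/set0Pn; exists a; rewrite inE.
  - by move: S2; rewrite (cardsD1 a) aS -card_gt0.
  move=> x y; rewrite inE => /eqP-> _; apply/negP => /coP[k [ka _]].
  have := hmax k isT; rewrite /= Q0 leqn0 cards_eq0 => /eqP/setP/(_ a).
  by rewrite !inE aS ka.
exfalso.
have [k /andP[kz kQ]] : exists k, inp k z && (Q h \subset Q k).
  have [[q qQ]|[q [r [qr qQ]]]] :
      (exists q, Q h = [set q]) \/ exists q r, q != r /\ Q h = [set q; r].
    move: (leq_trans (subset_leq_card QA) A2) Q0; case E0: #|Q h| => [|[|[|n]]] // _ _.
      by left; apply/cards1P; rewrite E0.
    by move/eqP: E0 => /cards2P; right.
  - have : co z q by apply: zA; apply: (subsetP QA); rewrite qQ set11.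
    case/coP=> k [kz kq]; exists k; rewrite kz qQ sub1set inE kq andbT.
    by have := set11 q; rewrite -qQ inE => /andP[].
  have qh : q \in Q h by rewrite qQ set21.
  have rh : r \in Q h by rewrite qQ set22.
  have [hq qS] := AQ _ (subsetP QA _ qh); have [hr rS] := AQ _ (subsetP QA _ rh).
  have [k [kz kq kr _ _]] := co_book K3 hz hq hr (zA _ (subsetP QA _ qh)) (zA _ (subsetP QA _ rh)).
  by exists k; rewrite kz qQ; apply/subsetP => v; rewrite !inE => /orP[]/eqP->; apply/andP.
have := hmax k isT; rewrite /= leqNgt => /negP[]; apply: proper_card.
apply/properP; split => //; exists z; first by rewrite inE zS.
by rewrite inE negb_and hz orbT.
Qed.

End Split.
End Local.

Local Close Scope group_scope.

(** * Amalgams *)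

(* Deleting at most two pairwise nonadjacent vertices [C] from [X] leaves a
   disconnected set if [b] is [false], and a join if [b] is [true]. *)
Definition sep (T : finType) (a : rel T) (b : bool) (X : {set T}) : bool :=
  [exists C : {set T}, exists A : {set T},
    [&& C \subset X, #|C| <= 2, [forall x in C, forall y in C, ~~ a x y],
        A \subset X :\: C & [&& A != set0, X :\: C :\: A != set0 &
        [forall x in A, forall y in X :\: C :\: A, a x y == b]]]].

Lemma sepP (T : finType) (a : rel T) b (X : {set T}) :
  reflect (exists C A : {set T},
    [/\ C \subset X, #|C| <= 2, {in C &, forall x y, ~~ a x y},
        A \subset X :\: C & [/\ A != set0, X :\: C :\: A != set0 &
        {in A & X :\: C :\: A, forall x y, a x y = b}]]) (sep a b X).
Proof.
apply: (iffP existsP) => [[C /existsP[A /and5P[CX C2 Ci AX /and3P[A0 B0 AB]]]]|].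
  exists C, A; split => //.
    by move=> x y xC yC; have /forall_inP/(_ x xC)/forall_inP/(_ y yC) := Ci.
  split => // x y xA yB.
  by have /forall_inP/(_ x xA)/forall_inP/(_ y yB)/eqP := AB.
case=> C [A [CX C2 Ci AX [A0 B0 AB]]]; exists C; apply/existsP; exists A.
apply/and5P; split => //.
  by apply/forall_inP => x xC; apply/forall_inP => y yC; apply: Ci.
apply/and3P; split => //.
by apply/forall_inP => x xA; apply/forall_inP => y yB; rewrite AB.
Qed.

Definition fits (T U : finType) (a : rel T) (X : {set T}) (d : rel U) : bool :=
  [exists f : {ffun T -> U},
    dinjectiveb f X && [forall x in X, forall y in X, d (f x) (f y) == a x y]].

Lemma fitsP (T U : finType) (a : rel T) (X : {set T}) (d : rel U) :
  reflect (exists f : T -> U, {in X &, injective f} /\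
     {in X &, forall x y, d (f x) (f y) = a x y}) (fits a X d).
Proof.
apply: (iffP existsP) => [[f /andP[/dinjectiveP fI fP]]|[f [fI fP]]].
  exists f; split => // x y xX yX.
  by have /forall_inP/(_ x xX)/forall_inP/(_ y yX)/eqP := fP.
exists [ffun x => f x]; apply/andP; split.
  by apply/dinjectiveP => x y xX yX; rewrite !ffunE; apply: fI.
by apply/forall_inP => x xX; apply/forall_inP => y yX; rewrite !ffunE fP.
Qed.

Section Amalgam.
Local Open Scope group_scope.
Variables (H : sgraph) (u v : H).
Hypothesis uv : adj u v.

Let uNv : u != v. Proof. by apply: contraTneq uv => ->; rewrite adj_irrefl. Qed.

Definition delE x y : del u v x y = adj x y && ~~ edge_rel u v x y := erefl.

Lemma del_sym : symmetric (del u v).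
Proof. by move=> x y; rewrite !delE adj_sym edge_relC. Qed.

Lemma del_irr : irreflexive (del u v).
Proof. by move=> x; rewrite delE adj_irrefl. Qed.

Lemma del_uv : del u v u v = false.
Proof. by rewrite delE /edge_rel !eqxx andbF. Qed.

(* The adjacency of two labels is the sum of a bit of each; hence labels can be
   chosen to realise any graph on [H], even when two of them are prescribed. *)
Definition label : finType := (H * {ffun H -> bool})%type.
Implicit Types (p q : label).

Definition label_adj p q := (p.1 != q.1) && (p.2 q.1 (+) q.2 p.1).
Definition blue p q := (p.1 != q.1) && ~~ (p.2 q.1 (+) q.2 p.1).

Lemma label_adj_sym : symmetric label_adj.
Proof. by move=> p q; rewrite /label_adj eq_sym addbC. Qed.

Lemma label_adj_irr : irreflexive label_adj.
Proof. by move=> p; rewrite /label_adj eqxx. Qed.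

Lemma blue_sym : symmetric blue.
Proof. by move=> p q; rewrite /blue eq_sym addbC. Qed.

Lemma blueN p q : blue p q -> label_adj p q = false.
Proof. by rewrite /blue /label_adj => /andP[_ /negbTE->]; rewrite andbF. Qed.

Definition istype (f : {ffun H -> label}) :=
  [forall x, forall y, (x != y) ==>
    ((f x).1 != (f y).1) && (label_adj (f x) (f y) == del u v x y)].

Definition copy_type : finType := {f : {ffun H -> label} | istype f}.

Lemma copy_typeP (t : copy_type) x y : x != y -> (val t x).1 != (val t y).1.
Proof. by case: t => f /= /forallP/(_ x)/forallP/(_ y)/implyP H0 /H0/andP[]. Qed.

Lemma copy_type_st (t : copy_type) x y : label_adj (val t x) (val t y) = del u v x y.
Proof.
have [->|xy] := eqVneq x y; first by rewrite label_adj_irr del_irr.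
by case: t => f /= /forallP/(_ x)/forallP/(_ y)/implyP/(_ xy)/andP[_ /eqP].
Qed.

Lemma copy_type_blue (t : copy_type) x y : x != y -> ~~ del u v x y -> blue (val t x) (val t y).
Proof.
by move=> xy; rewrite -(copy_type_st t) /label_adj /blue copy_typeP //.
Qed.

Lemma copy_type_inj (t : copy_type) : injective (val t).
Proof.
move=> x y E0; apply/eqP; apply: contraT => /(copy_typeP t).
by rewrite E0 eqxx.
Qed.

Lemma root_exists p q : blue p q -> exists t : copy_type, val t u = p /\ val t v = q.
Proof.
case: p q => [i chi] [j psi] /andP[/= ij Nx].
pose si := tperm u i * tperm (tperm u i v) j.
have tv : tperm u i v != i by rewrite -[X in _ != X](tpermL u i) (inj_eq perm_inj) eq_sym.
have siu : si u = i by rewrite permM tpermL tpermD // eq_sym.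
have siv : si v = j by rewrite permM tpermL.
(* The labels of [u] and [v] are prescribed. The bit of another vertex towards [u] or [v] corrects
   the prescribed bit; between two other vertices the one with smaller [enum_rank] carries the
   adjacency. *)
pose om (w : H) : {ffun H -> bool} := if w == u then chi else if w == v then psi else
  [ffun z => let w' := si^-1 z in
    if w' == u then del u v w u (+) chi (si w) else
    if w' == v then del u v w v (+) psi (si w) else
    (enum_rank w < enum_rank w') && del u v w w'].
pose f : {ffun H -> label} := [ffun w => (si w, om w)].
have fP : istype f.
  apply/forallP => x; apply/forallP => y; apply/implyP => xy.
  rewrite /f /label_adj !ffunE /= (inj_eq perm_inj) xy /=; apply/eqP; rewrite /om.
  have vu : v == u = false by rewrite eq_sym (negbTE uNv).
  have [xu|xu] := eqVneq x u; have [yu|yu] := eqVneq y u.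
  - by rewrite xu yu eqxx in xy.
  - have [yv|yv] := eqVneq y v; first by rewrite xu yv siu siv del_uv; apply/negbTE.
    by rewrite !ffunE permK xu eqxx addbC -addbA addbb addbF del_sym.
  - have [xv|xv] := eqVneq x v.
      by rewrite xv yu siu siv del_sym del_uv addbC; apply/negbTE.
    by rewrite !ffunE permK yu eqxx -addbA addbb addbF.
  have [xv|xv] := eqVneq x v; have [yv|yv] := eqVneq y v.
  - by rewrite xv yv eqxx in xy.
  - by rewrite !ffunE permK xv vu eqxx addbC -addbA addbb addbF del_sym.
  - by rewrite !ffunE permK yv vu eqxx -addbA addbb addbF.
  rewrite !ffunE !permK (negbTE xu) (negbTE xv) (negbTE yu) (negbTE yv) (del_sym y).
  have : enum_rank x != enum_rank y :> nat.
    by apply: contra xy => /eqP /val_inj /enum_rank_inj ->.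
  by case: ltngtP => //= _ _; rewrite ?addbF.
exists (exist _ f fP); rewrite /= !ffunE siu siv /om !eqxx.
by rewrite [v == u]eq_sym (negbTE uNv).
Qed.

Definition gen : finType := {e : copy_type * (label * label) | blue e.2.1 e.2.2}.
Definition gl1 (e : gen) : label := (val e).2.1.
Definition gl2 (e : gen) : label := (val e).2.2.

Lemma gl12 e : gl1 e != gl2 e.
Proof. by have /andP[pq _] := valP e; apply: contra pq => /eqP; rewrite /gl1 /gl2 => ->. Qed.

Definition root p q (t : copy_type) : copy_type :=
  odflt t [pick t' : copy_type | (val t' u == p) && (val t' v == q)].

Lemma rootP p q t : blue p q -> val (root p q t) u = p /\ val (root p q t) v = q.
Proof.
move=> /root_exists[t' [pE qE]]; rewrite /root.
by case: pickP => [t'' /andP[/eqP ? /eqP ?]//|/(_ t')]; rewrite pE qE !eqxx.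
Qed.

(* [e = (t, (p, q))] leads from a copy of type [t] containing the nonedge [pq]
   to a copy in which [pq] is the missing edge. *)
Definition gs (e : gen) : {perm copy_type} :=
  if (gl1 e \in codom (val (val e).1)) && (gl2 e \in codom (val (val e).1))
  then tperm (val e).1 (root (gl1 e) (gl2 e) (val e).1) else 1.

Lemma gs_inv e : gs e * gs e = 1.
Proof. by rewrite /gs; case: ifP => _; rewrite ?tperm2 ?mulg1. Qed.

Lemma root_codom p q t : blue p q ->
  p \in codom (val (root p q t)) /\ q \in codom (val (root p q t)).
Proof.
by move=> /(rootP t)[pE qE]; split; [rewrite -{1}pE|rewrite -{1}qE]; apply: codom_f.
Qed.

Lemma gs_codom e (t : copy_type) p : e \in star gl1 gl2 p -> p \in codom (val t) ->
  p \in codom (val (gs e t)).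
Proof.
rewrite inE => ep pt; rewrite /gs; case: ifP => [/andP[e1 e2]|_]; last by rewrite perm1.
have [r1 r2] := root_codom (val e).1 (valP e).
case: tpermP => [_|_|_ _] //; case/orP: ep => /eqP <- //.
Qed.

Theorem host_amalgam b (X : {set H}) :
  ~~ sep (@adj H) b X -> ~~ fits (@adj H) X (del u v) -> exists J, addition_host H J.
Proof.
move=> sepX fitX.
have [gT [s [phi [phiM phis s_inv retr acyc]]]] := acyclic_group (#|H| + 3) gl12 gs_inv.
pose p0 w : label := (w, [ffun _ => false]).
have b0 : blue (p0 u) (p0 v) by rewrite /blue /= !ffunE uNv.
have [t0 _] := root_exists b0.
(* The type of the piece at [g]: the group acts on types through [phi]. *)
pose tau g := phi g t0.
(* Pairs whose second component is not a suitable coset lie in no piece and follow the rule for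
   vertices without a common piece. *)
pose V : finType := (label * {set gT})%type.
pose lab (w : V) : label := w.1.
pose cs p g := g *: gp s (star gl1 gl2 p).
pose inp g (w : V) := (lab w \in codom (val (tau g))) && (w.2 == cs (lab w) g).
have inp_coset h k w : inp h w -> inp k w -> h^-1 * k \in gp s (star gl1 gl2 (lab w)).
  by move=> /andP[_ /eqP E1] /andP[_ /eqP E2]; rewrite -mem_lcoset -[_ *: _]E1 E2 lcoset_refl.
have inp_mul h g w : inp h w -> g \in gp s (star gl1 gl2 (lab w)) -> inp (h * g) w.
  move=> + /gpP[l lw ->].
  elim: l h lw => [|e l IH] h /=; first by rewrite wval_nil mulg1.
  case/andP=> ew /IH IHl /andP[hc /eqP hE]; rewrite wval_cons mulgA; apply: IHl.
  apply/andP; split.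
    by rewrite /tau phiM permM phis; apply: gs_codom.
  rewrite hE; apply/eqP/lcoset_eqP; rewrite mem_lcoset invMg mulgKV groupV.
  by apply/mem_gen/imset_f.
have inp_lab h w1 w2 : inp h w1 -> inp h w2 -> lab w1 = lab w2 -> w1 = w2.
  case: w1 w2 => [p1 c1] [p2 c2] /andP[_ /eqP /= ->] /andP[_ /eqP /= ->].
  by rewrite /lab /= => ->.
pose cop := co inp.
pose j (x y : V) := if cop x y then label_adj (lab x) (lab y) else b && (x != y).
pose N (x y : V) := cop x y && blue (lab x) (lab y).
have copC x y : cop x y = cop y x by apply: coC.
have phi1 : phi 1 = 1 by apply: (mulgI (phi 1)); rewrite -phiM !mulg1.
apply: (@host_of_frozen H V j N).
- by move=> x y; rewrite /j copC label_adj_sym eq_sym.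
- by move=> x; rewrite /j label_adj_irr eqxx andbF if_same.
- by move=> x y; rewrite /N copC blue_sym.
- move=> x y /andP[cxy bxy]; rewrite /j cxy (blueN bxy) andbT.
  by apply: contraTneq bxy => ->; rewrite /blue eqxx.
- pose f w : V := (val t0 w, cs (val t0 w) 1).
  have tau1 : tau 1 = t0 by rewrite /tau phi1 perm1.
  have fi w : inp 1 (f w) by apply/andP; split; [rewrite tau1; apply: codom_f | apply: eqxx].
  exists (f u), (f v); apply/andP; split; first by apply/coP; exists 1.
  by apply: copy_type_blue => //; rewrite del_uv.
- apply/negP => /embedsP[f f_inj fP].
  have SH : #|f @: X| <= #|H| by rewrite card_imset // max_card.
  have [X2|X2] := leqP #|f @: X| 1.
    case/fitsP: fitX; exists id; split => // x y xX yX.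
    have -> : x = y.
      by apply: f_inj; exact: (card_le1_eqP X2 (f y) (f x) (imset_f f yX) (imset_f f xX)).
    by rewrite del_irr adj_irrefl.
  have SK : #|f @: X| + 3 <= #|H| + 3 by rewrite leq_add2r.
  have [[h hS]|[D [A [DS D2 DP AS [A0 B0 AB]]]]] :=
      local_split s_inv retr acyc inp_coset inp_mul inp_lab SK X2.
    have hX x : x \in X -> inp h (f x) by move=> xX; apply/hS/imset_f.
    pose g x := odflt u [pick i | val (tau h) i == lab (f x)].
    have gE x : x \in X -> val (tau h) (g x) = lab (f x).
      move=> /hX/andP[/codomP[i iE] _]; rewrite /g; case: pickP => [i' /eqP//|/(_ i)].
      by rewrite iE eqxx.
    case/fitsP: fitX; exists g; split => x y xX yX.
      move=> E0; apply: f_inj; apply: (inp_lab h); try exact: hX.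
      by rewrite -!gE // E0.
    rewrite -fP -(copy_type_st (tau h)) !gE // /j.
    suff -> : cop (f x) (f y) by [].
    by apply/coP; exists h; split; apply: hX.
  case/negP: sepX; apply/sepP; exists (X :&: f @^-1: D), (X :&: f @^-1: A).
  have BE x : x \in X :\: (X :&: f @^-1: D) :\: (X :&: f @^-1: A) ->
      f x \in f @: X :\: D :\: A /\ x \in X.
    rewrite !inE; case xX: (x \in X); rewrite ?andbF //= andbT => /andP[-> ->].
    by rewrite imset_f.
  split.
  - exact: subsetIl.
  - apply: leq_trans D2; rewrite -(card_imset _ f_inj); apply: subset_leq_card.
    by apply/subsetP => _ /imsetP[x /[!inE] /andP[_ xD] ->].
  - move=> x y; rewrite !inE => /andP[xX xD] /andP[yX yD].
    have [->|xy] := eqVneq x y; first by rewrite adj_irrefl.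
    (* A generator joins the two labels; generators exist only for blue pairs, so the separating
       vertices are nonadjacent. *)
    have := DP _ _ xD yD; rewrite (inj_eq f_inj) => /(_ xy)/andP[cxy /set0Pn[e]].
    rewrite -fP /j -/(cop _ _) [cop _ _]cxy in_setI !inE.
    have bl := valP e; have := gl12 e => ne.
    case/andP=> /orP[]/eqP Ex /orP[]/eqP Ey.
    + by rewrite -Ex -Ey label_adj_irr.
    + by rewrite -Ex -Ey (blueN bl).
    + by rewrite -Ex -Ey label_adj_sym (blueN bl).
    + by rewrite -Ex -Ey label_adj_irr.
  - apply/subsetP => x; rewrite !inE => /andP[-> xA]; rewrite andbT /=.
    by have := subsetP AS _ xA; rewrite inE => /andP[].
  split.
  - case/set0Pn: A0 => a aA; have := subsetP AS _ aA; rewrite inE => /andP[_ /imsetP[x xX xE]].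
    by apply/set0Pn; exists x; rewrite !inE xX -xE.
  - case/set0Pn: B0 => a; rewrite !inE => /and3P[aA aD /imsetP[x xX xE]].
    by apply/set0Pn; exists x; rewrite !inE xX -xE aA aD.
  move=> x y; rewrite inE => /andP[xX xA] /BE[yB yX].
  have := AB _ _ _ yB; rewrite inE in xA => /(_ _ xA) /negbTE nc.
  rewrite -fP /j [cop _ _]nc (_ : f x != f y) ?andbT //.
  by apply: contraTneq yB => <-; rewrite inE xA.
move=> x y /andP[/coP[h [hx hy]] bxy].
(* This generator leads from the piece at [h] to one in which [x] and [y] stand for [u] and [v]. *)
pose e : gen := exist _ (tau h, (lab x, lab y)) bxy.
pose k := h * s e; pose t := tau k.
have tE : t = root (lab x) (lab y) (tau h).
  rewrite /t /tau /k phiM permM phis /gs -/(tau h) /gl1 /gl2 /=.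
  by have /andP[-> _] := hx; have /andP[-> _] := hy; rewrite tpermL.
have [tu tv] := rootP (tau h) bxy; rewrite -tE in tu tv.
have kx : inp k x by apply: inp_mul => //; apply/mem_gen/imset_f; rewrite inE eqxx.
have ky : inp k y by apply: inp_mul => //; apply/mem_gen/imset_f; rewrite inE eqxx orbT.
pose f w : V := (val t w, cs (val t w) k).
have kf w : inp k (f w) by apply/andP; split; [apply: codom_f | apply: eqxx].
have cof a c : cop (f a) (f c) by apply/coP; exists k.
exists u, v, f; split; split => //.
- by move=> a c /(congr1 lab) /= /copy_type_inj.
- by apply: (inp_lab k) => //; rewrite -tu.
- by apply: (inp_lab k) => //; rewrite -tv.
- by move=> a c ac nac; rewrite /j cof copy_type_st delE ac.
- move=> a c ac nac; rewrite /N cof /=; apply: copy_type_blue => //.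
  by rewrite delE (negbTE nac).
Qed.

End Amalgam.

(** * Intersection graphs *)

Lemma exists_set_between (T : finType) (X Y : {set T}) n :
  X \subset Y -> #|X| <= n <= #|Y| ->
  exists A : {set T}, [/\ X \subset A, A \subset Y & #|A| = n].
Proof.
move=> XY /andP[+ nY]; elim: n nY => [|n IH] nY Xn.
  by exists X; split => //; apply/eqP; rewrite -leqn0.
have [E0|ne] := eqVneq #|X| n.+1; first by exists X.
have [|A [XA AY An]] := IH (ltnW nY); first by rewrite -ltnS ltn_neqAle ne.
have /properP[_ [y yY yA]] : A \proper Y by rewrite properEcard AY An.
exists (y |: A); split.
- by apply: subset_trans XA (subsetUr _ _).
- by rewrite subUset sub1set yY.
- by rewrite cardsU1 yA An.
Qed.

Lemma exists_inj_into (S T : finType) (X : {set S}) (Y : {set T}) (y0 : T) :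
  #|X| <= #|Y| -> exists f : S -> T, {in X, forall x, f x \in Y} /\ {in X &, injective f}.
Proof.
move=> XY; exists (fun x => nth y0 (enum Y) (index x (enum X))).
have idx x : x \in X -> index x (enum X) < size (enum Y).
  by move=> xX; rewrite -cardE (leq_trans _ XY) // cardE index_mem mem_enum.
split=> [x xX|x y xX yX /eqP]; first by rewrite -mem_enum mem_nth ?idx.
rewrite nth_uniq ?enum_uniq ?idx // => /eqP E0.
by rewrite -(nth_index x (s := enum X) (x := x)) ?mem_enum // E0 nth_index ?mem_enum.
Qed.

Section Typed.
Variables (H : sgraph) (c : nat) (fl : bool).

Definition nb (a : rel H) x := [set y | a x y].

Definition triangle_free := forall x y z : H, adj x y -> adj y z -> adj x z -> False.

(** A choice of the missing edge for a frozen pair whose ends have types [t] and [t']; [M] consists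
    of the vertices of [H] to be represented with unlimited degree. *)
Definition cover (t t' : bool) := exists u v (M : {set H}),
  [/\ adj u v, (u \in M) = t, (v \in M) = t', fl || (M == set0) &
   {in M &, forall x y, x != y -> adj x y} /\
   forall w, w \notin M -> #|nb (del u v) w| <= c].

Lemma delC (u v x y : H) : del u v x y = del v u x y.
Proof. by rewrite /del /edge_rel orbC. Qed.

Lemma cover_sym t t' : cover t t' -> cover t' t.
Proof.
case=> u [v [M [uv uM vM fM [MC Md]]]]; exists v, u, M; split; rewrite // 1?adj_sym //.
split=> // w /Md; suff -> : nb (del v u) w = nb (del u v) w by [].
by apply/setP => z; rewrite !inE delC.
Qed.

Hypothesis tf : triangle_free.
Hypothesis big : if fl then
  exists x y : H, [/\ x != y, ~~ adj x y, c < #|nb (@adj H) x| & c < #|nb (@adj H) y|]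
  else exists x : H, c < #|nb (@adj H) x|.
Hypothesis cov_ss : cover false false.
Hypothesis cov_sb : fl -> cover false true.

Let B := #|H| + c.
(** A point is named after an edge, or serves as padding for a vertex. Two vertices use at most
    [B + B] points together, so one of the [B + B + 1] levels is free of both. *)
Definition plab : finType := ({set H} + H * 'I_B)%type.
Definition pt : finType := (plab * 'I_(B + B).+1)%type.
(* A set of points; the boolean marks the vertices of unlimited degree, which
   are pairwise adjacent; the last component only provides distinct vertices. *)
Definition tvertex : finType := ({set pt} * (bool * (H * 'I_3)))%type.
Implicit Types x y : tvertex.

Definition isb x := fl && x.2.1.
Definition cap x := if isb x then B else c.
(** A set beyond its capacity counts as empty, so that every set of points can be a vertex. *)
Definition eff x := if #|x.1| <= cap x then x.1 else set0.
Definition tadj x y := (x != y) && ((isb x && isb y) || (eff x :&: eff y != set0)).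
Definition tfrozen x y := [&& x != y, ~~ (isb x && isb y), #|x.1| == cap x, #|y.1| == cap y &
  [disjoint x.1 & y.1]].

Lemma eff_le x : #|eff x| <= cap x.
Proof. by rewrite /eff; case: ifP => //; rewrite cards0. Qed.

(** Two neighbours met in the same point would close a triangle, so a vertex of degree above [c]
    must be represented by one of unlimited degree. Without [fl] there are none, and with [fl] two
    nonadjacent vertices of [H] would be represented by adjacent ones. *)
Lemma typed_free : ~~ embeds (@adj H) tadj.
Proof.
apply/negP => /embedsP[f f_inj fP].
have key (w : H) : c < #|nb (@adj H) w| -> isb (f w).
  move=> cw; apply: contraT => wb.
  have effc : #|eff (f w)| <= c by have := eff_le (f w); rewrite /cap (negbTE wb).
  have [p0|[q0 _]] := set_0Vmem (eff (f w)).
    have /set0Pn[z] : nb (@adj H) w != set0 by rewrite -card_gt0 (leq_ltn_trans _ cw).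
    by rewrite inE -fP /tadj (negbTE wb) p0 set0I eqxx andbF.
  pose g z := odflt q0 [pick p in eff (f w) :&: eff (f z)].
  have gP z : z \in nb (@adj H) w -> g z \in eff (f w) :&: eff (f z).
    rewrite inE -fP /tadj (negbTE wb) /= => /andP[_ /set0Pn[p pP]].
    by rewrite /g; case: pickP => // /(_ p); rewrite pP.
  have [z zw [z' z'w [zz' gE]]] : exists2 z, z \in nb (@adj H) w &
      exists2 z', z' \in nb (@adj H) w & z != z' /\ g z = g z'.
    have : ~~ dinjectiveb g (nb (@adj H) w).
      apply/negP => /dinjectiveP/card_in_imset E0.
      have : #|g @: nb (@adj H) w| <= #|eff (f w)|.
        apply: subset_leq_card; apply/subsetP => _ /imsetP[z /gP + ->].
        by rewrite inE => /andP[].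
      by rewrite E0 leqNgt (leq_ltn_trans effc cw).
    case/dinjectivePn => z zw [z' /andP[z'z z'w] E0]; exists z => //; exists z' => //.
    by split; rewrite // eq_sym.
  have : adj z z'.
    rewrite -fP /tadj (inj_eq f_inj) zz' /=; apply/orP; right; apply/set0Pn; exists (g z).
    have := gP _ zw; have := gP _ z'w; rewrite -gE !inE => /andP[_ ->] /andP[_ ->] //.
  move: zw z'w; rewrite !inE => zw z'w zz1.
  by case: (@tf w z z').
move: big; case: ifP => [_ [x [y [xy nxy /key bx /key by0]]]|fF [x /key]].
  by move: nxy; rewrite -fP /tadj bx by0 (inj_eq f_inj) xy.
by rewrite /isb fF.
Qed.

(* The edges at [u] and [v] are represented by points of [x] and [y], all others
   by points on a level [t] that neither [x] nor [y] uses. *)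
Lemma typed_cover x y : tfrozen x y -> exists u v (f : H -> tvertex),
    [/\ adj u v, injective f, f u = x & f v = y] /\
    [/\ forall a b, adj a b -> ~~ edge_rel u v a b -> tadj (f a) (f b)
      & forall a b, a != b -> ~~ adj a b -> tfrozen (f a) (f b)].
Proof.
case/and5P=> xy nb_xy /eqP xc /eqP yc xy_dis.
have [u [v [M [uv uM vM fM [MC Md]]]]] : cover (isb x) (isb y).
  move: nb_xy; case bx: (isb x); case by0: (isb y) => // _.
    by apply/cover_sym/cov_sb; move: bx; rewrite /isb; case: fl.
  by apply: cov_sb; move: by0; rewrite /isb; case: fl.
have uNv : u != v by apply: contraTneq uv => ->; rewrite adj_irrefl.
have B_gt0 : 0 < B by rewrite /B addn_gt0; apply/orP; left; apply/card_gt0P; exists u.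
have nbB a w : #|nb a w| <= B by rewrite (leq_trans (max_card _)) // leq_addr.
have cB : c <= B by rewrite leq_addl.
pose capM w := if w \in M then B else c.
have capM_le w : capM w <= B by rewrite /capM; case: ifP.
have nbM w : #|nb (del u v) w| <= capM w.
  by rewrite /capM; case: ifP => [_|/negbT/Md //]; apply: nbB.
have xM : #|x.1| = capM u by rewrite xc /cap /capM uM.
have yM : #|y.1| = capM v by rewrite yc /cap /capM vM.
pose q0 : pt := (inl set0, ord0).
have [iu [iuP iuI]] : exists f : H -> pt, {in nb (del u v) u, forall z, f z \in x.1} /\
    {in nb (del u v) u &, injective f} by apply: exists_inj_into => //; rewrite xM.
have [iv [ivP ivI]] : exists f : H -> pt, {in nb (del u v) v, forall z, f z \in y.1} /\
    {in nb (del u v) v &, injective f} by apply: exists_inj_into => //; rewrite yM.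
have [t tx] : exists t : 'I_(B + B).+1, forall q, q \in x.1 :|: y.1 -> q.2 != t.
  have : [set q.2 | q in x.1 :|: y.1] \proper setT.
    rewrite properEcard subsetT cardsT card_ord ltnS.
    apply: leq_trans (leq_imset_card _ _) _; apply: leq_trans (leq_card_setU _ _) _.
    by rewrite leq_add // ?xM ?yM.
  case/properP=> _ [t _ tn]; exists t => q qx; apply: contra tn => /eqP <-.
  exact: imset_f.
have [l [lx ly]] : exists l : 'I_3, l != x.2.2.2 /\ l != y.2.2.2.
  have : [set x.2.2.2; y.2.2.2] \proper setT.
    by rewrite properEcard subsetT cardsT card_ord ltnS cards2; case: (_ != _).
  case/properP=> _ [l _]; rewrite !inE negb_or => /andP[? ?]; by exists l.
pose p w z : pt := if z == u then iu w else if z == v then iv w else (inl [set w; z], t).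
pose Bs w := [set p w z | z in nb (@adj H) w].
pose Pad w : {set pt} := [set (inr (w, i), t) | i : 'I_B].
have nb_del w : w != u -> w != v -> nb (del u v) w = nb (@adj H) w.
  move=> wu wv; apply/setP => z; rewrite !inE /del /edge_rel (negbTE wu) (negbTE wv) /=.
  by rewrite andbT.
(* A new vertex takes its edge points and is padded up to exactly its capacity, as [tfrozen]
   demands. *)
have /fin_all_exists[A AP] w : exists D : {set pt}, w != u -> w != v ->
    [/\ Bs w \subset D, D \subset Bs w :|: Pad w & #|D| = capM w].
  have [->|wu] := eqVneq w u; first by exists set0.
  have [->|wv] := eqVneq w v; first by exists set0.
  have [||D DP] := @exists_set_between _ (Bs w) (Bs w :|: Pad w) (capM w).
  - exact: subsetUl.
  - rewrite (leq_trans (leq_imset_card _ _)) -?nb_del //=.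
    apply: (leq_trans (capM_le w)); apply: leq_trans (subset_leq_card (subsetUr _ _)).
    by rewrite card_imset ?card_ord // => i j [].
  by exists D.
pose f w : tvertex := if w == u then x else if w == v then y else (A w, (w \in M, (w, l))).
have fu : f u = x by rewrite /f eqxx.
have fv : f v = y by rewrite /f eqxx eq_sym (negbTE uNv).
have fo w : w != u -> w != v -> f w = (A w, (w \in M, (w, l))).
  by move=> wu wv; rewrite /f (negbTE wu) (negbTE wv).
have casew w : [\/ w = u, w = v | w != u /\ w != v].
  have [->|wu] := eqVneq w u; first by constructor 1.
  by have [->|wv] := eqVneq w v; [constructor 2|constructor 3].
have fb w : isb (f w) = (w \in M).
  case: (casew w) => [->|->|[wu wv]]; rewrite ?fu ?fv ?fo //.
  rewrite /isb /=; case/orP: fM => [->//|/eqP->]; by rewrite inE andbF.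
have fc w : #|(f w).1| = cap (f w).
  case: (casew w) => [->|->|[wu wv]]; rewrite ?fu ?fv //.
  by rewrite /cap fb fo //=; case: (AP w wu wv).
have fe w : eff (f w) = (f w).1 by rewrite /eff fc leqnn.
have nbu w : w != v -> adj w u -> w \in nb (del u v) u.
  move=> wv wu; rewrite inE /del /edge_rel adj_sym wu eqxx (negbTE wv) /=.
  by rewrite (negbTE uNv).
have nbv w : w != u -> adj w v -> w \in nb (del u v) v.
  move=> wu wv; rewrite inE /del /edge_rel adj_sym wv eqxx (negbTE wu) /=.
  by rewrite eq_sym (negbTE uNv).
have f_inj : injective f.
  move=> a b; case: (casew a) => [->|->|[au av]]; case: (casew b) => [->|->|[bu bv]];
    rewrite ?fu ?fv ?fo // => E0.
  - by rewrite E0 eqxx in xy.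
  - by rewrite E0 eqxx in lx.
  - by rewrite E0 eqxx in xy.
  - by rewrite E0 eqxx in ly.
  - by rewrite -E0 eqxx in lx.
  - by rewrite -E0 eqxx in ly.
  by case: E0.
have elim_f w q : w != u -> w != v -> q \in (f w).1 ->
   [\/ q = iu w /\ adj w u, q = iv w /\ adj w v,
       exists z, [/\ adj w z & q = (inl [set w; z], t)] | exists i, q = (inr (w, i), t)].
  move=> wu wv; rewrite fo //= => qA; have [_ /subsetP/(_ q qA) + _] := AP w wu wv.
  rewrite inE => /orP[/imsetP[z /[!inE] wz ->]|/imsetP[i _ ->]]; last first.
    by constructor 4; exists i.
  rewrite /p; have [zu|zu] := eqVneq z u; first by constructor 1; rewrite -zu.
  have [zv|zv] := eqVneq z v; first by constructor 2; rewrite -zv.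
  by constructor 3; exists z.
have intro_f w z : w != u -> w != v -> adj w z -> p w z \in (f w).1.
  move=> wu wv wz; rewrite fo //=; have [/subsetP sub _ _] := AP w wu wv.
  by apply: sub; apply: imset_f; rewrite inE.
have tx1 q : q \in x.1 -> q.2 != t by move=> qx; apply: tx; rewrite inE qx.
have ty1 q : q \in y.1 -> q.2 != t by move=> qy; apply: tx; rewrite inE qy orbT.
have disF q : q \in x.1 -> q \in y.1 -> False.
  by move=> qx qy; move: xy_dis; rewrite disjoint_subset => /subsetP/(_ q qx); rewrite inE qy.
have dis a b q : a != b -> ~~ adj a b -> q \in (f a).1 -> q \in (f b).1 -> False.
  have half a' b' : a' = u \/ a' = v -> b' != u -> b' != v -> ~~ adj a' b' ->
      q \in (f a').1 -> q \in (f b').1 -> False.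
    move=> auv bu bv nab qa /elim_f-/(_ bu bv) qb.
    case: auv nab qa => ->; rewrite ?fu ?fv adj_sym => nab qa; case: qb.
    - by case=> _; rewrite (negbTE nab).
    - by case=> qE /(nbv _ bu)/ivP; rewrite -qE; apply: disF.
    - by case=> z [_ qE]; have := tx1 _ qa; rewrite qE eqxx.
    - by case=> i qE; have := tx1 _ qa; rewrite qE eqxx.
    - by case=> qE /(nbu _ bv)/iuP; rewrite -qE => qx; apply: disF qa.
    - by case=> _; rewrite (negbTE nab).
    - by case=> z [_ qE]; have := ty1 _ qa; rewrite qE eqxx.
    - by case=> i qE; have := ty1 _ qa; rewrite qE eqxx.
  move=> ab nab qa qb.
  case: (casew a) => [aE|aE|[au av]].
  - case: (casew b) => [bE|bE|[bu bv]].
    + by rewrite aE bE eqxx in ab.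
    + by rewrite aE bE uv in nab.
    + by apply: (half a b) => //; left.
  - case: (casew b) => [bE|bE|[bu bv]].
    + by rewrite aE bE adj_sym uv in nab.
    + by rewrite aE bE eqxx in ab.
    + by apply: (half a b) => //; right.
  case: (casew b) => [bE|bE|[bu bv]].
  - by rewrite adj_sym in nab; apply: (half b a) => //; left.
  - by rewrite adj_sym in nab; apply: (half b a) => //; right.
  have := elim_f _ _ au av qa; have := elim_f _ _ bu bv qb.
  case=> [[-> b1]|[-> b1]|[z [bz ->]]|[i ->]].
  - have b2 := nbu _ bv b1; case=> [[E0 a1]|[E0 a1]|[z' [az E0]]|[i E0]].
    + by move/(iuI _ _ b2 (nbu _ av a1)): E0 => E0; rewrite E0 eqxx in ab.
    + by apply: (disF (iu b)); [apply: iuP | rewrite E0; apply/ivP/nbv].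
    + by have := tx1 _ (iuP _ b2); rewrite E0 eqxx.
    + by have := tx1 _ (iuP _ b2); rewrite E0 eqxx.
  - have b2 := nbv _ bu b1; case=> [[E0 a1]|[E0 a1]|[z' [az E0]]|[i E0]].
    + by apply: (disF (iv b)); [rewrite E0; apply/iuP/nbu | apply: ivP].
    + by move/(ivI _ _ b2 (nbv _ au a1)): E0 => E0; rewrite E0 eqxx in ab.
    + by have := ty1 _ (ivP _ b2); rewrite E0 eqxx.
    + by have := ty1 _ (ivP _ b2); rewrite E0 eqxx.
  - case=> [[E0 a1]|[E0 a1]|[z' [az E0]]|[i E0]] //.
    + by have := tx1 _ (iuP _ (nbu _ av a1)); rewrite -E0 eqxx.
    + by have := ty1 _ (ivP _ (nbv _ au a1)); rewrite -E0 eqxx.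
    + case: E0 => /setP/(_ a); rewrite !inE eqxx (negbTE ab) /= => /eqP E1.
      by rewrite adj_sym E1 bz in nab.
  - case=> [[E0 a1]|[E0 a1]|[z' [az E0]]|[j E0]] //.
    + by have := tx1 _ (iuP _ (nbu _ av a1)); rewrite -E0 eqxx.
    + by have := ty1 _ (ivP _ (nbv _ au a1)); rewrite -E0 eqxx.
    + by case: E0 => E0; rewrite E0 eqxx in ab.
have meet a b : adj a b -> ~~ edge_rel u v a b -> exists q, q \in (f a).1 /\ q \in (f b).1.
  have half a' b' : a' = u \/ a' = v -> b' != u -> b' != v -> adj b' a' ->
      exists q, q \in (f a').1 /\ q \in (f b').1.
    move=> auv bu bv ba; exists (p b' a'); split; last exact: intro_f.
    case: auv ba => ->; rewrite ?fu ?fv /p ?eqxx => ba; first by apply/iuP/nbu.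
    by rewrite eq_sym (negbTE uNv); apply/ivP/nbv.
  move=> ab nuv.
  case: (casew a) => [aE|aE|[au av]].
  - case: (casew b) => [bE|bE|[bu bv]].
    + by rewrite aE bE adj_irrefl in ab.
    + by rewrite aE bE /edge_rel !eqxx in nuv.
    + by apply: half => //; [left | rewrite adj_sym].
  - case: (casew b) => [bE|bE|[bu bv]].
    + by rewrite aE bE /edge_rel !eqxx orbT in nuv.
    + by rewrite aE bE adj_irrefl in ab.
    + by apply: half => //; [right | rewrite adj_sym].
  case: (casew b) => [bE|bE|[bu bv]].
  - by have [q [? ?]] := half b a (or_introl bE) au av ab; exists q.
  - by have [q [? ?]] := half b a (or_intror bE) au av ab; exists q.
  exists (p a b); split; first exact: intro_f.
  have -> : p a b = p b a by rewrite /p (negbTE au) (negbTE av) (negbTE bu) (negbTE bv) setUC.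
  by apply: intro_f; rewrite // adj_sym.
have disj a b : a != b -> ~~ adj a b -> [disjoint (f a).1 & (f b).1].
  move=> ab nab; rewrite disjoint_subset; apply/subsetP => q qa; rewrite inE.
  by apply/negP => qb; apply: (dis a b q).
exists u, v, f; split; split => // a b.
  move=> ab /(meet _ _ ab)[q [qa qb]]; rewrite /tadj (inj_eq f_inj) !fe.
  apply/andP; split; first by apply: contraTneq ab => ->; rewrite adj_irrefl.
  by apply/orP; right; apply/set0Pn; exists q; rewrite inE qa.
move=> ab nab; rewrite /tfrozen (inj_eq f_inj) ab !fc !eqxx !fb disj // !andbT /= ?andbT.
by apply/negP => /andP[aM bM]; rewrite MC in nab.
Qed.

Theorem host_typed : exists J, addition_host H J.
Proof.
apply: (@host_of_frozen H tvertex tadj tfrozen).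
- by move=> x y; rewrite /tadj eq_sym andbC [isb x && _]andbC setIC andbC.
- by move=> x; rewrite /tadj eqxx.
- move=> x y; rewrite /tfrozen eq_sym disjoint_sym [isb x && _]andbC.
  by do 2!congr (_ && _); rewrite andbCA.
- move=> x y /and5P[xy nb_xy /eqP xc /eqP yc dis]; rewrite xy /tadj xy (negbTE nb_xy) /=.
  by rewrite negbK /eff xc yc !leqnn setI_eq0.
- have [u [v [M [uv _ _ _ _]]]] := cov_ss.
  have B0 : 0 < B by rewrite /B addn_gt0; apply/orP; left; apply/card_gt0P; exists u.
  pose Y (k : 'I_(B + B).+1) : {set pt} := [set (inr (u, i), k) | i : 'I_B].
  have exA k : exists A : {set pt}, A \subset Y k /\ #|A| = c.
    have [||A [_ ? ?]] := @exists_set_between _ set0 (Y k) c; last by exists A.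
      exact: sub0set.
    by rewrite cards0 card_imset ?card_ord ?leq_addl // => i j [].
  have [A1 [s1 c1]] := exA ord0; have [A2 [s2 c2]] := exA ord_max.
  exists (A1, (false, (u, ord0))), (A2, (false, (v, ord0))).
  rewrite /tfrozen /cap /isb /= andbF c1 c2 !eqxx /=; apply/andP; split.
    apply: contraTneq uv => -[_ ->]; by rewrite adj_irrefl.
  rewrite disjoint_subset; apply/subsetP => q /(subsetP s1)/imsetP[i _ ->].
  rewrite inE; apply/negP => /(subsetP s2)/imsetP[j _ /(congr1 (fun q : pt => val q.2)) /= E0].
  by move: (leq_addr B B); rewrite -E0 leqNgt B0.
- exact: typed_free.
exact: typed_cover.
Qed.
End Typed.

(** * Inseparable sets *)

Section Small.
Variables (T : finType) (a : rel T).
Hypothesis a_sym : symmetric a.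
Implicit Types (A B C X Y : {set T}).

Definition indep X := [forall x in X, forall y in X, ~~ a x y].
Definition small X := (#|X| <= 2) && indep X.

Lemma indepP X : reflect {in X &, forall x y, ~~ a x y} (indep X).
Proof.
apply: (iffP forall_inP) => [H x y xX|H x xX]; first exact: (forall_inP (H x xX)).
by apply/forall_inP => y; apply: H.
Qed.

Lemma indepS X Y : X \subset Y -> indep Y -> indep X.
Proof.
by move=> /subsetP XY /indepP H; apply/indepP => x y /XY xY /XY yY; apply: H.
Qed.

Lemma smallS X Y : X \subset Y -> small Y -> small X.
Proof.
move=> XY /andP[Y2 Yi]; apply/andP; split; last exact: indepS Yi.
exact: leq_trans (subset_leq_card XY) Y2.
Qed.

(** If [X] had vertices off each of the two unions, [X :&: C] would separate it. *)
Lemma insep_side b X C A B : ~~ sep a b X -> small C -> X \subset C :|: A :|: B ->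
  {in A & B, forall x y, a x y = b} -> X \subset C :|: A \/ X \subset C :|: B.
Proof.
move=> nsep /andP[C2 /indepP Ci] /subsetP XC AB.
have [XA|/subsetPn[x xX /[!inE] /norP[xC xA]]] := boolP (X \subset C :|: A); first by left.
have [XB|/subsetPn[y yX /[!inE] /norP[yC yB]]] := boolP (X \subset C :|: B); first by right.
case/negP: nsep; apply/sepP; exists (X :&: C), ((X :&: A) :\: (C :|: B)).
have inB z : z \in X -> z \notin C -> ~~ ((z \in A) && (z \notin B)) -> z \in B.
  move=> /XC; rewrite !inE => /orP[/orP[->//|->]|->] //.
  by move=> _; rewrite negbK.
split.
- exact: subsetIl.
- by apply: leq_trans C2; apply: subset_leq_card; apply: subsetIr.
- by move=> z t /[!inE] /andP[_ zC] /andP[_ tC]; apply: Ci.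
- by apply/subsetP => z /[!inE] /andP[/norP[zC zB] /andP[zX zA]]; rewrite zX zC.
split.
- apply/set0Pn; exists y; rewrite !inE (negbTE yC) (negbTE yB) yX.
  by have := XC _ yX; rewrite !inE (negbTE yC) (negbTE yB) orbF.
- by apply/set0Pn; exists x; rewrite !inE xX (negbTE xC) (negbTE xA) !andbF.
move=> z t; rewrite !inE => /andP[_ /andP[_ zA]] /andP[tA /andP[tC tX]].
rewrite tX /= in tA tC; apply: AB => //; apply: inB => //.
by move: tA; rewrite (negbTE tC) /=; case: (t \in B); case: (t \in A).
Qed.

(** A separator of the union leaves each of [X] and [Y] on one side only. If the sides agree, the
    other side is empty; if they differ, the intersection lies in the separator and is small. *)
Lemma insep_union b X Y : ~~ sep a b X -> ~~ sep a b Y -> ~~ small (X :&: Y) ->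
  ~~ sep a b (X :|: Y).
Proof.
move=> nX nY nS; apply/negP => /sepP[C [A [CX C2 /indepP Ci AX [A0 B0 AB]]]].
set B := _ :\: A in B0 AB.
have sC : small C by apply/andP.
have XY : X :|: Y \subset C :|: A :|: B.
  apply/subsetP => x xX; move: (xX); rewrite !inE => xXY.
  by rewrite xXY andbT; case: (x \in A); case: (x \in C).
have BA x : x \in B -> (x \in A = false) /\ (x \in C = false) /\ x \in X :|: Y.
  by rewrite in_setD in_setD => /andP[/negbTE-> /andP[/negbTE-> ->]].
have AA x : x \in A -> (x \in C = false) /\ x \in X :|: Y.
  by move/(subsetP AX); rewrite in_setD => /andP[/negbTE-> ->].
have [|XA|XB] := insep_side nX sC _ AB; first by apply: subset_trans XY; apply: subsetUl.
  have [|YA|YB] := insep_side nY sC _ AB; first by apply: subset_trans XY; apply: subsetUr.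
    have [x xB] := set0Pn _ B0; have [xA [xC]] := BA x xB.
    by rewrite inE => /orP[/(subsetP XA)|/(subsetP YA)]; rewrite inE xA xC.
  case/negP: nS; apply: smallS sC; apply/subsetP => x; rewrite inE => /andP[xX xY].
  have := subsetP XA _ xX; have := subsetP YB _ xY; rewrite ![x \in _ :|: _]inE.
  by case/orP=> // /BA[-> _]; rewrite orbF.
have [|YA|YB] := insep_side nY sC _ AB; first by apply: subset_trans XY; apply: subsetUr.
  case/negP: nS; apply: smallS sC; apply/subsetP => x; rewrite inE => /andP[xX xY].
  have := subsetP XB _ xX; have := subsetP YA _ xY; rewrite ![x \in _ :|: _]inE.
  by move=> h1 /orP[//|/BA[xA _]]; rewrite xA orbF in h1.
have [x xA] := set0Pn _ A0; have [xC] := AA x xA.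
have xB : x \in B = false by apply/negP => /BA[]; rewrite xA.
by rewrite inE => /orP[/(subsetP XB)|/(subsetP YB)]; rewrite inE xB xC.
Qed.

Definition unsplit X := forall A B : {set T}, A :|: B = X -> [disjoint A & B] -> {in A & B, forall x y, ~~ a x y} ->
  A = set0 \/ B = set0.

Lemma join_insep (D R : {set T}) : D != set0 -> {in D & R, forall x y, a x y} -> ~~ small R ->
  (~~ small D \/ unsplit R) -> ~~ sep a false (D :|: R).
Proof.
move=> D0 DR nsR hD; apply/negP => /sepP[C [A [CX C2 /indepP Ci AX [A0 B0 AB]]]].
set B := _ :\: A in B0 AB.
have sC : small C by apply/andP.
have [r rR rC] : exists2 r, r \in R & r \notin C.
  by apply/subsetPn; apply: contra nsR => /smallS; apply.
have side x : x \in D :|: R -> x \notin C -> (x \in A) || (x \in B).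
  by move=> xX xC; rewrite /B 2!in_setD xC xX andbT; case: (x \in A).
have AN x : x \in A -> x \notin C /\ x \in D :|: R.
  by move/(subsetP AX); rewrite in_setD => /andP.
have BN x : x \in B -> x \notin A /\ (x \notin C /\ x \in D :|: R).
  by rewrite /B 2!in_setD => /and3P[-> -> ->].
have [DC|/subsetPn[d dD dC]] := boolP (D \subset C).
  case: hD => [/negP[]|uR]; first exact: smallS sC.
  have RC x : x \in R -> x \notin C.
    move=> xR; apply/negP => xC; have [d dD] := set0Pn _ D0.
    by have := indepP _ Ci _ _ (subsetP DC _ dD) xC; rewrite DR.
  have AR : A \subset R.
    apply/subsetP => x xA; have [xC] := AN x xA; rewrite inE => /orP[/(subsetP DC)|//].
    by rewrite (negbTE xC).
  have BR : B \subset R.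
    apply/subsetP => x /BN[_ [xC]]; rewrite inE => /orP[/(subsetP DC)|//].
    by rewrite (negbTE xC).
  have [|||E0|E0] := uR A B.
  - apply/eqP; rewrite eqEsubset subUset AR BR /=; apply/subsetP => x xR.
    by rewrite inE side ?RC // inE xR orbT.
  - by rewrite disjoint_sym /B setDE disjoints_subset subsetIr.
  - by move=> x y xA yB; rewrite AB.
  - by rewrite E0 eqxx in A0.
  - by rewrite E0 eqxx in B0.
have rX : r \in D :|: R by rewrite inE rR orbT.
have dX : d \in D :|: R by rewrite inE dD.
have cross x y : x \in A -> y \in B -> a x y = false by move=> xA yB; rewrite AB.
have cross' x y : x \in B -> y \in A -> a x y = false by move=> xA yB; rewrite a_sym AB.
have key x y : x \in A -> y \in B -> False.
  move=> xA yB; have [xC xX] := AN _ xA; have [_ [yC yX]] := BN _ yB.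
  case/orP: (side r rX rC) => [rA|rB]; case/orP: (side d dX dC) => [dA|dB].
  - move: yX; rewrite inE => /orP[yD|yR].
      by have := cross' _ _ yB rA; rewrite DR.
    by have := cross _ _ dA yB; rewrite DR.
  - by have := cross' _ _ dB rA; rewrite DR.
  - by have := cross _ _ dA rB; rewrite DR.
  - move: xX; rewrite inE => /orP[xD|xR].
      by have := cross _ _ xA rB; rewrite DR.
    by have := cross' _ _ dB xA; rewrite DR.
have [x xA] := set0Pn _ A0; have [y yB] := set0Pn _ B0.
exact: key xA yB.
Qed.

Lemma card3_small X : 2 < #|X| -> ~~ small X.
Proof. by move=> X3; rewrite /small leqNgt X3. Qed.

Lemma edge_small X x y : x \in X -> y \in X -> a x y -> ~~ small X.
Proof.
move=> xX yX axy; rewrite /small negb_and; apply/orP; right.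
by apply/negP => /indepP/(_ _ _ xX yX); rewrite axy.
Qed.

End Small.

Lemma sep_imset (T U : finType) (a : rel T) (d : rel U) b (X : {set T}) (f : T -> U) :
  {in X &, injective f} -> {in X &, forall x y, d (f x) (f y) = a x y} ->
  ~~ sep a b X -> ~~ sep d b (f @: X).
Proof.
move=> f_inj fa; apply: contra => /sepP[C [A [CX C2 Ci AX [A0 B0 AB]]]]; apply/sepP.
exists (X :&: f @^-1: C), (X :&: f @^-1: A).
split.
- exact: subsetIl.
- have fI : {in X :&: f @^-1: C &, injective f}.
    by move=> x y /[!inE] /andP[xX _] /andP[yX _]; apply: f_inj.
  apply: leq_trans C2; rewrite -(card_in_imset fI); apply: subset_leq_card.
  by apply/subsetP => _ /imsetP[x /[!inE] /andP[_ xC] ->].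
- by move=> x y /[!inE] /andP[xX xC] /andP[yX yC]; rewrite -fa // Ci.
- apply/subsetP => x /[!inE] /andP[xX xA]; rewrite xX andbT /=.
  by have := subsetP AX _ xA; rewrite inE => /andP[].
split.
- case/set0Pn: A0 => y yA; have := subsetP AX _ yA; rewrite inE => /andP[_ /imsetP[x xX yE]].
  by apply/set0Pn; exists x; rewrite !inE xX -yE.
- case/set0Pn: B0 => y; rewrite !inE => /and3P[yA yC /imsetP[x xX yE]].
  by apply/set0Pn; exists x; rewrite !inE xX -yE yA yC.
move=> x y /[!inE] /andP[xX xA] /andP[yA /andP[yC yX]].
rewrite yX /= in yA yC; rewrite -fa // AB // !inE yA yC imset_f //.
Qed.

(** * Hosts from inseparable sets *)

Section Graph.
Variable H : sgraph.
Implicit Types (X Y Z C D R U : {set H}) (u v x y : H).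
Local Notation hostable := (exists J, addition_host H J).
Local Notation a := (@adj H).

(** An embedding with image [X] would inject the edges of [H[X]] into those that remain after [uv]
    is deleted. *)
Lemma not_fits X u v : adj u v -> u \in X -> v \in X ->
  (forall f : H -> H, {in X &, injective f} ->
     {in X &, forall x y, del u v (f x) (f y) = adj x y} -> f @: X = X) ->
  ~~ fits a X (del u v).
Proof.
move=> uv uX vX Hf; apply/negP => /fitsP[f [fI fP]]; have fX := Hf f fI fP.
pose E1 := [set p : H * H | [&& p.1 \in X, p.2 \in X & adj p.1 p.2]].
pose E2 := [set p : H * H | [&& p.1 \in X, p.2 \in X & del u v p.1 p.2]].
pose g (p : H * H) := (f p.1, f p.2).
have fin x : x \in X -> f x \in X by move=> xX; rewrite -fX imset_f.
have : #|E1| <= #|E2|.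
  have gI : {in E1 &, injective g}.
    move=> [x y] [x' y'] /[!inE] /and3P[/= xX yX _] /and3P[/= x'X y'X _] [].
    by move=> /fI-> // /fI->.
  rewrite -(card_in_imset gI); apply: subset_leq_card; apply/subsetP => _ /imsetP[[x y] /[!inE] /and3P[/= xX yX xy] ->].
  by rewrite /= !fin // fP.
rewrite leqNgt => /negP[]; apply: proper_card; apply/properP; split.
  by apply/subsetP => -[x y]; rewrite !inE /= => /and3P[-> -> /andP[->]].
exists (u, v); rewrite !inE /= uX vX //=.
by rewrite /del /edge_rel !eqxx andbF.
Qed.

Lemma host_setT b u v : adj u v -> ~~ sep a b setT -> hostable.
Proof.
move=> uv nsep; apply: (host_amalgam uv nsep); apply: not_fits => // f fI _.
by apply/eqP; rewrite eqEcard subsetT (card_in_imset fI) leqnn.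
Qed.

Lemma sep_del u v X : sep a false X -> sep (del u v) false X.
Proof.
move=> /sepP[C [A [CX C2 Ci AX [A0 B0 AB]]]]; apply/sepP; exists C, A; split => //.
  by move=> x y xC yC; rewrite /del (negbTE (Ci _ _ xC yC)).
by split => // x y xA yB; rewrite /del AB.
Qed.

(** Deleting an edge can only help to disconnect, so the image of [X] in [H - uv] is inseparable in
    [H] too, and it equals [X] by uniqueness. *)
Lemma host_insep_unique X u v : ~~ sep a false X -> u \in X -> v \in X -> adj u v ->
  (forall Y, ~~ sep a false Y -> #|Y| = #|X| -> Y = X) -> hostable.
Proof.
move=> nX uX vX uv uniqX; apply: (host_amalgam uv nX); apply: not_fits => // f fI fP.
apply: uniqX; last exact: card_in_imset.
by apply: contra (sep_imset fI fP nX); apply: sep_del.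
Qed.

(** For [X] maximal above [X0], an inseparable [Y] of the same size whose intersection with [X] is
    not small has an inseparable union with [X], hence equals it. Only small intersections are left
    to exclude. *)
Lemma host_insep_max X0 u v : ~~ sep a false X0 -> u \in X0 -> v \in X0 -> adj u v ->
  (forall X Y, X0 \subset X -> ~~ sep a false X -> ~~ sep a false Y -> #|Y| = #|X| ->
     small a (Y :&: X) -> False) -> hostable.
Proof.
move=> n0 u0 v0 uv Hm.
have [X /maxsetP[nX Xmax] X0X] := maxset_exists (P := fun X => ~~ sep a false X) n0.
apply: (host_insep_unique nX (subsetP X0X _ u0) (subsetP X0X _ v0) uv) => Y nY YX.
have [sm|nsm] := boolP (small a (Y :&: X)); first by case: (Hm X Y).
have nU := insep_union nY nX nsm.
have /eqP E0 := Xmax _ nU (subsetUr _ _).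
apply/eqP; rewrite eqEcard YX leqnn andbT; apply/setUidPl.
by rewrite setUC; apply/eqP.
Qed.

(** A competitor [Y] has at most two vertices inside [X] and two outside, too few. *)
Lemma host_insep_big X0 u v : ~~ sep a false X0 -> u \in X0 -> v \in X0 -> adj u v ->
  #|~: X0| <= 2 -> 4 < #|X0| -> hostable.
Proof.
move=> n0 u0 v0 uv c2 X5; apply: (host_insep_max n0 u0 v0 uv) => X Y X0X _ _ YX /andP[s2 _].
have := subset_leq_card X0X; rewrite -YX leqNgt => /negP[].
apply: leq_ltn_trans X5; rewrite -(cardsID X Y) (@leq_add _ _ 2 2) //.
apply: leq_trans c2; apply: subset_leq_card; rewrite setDE.
by apply: subset_trans (subsetIr _ _) _; rewrite setCS.
Qed.

End Graph.

(** * Checking small graphs by computation *)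

(* [has] and [all] with a lazy conditional, for call-by-value evaluation. *)
Fixpoint anyb (T : Type) (p : T -> bool) s :=
  if s is x :: s' then if p x then true else anyb p s' else false.
Fixpoint allb (T : Type) (p : T -> bool) s :=
  if s is x :: s' then if p x then allb p s' else false else true.

Lemma anybE T (p : T -> bool) s : anyb p s = has p s.
Proof. by elim: s => //= x s ->; case: (p x). Qed.

Lemma allbE T (p : T -> bool) s : allb p s = all p s.
Proof. by elim: s => //= x s ->; case: (p x). Qed.

(** Backtracking search for [k] further images taken from [cs], where [R i j x y] constrains
    positions [i < j] with images [x] and [y]. Pairs within the initial [img] are never tested. *)
Fixpoint ext (R : nat -> nat -> nat -> nat -> bool) (cs : seq nat) k (img : seq nat) :=
  if k is k'.+1 then
    anyb (fun c => if allb (fun i => R i (size img) (nth 0 img i) c) (iota 0 (size img))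
                   then ext R cs k' (rcons img c) else false) cs
  else true.

Lemma extP (R : nat -> nat -> nat -> nat -> bool) cs k img : reflect (exists l, [/\ size l = k, {subset l <= cs} &
    forall i j, i < j -> size img <= j < size img + k ->
      R i j (nth 0 (img ++ l) i) (nth 0 (img ++ l) j)]) (ext R cs k img).
Proof.
elim: k img => [|k IH] img /=.
  left; exists [::]; split => // i j _; rewrite addn0 => /andP[h1 h2].
  by move: h2; rewrite ltnNge h1.
rewrite anybE; apply: (iffP hasP) => [[c ccs]|[[|c l] [// [sl] lcs Rl]]].
  rewrite allbE; case: ifP => // /allP ok /IH[l [sl lcs Rl]].
  exists (c :: l); split; rewrite /= ?sl //.
    by move=> x; rewrite inE => /orP[/eqP->|/lcs].
  move=> i j ij /andP[ji jk]; rewrite -cat_rcons.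
  have [jE|jN] := eqVneq j (size img).
    rewrite jE in ij *; rewrite !nth_cat size_rcons ltnSn ltnW // !nth_rcons ltnn eqxx ij.
    by apply: ok; rewrite mem_iota.
  by apply: Rl; rewrite // size_rcons ltn_neqAle eq_sym jN ji /= addSnnS.
have szl : size img < size img + k.+1 by rewrite addnS ltnS leq_addr.
exists c; first by apply: lcs; rewrite inE eqxx.
rewrite allbE ifT.
  apply/IH; exists l; split => //; first by move=> x xl; apply: lcs; rewrite inE xl orbT.
  move=> i j ij; rewrite size_rcons cat_rcons addSnnS => /andP[ji jk].
  by apply: Rl => //; rewrite ltnW.
apply/allP => i; rewrite mem_iota add0n => /= isz.
have := Rl i (size img) isz; rewrite leqnn szl => /(_ isT).
by rewrite !nth_cat isz ltnn subnn.
Qed.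

Definition mrel (M : seq (seq bool)) i j := nth false (nth [::] M i) j.

Definition mdel (M : seq (seq bool)) u v i j :=
  if mrel M i j then ~~ ((i == u) && (j == v) || (i == v) && (j == u)) else false.

Definition grow (a : rel nat) (Y S : seq nat) :=
  [seq y <- Y | if y \in S then true else anyb (fun x => a x y) S].

(** With four rounds of growth a positive answer proves connectedness, while a negative one may only
    be due to longer paths. *)
Definition linked (a : rel nat) (Y : seq nat) :=
  if Y is y :: _ then allb (fun z => z \in iter 4 (grow a Y) [:: y]) Y else true.

(** Runs through the separators with at most two vertices; comparison with [b] turns the case of
    joins into connectedness of the complement. *)
Definition insepb (M : seq (seq bool)) (b : bool) (X : seq nat) :=
  let r i j := mrel M i j != b in
  let tst C := linked r [seq x <- X | x \notin C] in
  if tst [::] then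
    allb (fun i => if tst [:: i] then
      allb (fun j => if mrel M i j then true else tst [:: i; j]) X else false) X
  else false.

Definition fitsb (M : seq (seq bool)) (X : seq nat) u v :=
  ext (fun i j x y => if x == y then false else
                      mdel M u v x y == mrel M (nth 0 X i) (nth 0 X j))
      (iota 0 (size M)) (size X) [::].

(* For [X] the whole vertex set, a count of edges shows that [H[X]] does not
   embed into [H - uv]. *)
Definition amalb (M : seq (seq bool)) (z : bool * seq nat * nat * nat) :=
  let: (b, X, u, v) := z in
  if mrel M u v && uniq X && all (fun i => i < size M) X then if insepb M b X then
      if size X == size M then true else ~~ fitsb M X u v
    else false
  else false.

Definition degb (a : rel nat) n i := count (a i) (iota 0 n).

(** [B] is the least possible [M] of [cover]: the vertices whose degree still exceeds [c] after the
    deletion, and [v] if it has to be of unlimited degree. *)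
Definition coverb (M : seq (seq bool)) c (fl t : bool) u v :=
  let n := size M in
  if mrel M u v then
    let B := [seq w <- iota 0 n | if t && (w == v) then true else c < degb (mdel M u v) n w] in
    [&& u \notin B, (v \in B) == t, fl || nilp B &
        allb (fun x => allb (fun y => if x == y then true else mrel M x y) B) B]
  else false.

Definition has_coverb (M : seq (seq bool)) c fl t :=
  anyb (fun u => anyb (fun v => coverb M c fl t u v) (iota 0 (size M))) (iota 0 (size M)).

Definition bigs (M : seq (seq bool)) c :=
  [seq w <- iota 0 (size M) | c < degb (mrel M) (size M) w].

Definition typedb ks (M : seq (seq bool)) :=
  let ns := iota 0 (size M) in
  if allb (fun x => allb (fun y => if mrel M x y then
       allb (fun z => if mrel M y z then ~~ mrel M x z else true) ns else true) ns) ns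
  then anyb (fun c =>
    if if nilp (bigs M c) then false else has_coverb M c false false then true else
    if anyb (fun x => anyb (fun y => if x == y then false else ~~ mrel M x y)
                           (bigs M c)) (bigs M c)
    then if has_coverb M c true false then has_coverb M c true true else false else false) ks
  else false.

Definition isob (M S : seq (seq bool)) :=
  if size M == size S then
    ext (fun i j x y => if x == y then false else mrel M x y == mrel S i j)
        (iota 0 (size M)) (size M) [::]
  else false.

Section Soundness.
Variables (H : sgraph) (vs : seq H).
Hypotheses (vs_uniq : uniq vs) (vs_all : forall x : H, x \in vs).
Variable x0 : H.

Definition mat (us ws : seq H) := [seq [seq adj x y | y <- ws] | x <- us].
Local Notation M := (mat vs vs).
Local Notation n := (size vs).
Local Notation v i := (nth x0 vs i).

Lemma size_mat (us ws : seq H) : size (mat us ws) = size us.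
Proof. exact: size_map. Qed.

Lemma mrelE i j : i < n -> j < n -> mrel M i j = adj (v i) (v j).
Proof. by move=> i_n j_n; rewrite /mrel (nth_map x0) // (nth_map x0). Qed.

Lemma ixP (x : H) : index x vs < n. Proof. by rewrite index_mem. Qed.
Lemma vix (x : H) : v (index x vs) = x. Proof. by rewrite nth_index. Qed.
Lemma v_inj i j : i < n -> j < n -> v i = v j -> i = j.
Proof. by move=> i_n j_n /eqP; rewrite nth_uniq // => /eqP. Qed.

Lemma mrel_over i j : mrel M i j -> i < n /\ j < n.
Proof.
rewrite /mrel; have [i_n|i_n] := ltnP i n; last by rewrite (nth_default [::]) ?nth_nil ?size_mat.
rewrite (nth_map x0) //; have [//|j_n] := ltnP j n.
by rewrite nth_default // size_map.
Qed.

Lemma mdelE u w i j : u < n -> w < n -> i < n -> j < n ->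
  mdel M u w i j = del (v u) (v w) (v i) (v j).
Proof.
move=> un wn i_n j_n; rewrite /mdel /del /edge_rel !nth_uniq // mrelE //.
Qed.

Lemma grow_mono (a : rel nat) Y (P : pred nat) k y :
  P y -> (forall x z, P x -> z \in Y -> a x z -> P z) ->
  {in iter k (grow a Y) [:: y], forall z, P z}.
Proof.
move=> Py cl; elim: k => [|k IH] z /=; first by rewrite inE => /eqP->.
rewrite mem_filter anybE; case: ifP => [zS _|_ /andP[/hasP[x xS axz] zY]]; first exact: IH.
by apply: cl axz => //; apply: IH.
Qed.

Lemma linkedP (a : rel nat) Y (A : pred nat) : linked a Y ->
  has A Y -> has (predC A) Y ->
  exists x z, [/\ x \in Y, z \in Y, A x != A z & a x z].
Proof.
case: Y => // y Y0; set Y := y :: Y0.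
rewrite -[linked a Y]/(allb (fun z => z \in iter 4 (grow a Y) [:: y]) Y) allbE.
move=> /allP lk hA hN.
have yY : y \in Y by rewrite inE eqxx.
have [/hasP[x xY /hasP[z zY /andP[Axz axz]]]|no] :=
    boolP (has (fun x => has (fun z => (A x != A z) && a x z) Y) Y).
  by exists x, z.
have [z zY Az] : exists2 z, z \in Y & A z != A y.
  case Ay: (A y); [case/hasP: hN => z zY /=|case/hasP: hA => z zY] => Az; exists z => //.
    by rewrite (negbTE Az).
  by rewrite Az.
pose P t := (t \in Y) && (A t == A y).
have Py : P y by rewrite /P yY eqxx.
have cl t s : P t -> s \in Y -> a t s -> P s.
  move=> /andP[tY /eqP At] sY ats; rewrite /P sY -At eq_sym /=; apply: contraT => Ats.
  by case/negP: no; apply/hasP; exists t => //; apply/hasP; exists s => //; rewrite ats andbT.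
have /andP[_ /eqP Azy] := @grow_mono a Y P 4 y Py cl z (lk z zY).
by rewrite Azy eqxx in Az.
Qed.

Definition vset (X : seq nat) : {set H} := [set x | index x vs \in X].

Lemma in_vset X i : i < n -> (v i \in vset X) = (i \in X).
Proof. by move=> i_n; rewrite inE index_uniq. Qed.

Lemma insepb_sound b X : uniq X -> {in X, forall i, i < n} ->
  insepb M b X -> ~~ sep (@adj H) b (vset X).
Proof.
move=> uX Xn; rewrite /insepb; case: ifP => // t0; rewrite allbE => /allP t12.
apply/negP => /sepP[C [A [CX C2 Ci AX [A0 B0 AB]]]].
pose Cl := [seq i <- X | v i \in C].
have ClX i : (i \in Cl) = (v i \in C) && (i \in X) by rewrite mem_filter.
have sCl : size Cl <= 2.
  apply: leq_trans C2; rewrite -(size_map (fun i => v i)).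
  have uC : uniq [seq v i | i <- Cl].
    rewrite map_inj_in_uniq ?filter_uniq // => i j; rewrite !ClX.
    by move=> /andP[_ /Xn i_n] /andP[_ /Xn j_n]; apply: v_inj.
  rewrite -(card_uniqP uC); apply: subset_leq_card; apply/subsetP => x /mapP[i].
  by rewrite ClX => /andP[iC _] ->.
have lk : linked (fun i j => mrel M i j != b) [seq x <- X | x \notin Cl].
  case E0: Cl sCl => [|i [|j [|k l]]] // _.
    have iX : i \in X by have := ClX i; rewrite E0 inE eqxx => /esym/andP[].
    by have := t12 _ iX; case: ifP.
  have [iC iX] : v i \in C /\ i \in X by have := ClX i; rewrite E0 !inE eqxx => /esym/andP[].
  have [jC jX] : v j \in C /\ j \in X.
    by have := ClX j; rewrite E0 !inE eqxx orbT => /esym/andP[].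
  have := t12 _ iX; case: ifP => // _; rewrite allbE => /allP/(_ _ jX).
  by rewrite mrelE ?Xn // (negbTE (Ci _ _ iC jC)).
have inY x : x \in vset X :\: C -> index x vs \in [seq i <- X | i \notin Cl].
  by rewrite !inE => /andP[xC xX]; rewrite mem_filter ClX vix (negbTE xC) xX.
have [||i [j [iY jY ij r]]] := @linkedP _ _ (fun i => v i \in A) lk.
- have [a aA] := set0Pn _ A0; apply/hasP; exists (index a vs); last by rewrite vix.
  by apply/inY/(subsetP AX).
- have [a] := set0Pn _ B0; rewrite inE => /andP[aA aY]; apply/hasP.
  by exists (index a vs); [exact: inY | rewrite /= vix].
have cl k : k \in [seq i <- X | i \notin Cl] -> v k \in vset X :\: C /\ k < n.
  rewrite mem_filter ClX => /andP[+ kX]; rewrite kX andbT => kC.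
  by rewrite inE kC in_vset ?Xn.
have [iX i_n] := cl _ iY; have [jX j_n] := cl _ jY.
move: r; rewrite mrelE //; case iA: (v i \in A) ij; case jA: (v j \in A) => // _.
  by rewrite AB ?eqxx // inE jA.
by rewrite adj_sym AB ?eqxx // inE iA.
Qed.

Lemma fitsb_sound X a b : uniq X -> {in X, forall i, i < n} -> a < n -> b < n ->
  ~~ fitsb M X a b -> ~~ fits (@adj H) (vset X) (del (v a) (v b)).
Proof.
move=> uX Xn an bn; apply: contra => /fitsP[f [fI fP]].
apply/extP; exists [seq index (f (v i)) vs | i <- X]; split.
- by rewrite size_map.
- by move=> _ /mapP[i _ ->]; rewrite mem_iota add0n size_mat ixP.
move=> i j ij; rewrite /= add0n => jX.
have iX := ltn_trans ij jX.
have Xi k : k < size X -> nth 0 X k \in X by move=> ?; apply: mem_nth.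
have vX k : k < size X -> v (nth 0 X k) \in vset X by move=> kX; rewrite in_vset ?Xn ?Xi.
rewrite !(nth_map 0) //.
have -> : (index (f (v (nth 0 X i))) vs == index (f (v (nth 0 X j))) vs) = false.
  apply/negP => /eqP /(congr1 (nth x0 vs)); rewrite !vix => /fI -/(_ (vX _ iX) (vX _ jX)).
  move/v_inj; rewrite !Xn ?Xi // => /(_ isT isT) /eqP.
  by rewrite nth_uniq // ltn_eqF.
by rewrite mdelE ?ixP // !vix fP ?vX // mrelE ?Xn ?Xi.
Qed.

Lemma amalb_sound z : amalb M z -> exists J, addition_host H J.
Proof.
case: z => [[[b X] a] c] /=; case: ifP => // /andP[/andP[ac uX] /allP Xn].
have [an cn] := mrel_over ac; rewrite mrelE // in ac; rewrite size_mat in Xn.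
case: ifP => // /(insepb_sound uX Xn) ins; case: ifP => [/eqP sX _|_ fit]; last first.
  by apply: (host_amalgam ac ins); apply: fitsb_sound.
apply: (host_setT (b := b) ac); suff <- : vset X = setT by [].
apply/setP => x; rewrite !inE.
have [||_ ->] := uniq_min_size uX (s2 := iota 0 n).
- by move=> i /Xn; rewrite mem_iota.
- by rewrite size_iota sX size_mat.
by rewrite mem_iota ixP.
Qed.

Lemma card_count (P : pred H) : #|[set x | P x]| = count (fun i => P (v i)) (iota 0 n).
Proof.
rewrite -(count_map (nth x0 vs)) -/(mkseq _ _) mkseq_nth -size_filter.
rewrite -(card_uniqP (filter_uniq P vs_uniq)); apply: eq_card => x.
by rewrite inE mem_filter vs_all andbT.
Qed.

Lemma degbE i : i < n -> degb (mrel M) n i = #|nb (@adj H) (v i)|.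
Proof.
move=> i_n; rewrite card_count; apply: eq_in_count => j.
by rewrite mem_iota /= => j_n; rewrite mrelE.
Qed.

Lemma degb_del a b i : a < n -> b < n -> i < n ->
  degb (mdel M a b) n i = #|nb (del (v a) (v b)) (v i)|.
Proof.
move=> an bn i_n; rewrite card_count; apply: eq_in_count => j.
by rewrite mem_iota /= => j_n; rewrite mdelE.
Qed.

Lemma coverb_sound c fl t a b : coverb M c fl t a b -> cover H c fl false t.
Proof.
rewrite /coverb size_mat; case: ifP => // ab; have [an bn] := mrel_over ab.
rewrite mrelE // in ab.
set B := filter _ _; case/and4P=> aB /eqP bB fB; rewrite allbE => /allP cl.
have Bn i : i \in B -> i < n by rewrite mem_filter mem_iota => /andP[].
exists (v a), (v b), (vset B); split => //.
- by rewrite in_vset // (negbTE aB).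
- by rewrite in_vset.
- case/orP: fB => [->//|/nilP ->]; apply/orP; right; apply/eqP/setP => x.
  by rewrite !inE.
split=> [x y|w].
  rewrite !inE => xB yB xy; have := cl _ xB; rewrite allbE => /allP/(_ _ yB).
  rewrite mrelE ?Bn // !vix; case: eqP => // /(congr1 (nth x0 vs)).
  by rewrite !vix => E0; rewrite E0 eqxx in xy.
rewrite inE => wB; rewrite -(vix w) -degb_del ?ixP // leqNgt; apply: contra wB => dw.
by rewrite mem_filter mem_iota /= add0n ixP andbT; case: ifP.
Qed.

Lemma typedb_sound ks : typedb ks M -> exists J, addition_host H J.
Proof.
rewrite /typedb size_mat; set ns := iota 0 n.
have ns_ix x : index x vs \in ns by rewrite mem_iota add0n ixP.
case: ifP => // tfb; rewrite anybE => /hasP[c _].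
have tf : triangle_free H.
  move=> x y z xy yz xz; move: tfb; rewrite allbE => /allP/(_ _ (ns_ix x)).
  rewrite allbE => /allP/(_ _ (ns_ix y)); rewrite mrelE ?ixP // !vix xy allbE.
  by move=> /allP/(_ _ (ns_ix z)); rewrite !mrelE ?ixP // !vix yz xz.
have covP fl t : has_coverb M c fl t -> cover H c fl false t.
  by rewrite /has_coverb anybE => /hasP[a _]; rewrite anybE => /hasP[b _] /coverb_sound.
have BgP i : i \in bigs M c -> i < n /\ c < #|nb (@adj H) (v i)|.
  rewrite mem_filter size_mat mem_iota add0n /= => /andP[+ i_n].
  by rewrite degbE.
case: ifP => [|_].
  case E0: (bigs M c) => [//|i B'] c0 _; apply: (@host_typed H c false) => //; last exact: covP.
  by exists (v i); apply: (BgP i _).2; rewrite E0 inE eqxx.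
case: ifP => //; rewrite anybE => /hasP[i iB]; rewrite anybE => /hasP[j jB].
have [i_n ci] := BgP _ iB; have [j_n cj] := BgP _ jB.
case: eqP => // /eqP ij; rewrite mrelE // => nij.
case: ifP => // c1 c2; apply: (@host_typed H c true) => //; try by move=> *; apply: covP.
exists (v i), (v j); split => //.
by rewrite nth_uniq.
Qed.

Lemma isob_sound S : isob M S -> exists ws : seq H,
  [/\ uniq ws, forall x, x \in ws, size ws = size S &
   forall i j, i < j -> j < size S -> mrel S i j = adj (nth x0 ws i) (nth x0 ws j)].
Proof.
rewrite /isob size_mat; case: ifP => // /eqP nS /extP[l [sl lcs Rl]].
rewrite /= in Rl.
have ln i : i < n -> nth 0 l i < n.
  move=> i_n; have /lcs : nth 0 l i \in l by rewrite mem_nth ?sl.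
  by rewrite mem_iota.
have lR i j : i < j -> j < n -> (nth 0 l i == nth 0 l j) = false /\
    mrel M (nth 0 l i) (nth 0 l j) = mrel S i j.
  by move=> ij j_n; have := Rl i j ij j_n; case: eqP => // _ /eqP.
have vl i : i < n -> nth x0 [seq v i | i <- l] i = v (nth 0 l i).
  by move=> i_n; rewrite (nth_map 0) ?sl.
have uws : uniq [seq v i | i <- l].
  rewrite map_inj_in_uniq => [|i j /lcs + /lcs +]; last first.
    by rewrite !mem_iota; apply: v_inj.
  apply/(uniqP 0) => i j; rewrite !inE sl => i_n j_n.
  by case: (ltngtP i j) => // [/lR|/lR]/(_ _)[//|/eqP nE _ E0]; case: nE; rewrite E0.
exists [seq v i | i <- l]; split => //; first 1 last.
- by rewrite size_map sl.
- by move=> i j ij; rewrite -nS => j_n; rewrite !vl ?(ltn_trans ij) // -mrelE ?ln ?(ltn_trans ij) //; case: (lR _ _ ij j_n).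
have [||_ E0] := uniq_min_size uws (s2 := vs).
- by move=> x _.
- by rewrite size_map sl.
by move=> x; rewrite E0.
Qed.

End Soundness.

(** * Circulant graphs *)

Definition circ n (D : seq nat) : seq (seq bool) :=
  [seq [seq (n + j - i) %% n \in D | j <- iota 0 n] | i <- iota 0 n].

Section Circulant.
Variables (n : nat) (c : nat).
Hypothesis cn : c <= n.

Definition rotate i := (i + n - c) %% n.

Lemma mrel_circ D i j : i < n -> j < n -> mrel (circ n D) i j = ((n + j - i) %% n \in D).
Proof.
by move=> i_n j_n; rewrite /mrel !(nth_map 0) ?size_iota // !nth_iota.
Qed.

Lemma rotate_lt i : i < n -> rotate i < n.
Proof. by move=> i_n; rewrite ltn_mod (leq_ltn_trans _ i_n). Qed.

Lemma rotate_inj i j : i < n -> j < n -> rotate i = rotate j -> i = j.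
Proof.
move=> i_n j_n /eqP; rewrite /rotate -!addnBA // eqn_modDr !modn_small //.
by move/eqP.
Qed.

Lemma mrel_rotate D i j : i < n -> j < n ->
  mrel (circ n D) (rotate i) (rotate j) = mrel (circ n D) i j.
Proof.
move=> i_n j_n; rewrite !mrel_circ ?rotate_lt //; congr (_ \in D).
have ri := ltnW (rotate_lt i_n).
apply/eqP; rewrite -(eqn_modDr (rotate i)) subnK; last by rewrite (leq_trans ri) ?leq_addr.
rewrite modnDl /rotate !modn_mod modnDmr.
have -> : n + j - i + (i + n - c) = j + n - c + n.
  rewrite -(addnBA i cn) addnA subnK; last by rewrite (leq_trans (ltnW i_n)) ?leq_addr.
  by rewrite -(addnBA j cn) [n + j]addnC -!addnA [n + (n - c)]addnC.
by rewrite modnDr.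
Qed.

End Circulant.

Section Sporadic.
Variables (S : seq (seq bool)) (N : nat) (JD ND : seq nat).
Local Notation JM := (circ N JD).
Local Notation NM := (circ N ND).

(** By rotation, the first vertex of a forbidden copy and one end of a frozen pair may be placed at
    0. In the last test the edge [0 1] of [S] is placed on 0 and [y] before the search starts, so
    [ext] imposes nothing on it, as befits the missing edge. *)
Definition spb :=
  let k := size S in let ns := iota 0 N in let J := JM in let F := NM in
  [&& 1 < k, mrel S 0 1,
      all (fun x => all (fun y => mrel J x y == mrel J y x) ns) ns,
      all (fun x => ~~ mrel J x x && ~~ mrel F x x) ns,
      all (fun x => all (fun y => (mrel F x y == mrel F y x) && ~~ (mrel F x y && mrel J x y)) ns) ns &
  [&& has (fun x => has (mrel F x) ns) ns,
      ~~ ext (fun i j x y => if x == y then false else mrel J x y == mrel S i j) ns k.-1 [:: 0] &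
      allb (fun y => if mrel F 0 y then
          ext (fun i j x y => if x == y then false else
                              if mrel S i j then mrel J x y else mrel F x y) ns k.-2 [:: 0; y]
        else true) ns]].

Lemma spb_sound (H : sgraph) (x0 : H) (vs : seq H) : spb ->
  uniq vs -> (forall x, x \in vs) -> size vs = size S ->
  (forall i j, i < j -> j < size S -> mrel S i j = adj (nth x0 vs i) (nth x0 vs j)) ->
  exists J, addition_host H J.
Proof.
case/and5P=> k1 S01 /allP Jsym /allP irr /andP[/allP Nsym].
set ns := iota 0 _; case/and3P=> /hasP[a aN /hasP[b bN Nab]] free; rewrite allbE => /allP cov.
move=> uvs allvs sz SE.
have ord_ns (x : 'I_N) : (x : nat) \in ns by rewrite mem_iota add0n /=.
have ix (x : H) : index x vs < size S by rewrite -sz index_mem.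
have vix (x : H) : nth x0 vs (index x vs) = x by rewrite nth_index.
have SE' x y : index x vs < index y vs -> mrel S (index x vs) (index y vs) = adj x y.
  by move=> xy; rewrite SE // !vix.
have ix_inj : injective (index^~ vs) by move=> x y E0; rewrite -(vix x) E0 vix.
apply: (@host_of_frozen H 'I_N (fun x y => mrel JM x y) (fun x y => mrel NM x y)).
- by move=> x y; have /allP/(_ _ (ord_ns y))/eqP := Jsym _ (ord_ns x).
- by move=> x; have /andP[/negbTE] := irr _ (ord_ns x).
- by move=> x y; have /allP/(_ _ (ord_ns y))/andP[/eqP] := Nsym _ (ord_ns x).
- move=> x y Nxy; have /allP/(_ _ (ord_ns y))/andP[_] := Nsym _ (ord_ns x).
  rewrite Nxy /= => ->; rewrite andbT; apply: contraTneq Nxy => ->.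
  by have /andP[] := irr _ (ord_ns y).
- rewrite !mem_iota add0n /= in aN bN.
  by exists (Ordinal aN), (Ordinal bN).
- apply: contra free => /embedsP[f f_inj fP]; apply/extP.
  pose c : nat := f (nth x0 vs 0); have cN : c <= N by apply: ltnW (ltn_ord _).
  have g0 : 0 = rotate N c (f (nth x0 vs 0)) by rewrite /rotate -/c addKn modnn.
  exists [seq rotate N c (f x) | x <- behead vs]; split; rewrite ?size_map ?size_behead ?sz //.
    by move=> _ /mapP[x _ ->]; rewrite mem_iota rotate_lt.
  have -> : [:: 0] ++ [seq rotate N c (f x) | x <- behead vs] = [seq rotate N c (f x) | x <- vs].
    by case: (vs) sz g0 => [/esym sS|v vs' _ /= <-] //; rewrite sS in k1.
  move=> i j ij /=; rewrite add1n (prednK (ltnW k1)) => /andP[_ j_k].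
  rewrite -sz in j_k; have i_k := ltn_trans ij j_k.
  rewrite !(nth_map x0) // mrel_rotate //; case: eqP => [|_]; last by rewrite fP SE -?sz.
  move/(rotate_inj cN (ltn_ord _) (ltn_ord _))/val_inj/f_inj/eqP.
  by rewrite nth_uniq // ltn_eqF.
move=> x y Nxy; have N0 : 0 < N by apply: leq_ltn_trans (ltn_ord x).
have xN : x <= N by apply: ltnW.
have x0E : rotate N x x = 0 by rewrite /rotate addKn modnn.
have := cov (rotate N x y); rewrite mem_iota rotate_lt // => /(_ isT).
rewrite -{1}x0E mrel_rotate // Nxy.
set y' := rotate N x y; have y'N : y' < N by apply: rotate_lt.
case/extP=> [l [sl lcs Rl]]; set img := [:: 0, y' & l].
have simg : size img = size S by rewrite /= sl; case: (size S) k1 => [|[|]].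
have imgN i : i < size S -> nth 0 img i < N.
  case: i => [|[|i]] iS //=.
  have /lcs : nth 0 l i \in l by apply: mem_nth; rewrite -simg in iS.
  by rewrite mem_iota.
have k2 : 2 + (size S).-2 = size S by case: (size S) k1 => [|[|]].
have Rl' i j : i < j -> 1 < j < size S -> (nth 0 img i == nth 0 img j) = false /\
    if mrel S i j then mrel JM (nth 0 img i) (nth 0 img j)
    else mrel NM (nth 0 img i) (nth 0 img j).
  move=> ij jS; have := Rl i j ij; rewrite /= k2 => /(_ jS).
  by rewrite -/img; case: ifP.
have xy' : 0 != y'.
  rewrite -x0E; apply/eqP => /(rotate_inj xN (ltn_ord x) (ltn_ord y)) xy.
  by have /andP[_] := irr _ (ord_ns y); rewrite -{1}xy Nxy.
have dist i j : i < j -> j < size S -> (nth 0 img i == nth 0 img j) = false.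
  move=> ij jS; case: j ij jS => [|[|j]] // ij jS; last by case: (Rl' i j.+2 ij jS).
  by case: i ij => // _; apply/negbTE.
have cN : N - x <= N by apply: leq_subr.
pose f z : 'I_N := Ordinal (rotate_lt (N - x) (imgN _ (ix z))).
have fE z : f z = rotate N (N - x) (nth 0 img (index z vs)) :> nat by [].
have back i : i < N -> rotate N (N - x) (rotate N x i) = i.
  move=> i_N; rewrite /rotate -addnBA // subKn // modnDml subnK ?modnDr ?modn_small //.
  by rewrite (leq_trans xN) ?leq_addl.
have i0 : index (nth x0 vs 0) vs = 0 by rewrite index_uniq ?sz // ltnW.
have i1 : index (nth x0 vs 1) vs = 1 by rewrite index_uniq ?sz.
have JMs p q : mrel JM (f p) (f q) = mrel JM (f q) (f p).
  by have /allP/(_ _ (ord_ns (f q)))/eqP := Jsym _ (ord_ns (f p)).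
have NMs p q : mrel NM (f p) (f q) = mrel NM (f q) (f p).
  by have /allP/(_ _ (ord_ns (f q)))/andP[/eqP] := Nsym _ (ord_ns (f p)).
exists (nth x0 vs 0), (nth x0 vs 1), f; split; split.
- by rewrite -SE.
- move=> p q /(congr1 val) /(rotate_inj cN (imgN _ (ix p)) (imgN _ (ix q))) E0; apply: ix_inj.
  by case: (ltngtP (index p vs) (index q vs)) => // /dist-/(_ (ix _)); rewrite E0 eqxx.
- by apply: val_inj; rewrite /= i0 /= -x0E back.
- by apply: val_inj; rewrite /= i1 /= back.
- have half p q : index p vs < index q vs -> adj p q ->
      ~~ edge_rel (nth x0 vs 0) (nth x0 vs 1) p q -> mrel JM (f p) (f q).
    move=> pq apq ne; rewrite !fE mrel_rotate ?imgN //.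
    have [q1|q1] := leqP (index q vs) 1; last first.
      by have [|_] := Rl' _ _ pq; rewrite ?q1 ?ix // SE' // apq.
    have qE : index q vs = 1 by apply/eqP; rewrite eqn_leq q1 (leq_ltn_trans _ pq).
    have pE : index p vs = 0 by move: pq; rewrite qE ltnS leqn0 => /eqP.
    by move: ne; rewrite /edge_rel -{1}pE -qE !vix !eqxx.
  move=> p q apq ne; case: (ltngtP (index p vs) (index q vs)) => [pq|qp|E0].
  + exact: half.
  + by rewrite JMs; apply: half => //; rewrite 1?adj_sym // edge_relC.
  + by rewrite (ix_inj _ _ E0) adj_irrefl in apq.
have half p q : index p vs < index q vs -> ~~ adj p q -> mrel NM (f p) (f q).
  move=> pq apq; rewrite !fE mrel_rotate ?imgN //.
  have [q1|q1] := leqP (index q vs) 1; last first.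
    by have [|_] := Rl' _ _ pq; rewrite ?q1 ?ix // SE' // (negbTE apq).
  have qE : index q vs = 1 by apply/eqP; rewrite eqn_leq q1 (leq_ltn_trans _ pq).
  have pE : index p vs = 0 by move: pq; rewrite qE ltnS leqn0 => /eqP.
  by move: apq; rewrite -SE' // pE qE S01.
move=> p q pq napq; case: (ltngtP (index p vs) (index q vs)) => [lt|lt|E0].
- exact: half.
- by rewrite NMs; apply: half => //; rewrite adj_sym.
- by rewrite (ix_inj _ _ E0) eqxx in pq.
Qed.
End Sporadic.

Definition edges_mat k (E : seq (nat * nat)) : seq (seq bool) :=
  [seq [seq ((i, j) \in E) || ((j, i) \in E) | j <- iota 0 k] | i <- iota 0 k].

(* Each entry is a graph [S] with the edge [0 1] and a circulant graph on [n]
   vertices without induced [S]; the last list gives the frozen nonedges. *)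
Definition sporadic : seq (seq (seq bool) * nat * seq nat * seq nat) :=
 [:: (edges_mat 4 [:: (0, 1); (0, 3); (1, 2); (2, 3)], 5, [:: 1; 4], [:: 2; 3]);
     (edges_mat 5 [:: (0, 1); (0, 3); (1, 2); (2, 3)], 19, [:: 2; 3; 5; 14; 16; 17], [:: 1; 4; 6; 7; 8; 9; 10; 11; 12; 13; 15; 18]);
     (edges_mat 6 [:: (0, 1); (0, 3); (1, 2); (2, 3)], 13, [:: 2; 3; 10; 11], [:: 1; 4; 5; 6; 7; 8; 9; 12]);
     (edges_mat 6 [:: (0, 1); (0, 4); (0, 5); (1, 2); (1, 3); (2, 3); (2, 4); (4, 5)], 9, [:: 2; 4; 5; 7], [:: 1; 3; 6; 8]);
     (edges_mat 6 [:: (0, 1); (0, 3); (0, 4); (1, 2); (1, 5); (2, 3); (2, 4); (4, 5)], 13, [:: 1; 5; 8; 12], [:: 2; 3; 4; 6; 7; 9; 10; 11]);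
     (edges_mat 7 [:: (0, 1); (0, 3); (0, 4); (1, 2); (2, 3); (2, 4); (3, 5); (4, 5)], 23, [:: 2; 3; 4; 9; 11; 12; 14; 19; 20; 21], [:: 1; 5; 6; 7; 8; 10; 13; 15; 16; 17; 18; 22]);
     (edges_mat 8 [:: (0, 1); (0, 3); (0, 4); (0, 5); (1, 2); (1, 6); (1, 7); (2, 3); (2, 4); (2, 5); (5, 6); (5, 7)], 29, [:: 1; 4; 5; 6; 7; 9; 13; 16; 20; 22; 23; 24; 25; 28], [:: 2; 3; 8; 10; 11; 12; 14; 15; 17; 18; 19; 21; 26; 27])].

Lemma sporadic_ok : all (fun z => spb z.1.1.1 z.1.1.2 z.1.2 z.2) sporadic.
Proof. by vm_compute. Qed.

Definition cert := (bool * seq nat * nat * nat)%type.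

Definition chk ks (cs : seq cert) (M : seq (seq bool)) :=
  if typedb ks M then true else if anyb (amalb M) cs then true else
  anyb (fun z => isob M z.1.1.1) sporadic.

Lemma chk_sound ks cs (H : sgraph) (x0 : H) (vs : seq H) : uniq vs ->
  (forall x, x \in vs) -> chk ks cs (mat vs vs) -> exists J, addition_host H J.
Proof.
move=> uvs avs; rewrite /chk; case: ifP => [/(typedb_sound uvs avs x0)//|_].
case: ifP => [|_].
  by rewrite anybE => /hasP[z _ /(amalb_sound uvs avs x0)].
rewrite anybE => /hasP[z zS /(isob_sound uvs avs x0)[ws [uws aws sws wsE]]].
exact: (spb_sound (allP sporadic_ok _ zS) uws aws sws wsE).
Qed.

Fixpoint lists (T : Type) (s : seq T) k : seq (seq T) :=
  if k is k'.+1 then flatten [seq [seq x :: l | l <- lists s k'] | x <- s] else [:: [::]].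

Lemma mem_lists (T : eqType) (s : seq T) l : {subset l <= s} -> l \in lists s (size l).
Proof.
elim: l => [|x l IH] ls /=; first by rewrite inE.
apply/flattenP; exists [seq x :: l' | l' <- lists s (size l)].
  by apply: map_f; apply: ls; rewrite inE eqxx.
by apply/map_f/IH => y yl; apply: ls; rewrite inE yl orbT.
Qed.

Definition blocks (FU FR X : seq (seq bool)) : seq (seq bool) :=
  [seq nth [::] FU i ++ nth [::] X i | i <- iota 0 (size FU)] ++
  [seq [seq nth false row j | row <- X] ++ nth [::] FR j | j <- iota 0 (size FR)].

(* [d] rows of the off-diagonal block are full, the others are arbitrary. *)
Definition family (d : nat) (FU FR : seq (seq bool)) (cs : seq cert) :=
  allb (fun X => chk (iota (size FR).-1 4) cs (blocks FU FR (nseq d (nseq (size FR) true) ++ X)))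
       (lists (lists [:: true; false] (size FR)) (size FU - d)).

Lemma family_sound d FU FR cs (H : sgraph) (us rs : seq H) :
  family d FU FR cs -> us != [::] -> uniq (us ++ rs) -> (forall x, x \in us ++ rs) ->
  mat us us = FU -> mat rs rs = FR ->
  {in take d us & rs, forall x y, adj x y} -> d <= size us ->
  exists J, addition_host H J.
Proof.
move=> fam us0 uvs avs UE RE full dus.
have x0 : H by case: (us) us0.
have sU : size FU = size us by rewrite -UE size_mat.
have sR : size FR = size rs by rewrite -RE size_mat.
have XE : mat us rs = nseq d (nseq (size FR) true) ++ mat (drop d us) rs.
  rewrite -{1}(cat_take_drop d us) /mat map_cat; congr (_ ++ _).
  rewrite sR -[in RHS](size_takel dus); elim: (take d us) full => [//|x l IH] full /=.
  rewrite IH; last by move=> y z yl; apply: full; rewrite inE yl orbT.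
  congr (_ :: _); apply: (@eq_from_nth _ false); rewrite size_map ?size_nseq // => i i_r.
  by rewrite (nth_map x0) // nth_nseq i_r full ?mem_nth // inE eqxx.
apply: (chk_sound (ks := iota (size FR).-1 4) (cs := cs) x0 uvs avs).
have -> : mat (us ++ rs) (us ++ rs) = blocks FU FR (mat us rs).
  have E1 (ws : seq H) : mat ws (us ++ rs) = [seq [seq adj x y | y <- us] ++ [seq adj x y | y <- rs] | x <- ws].
    by apply: eq_map => x; rewrite map_cat.
  rewrite {1}/mat map_cat -/(mat us _) -/(mat rs _) !E1 /blocks sU sR; congr (_ ++ _).
    apply: (@eq_from_nth _ [::]); rewrite !size_map ?size_iota // => i i_u.
    rewrite (nth_map x0) // (nth_map 0) ?size_iota // nth_iota // add0n -UE.
    by rewrite !(nth_map x0).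
  apply: (@eq_from_nth _ [::]); rewrite !size_map ?size_iota // => j j_r.
  rewrite (nth_map x0) // (nth_map 0) ?size_iota // nth_iota // add0n -RE.
  rewrite (nth_map x0) //; congr (_ ++ _); rewrite -map_comp; apply: eq_map => x /=.
  by rewrite (nth_map x0) // adj_sym.
move: fam; rewrite /family allbE XE => /allP; apply.
rewrite sU -size_drop -(size_mat (drop d us) rs); apply: mem_lists => l /mapP[x _ ->].
by rewrite sR -(size_map (adj x) rs); apply: mem_lists => b _; rewrite !inE; case: b.
Qed.

Definition edgeless k := edges_mat k [::].
Definition matching4 := edges_mat 4 [:: (0, 2); (1, 3)].
Definition two_edges := edges_mat 4 [:: (0, 1); (2, 3)].
Definition one_edge := edges_mat 4 [:: (0, 1)].

(* The certificates [(b, X, u, v)] below were found by a computer search. *)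
Lemma family_hub :
  all (fun p => all (fun r => family 1 (edgeless p) (edgeless r)
    [:: (false, [:: 0; 1; 2; 3; 4; 5], 0, 3)])
  [:: 1; 2; 3]) [:: 1; 2; 3].
Proof. by vm_compute. Qed.

Lemma family_hubs :
  all (fun r => family 2 (edgeless 4) (edgeless r)
    [:: (true, [:: 2; 3; 4; 5; 6], 2, 5); (true, [:: 2; 3; 4; 5; 6], 3, 5); (false, [:: 0; 1; 2; 4; 5; 6], 0, 5); (true, [:: 2; 3; 4; 6], 3, 4); (true, [:: 2; 3; 4; 5; 6], 3, 6); (false, [:: 0; 1; 3; 4; 5; 6], 0, 6); (false, [:: 0; 1; 2; 3; 4; 5; 6], 0, 6); (false, [:: 0; 1; 2; 3; 4; 5; 6; 7], 0, 6); (false, [:: 0; 1; 2; 4; 5; 6; 7], 0, 6); (false, [:: 0; 1; 3; 4; 5; 6; 7], 0, 4); (false, [:: 0; 1; 2; 4; 5; 7], 1, 5); (false, [:: 0; 1; 2; 4; 6; 7], 2, 6); (false, [:: 0; 1; 2; 5; 6; 7], 2, 6); (false, [:: 0; 1; 3; 4; 5; 7], 3, 7); (false, [:: 0; 1; 3; 4; 6; 7], 1, 7); (false, [:: 0; 1; 3; 5; 6; 7], 3, 6); (false, [:: 0; 1; 2; 3; 4; 5; 7], 3, 7); (false, [:: 0; 1; 2; 3; 4; 6; 7], 0, 7); (false, [:: 0; 1; 2; 3; 5; 6; 7], 3, 5)])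
  [:: 1; 2; 3; 4].
Proof. by vm_compute. Qed.

Lemma family_matched :
  all (fun r => family 2 matching4 (edgeless r)
    [:: (true, [:: 0; 1; 2; 3], 1, 3); (false, [:: 0; 1; 2; 3; 4; 5; 6], 0, 6); (true, [:: 2; 3; 4; 5; 6], 2, 5); (true, [:: 2; 3; 4; 5; 6], 3, 5); (true, [:: 2; 3; 4; 5; 6], 3, 4); (true, [:: 2; 3; 4; 5; 6], 2, 4); (true, [:: 2; 3; 4; 5; 6; 7], 3, 4); (true, [:: 2; 3; 4; 5; 6; 7], 2, 4); (false, [:: 0; 1; 2; 3; 5; 6; 7], 0, 2); (true, [:: 2; 3; 4; 5; 6; 7], 2, 6); (true, [:: 2; 3; 5; 6; 7], 3, 6); (true, [:: 2; 3; 5; 6; 7], 2, 7); (true, [:: 2; 3; 5; 6; 7], 3, 7)])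
  [:: 1; 2; 3; 4].
Proof. by vm_compute. Qed.

Lemma family_hub_two_edges :
  all (fun p => family 1 (edgeless p) two_edges
    [:: (true, [:: 1; 2; 3; 4], 3, 4); (true, [:: 2; 3; 4; 5], 4, 5); (true, [:: 1; 2; 3; 4; 5], 2, 3); (true, [:: 1; 2; 3; 4; 5; 6], 3, 4); (true, [:: 3; 4; 5; 6], 3, 4); (true, [:: 3; 4; 5; 6], 5, 6); (false, [:: 0; 1; 2; 3; 4; 5; 6], 0, 6)])
  [:: 1; 2; 3].
Proof. by vm_compute. Qed.

Lemma family_hubs_two_edges :
  family 2 (edgeless 4) two_edges
    [:: (true, [:: 2; 3; 4; 5; 6; 7], 4, 5); (true, [:: 4; 5; 6; 7], 4, 5); (true, [:: 4; 5; 6; 7], 6, 7); (false, [:: 0; 1; 2; 3; 4; 5; 6; 7], 6, 7)].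
Proof. by vm_compute. Qed.

Lemma family_matched_two_edges :
  family 2 matching4 two_edges
    [:: (false, [:: 0; 1; 2; 3; 4; 5; 6; 7], 0, 6); (true, [:: 2; 3; 4; 5; 6; 7], 4, 5); (true, [:: 3; 4; 5; 6; 7], 6, 7); (false, [:: 1; 3; 4; 5; 6; 7], 4, 5)].
Proof. by vm_compute. Qed.

Lemma family_matched_edge :
  family 2 matching4 one_edge
    [:: (false, [:: 0; 1; 2; 4; 5], 4, 5); (true, [:: 2; 3; 4; 5; 6; 7], 4, 5); (false, [:: 0; 1; 3; 4; 5], 1, 5)].
Proof. by vm_compute. Qed.

(** * Classification *)

Section Graph.
Variable H : sgraph.
Implicit Types (A B X Y Z C D R U : {set H}) (u v x y : H).
Local Notation hostable := (exists J, addition_host H J).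
Local Notation a := (@adj H).

Lemma small_del u v C : small a C -> small (del u v) C.
Proof.
move=> /andP[C2 /indepP Ci]; rewrite /small C2; apply/indepP => x y xC yC.
by rewrite /del (negbTE (Ci _ _ xC yC)).
Qed.

Lemma del_notin u v x y : adj x y -> (y != u) && (y != v) -> del u v x y.
Proof. by move=> xy /andP[/negbTE yu /negbTE yv]; rewrite /del xy /edge_rel yu yv !andbF. Qed.

(* A separator of [Q] leaves [R] on one side; with the other side it has at most
   four vertices, so that [Y] stays on the side of [R]. *)
Lemma peel R u v : ~~ sep a true R -> u \in R -> v \in R ->
  forall Q : {set H}, R \subset Q -> #|Q :\: R| <= 2 ->
  exists Z, [/\ R \subset Z, Z \subset Q, ~~ sep a true Z &
    forall Y, ~~ sep (del u v) true Y -> 4 < #|Y| -> Y \subset Q -> Y \subset Z].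
Proof.
move=> nR uR vR Q; have [m] := ubnP #|Q|; elim: m Q => // m IH Q Qm RQ QR2.
have [/sepP[C [A [CQ C2 /indepP Ci AQ [A0 B0 AB]]]]|nQ] := boolP (sep a true Q); last first.
  by exists Q.
set B := _ :\: A in B0 AB.
have sC : small a C by apply/andP.
have QE : Q \subset C :|: A :|: B.
  by apply/subsetP => x xQ; rewrite !inE xQ andbT; case: (x \in A); case: (x \in C).
have AC : [disjoint A & C] by apply: disjointWl AQ _; rewrite disjoint_sym disjoints_subset setCD subsetUr.
have BC : [disjoint B & C].
  apply: disjointWl (subsetDl _ _) _.
  by rewrite disjoint_sym disjoints_subset setCD subsetUr.
have ABd : [disjoint A & B] by rewrite disjoint_sym /B setDE disjoints_subset subsetIr.
have BQ : B \subset Q by apply: subset_trans (subsetDl _ _) (subsetDl _ _).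
have AQ' : A \subset Q by apply: subset_trans AQ (subsetDl _ _).
have main (S T : {set H}) : S \subset Q -> T \subset Q -> Q \subset C :|: S :|: T -> [disjoint T & C] -> [disjoint S & T] ->
    T != set0 -> {in S & T, forall x y, adj x y} -> R \subset C :|: S ->
    exists Z, [/\ R \subset Z, Z \subset Q, ~~ sep a true Z &
    forall Y, ~~ sep (del u v) true Y -> 4 < #|Y| -> Y \subset Q -> Y \subset Z].
  move=> SQ TQ QST TC ST T0 STa RS.
  have TR x : x \in T -> x \notin C :|: S.
    move=> xT; rewrite inE negb_or; move: TC ST; rewrite [[disjoint S & T]]disjoint_sym !disjoint_subset.
    by move=> /subsetP/(_ _ xT) + /subsetP/(_ _ xT); rewrite !inE => -> ->.
  have T2 : #|T| <= 2.
    apply: leq_trans QR2; apply: subset_leq_card; apply/subsetP => x xT.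
    rewrite inE (subsetP TQ _ xT) andbT; apply: contra (TR _ xT).
    exact: (subsetP RS).
  have Q'Q : C :|: S \subset Q by rewrite subUset CQ.
  have [|||Z [RZ ZQ nZ Zmax]] := IH (C :|: S).
  - rewrite -ltnS; apply: leq_trans Qm; rewrite ltnS; apply: proper_card.
    apply/properP; split => //; have [t tT] := set0Pn _ T0.
    by exists t; [apply: (subsetP TQ)|apply: TR].
  - by [].
  - by apply: leq_trans QR2; apply: subset_leq_card; apply: setSD.
  exists Z; split => //; first exact: subset_trans Q'Q.
  move=> Y nY Y5 YQ; apply: Zmax => //.
  have [||//|YT] := insep_side nY (small_del u v sC) (A := S) (B := T).
  - exact: subset_trans QST.
  - move=> x y xS yT; apply: del_notin; first exact: STa.
    by apply/andP; split; apply: contraNneq (TR _ yT) => ->; apply: (subsetP RS).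
  have := leq_trans (subset_leq_card YT) (leq_card_setU _ _).
  by rewrite leqNgt => /negP[]; apply: leq_ltn_trans Y5; rewrite (@leq_add _ _ 2 2).
have [||RA|RB] := insep_side nR sC (A := A) (B := B).
- exact: subset_trans QE.
- by move=> x y xA yB; rewrite AB.
- by apply: (main A B) => // x y xA yB; rewrite AB.
apply: (main B A) => //.
- by rewrite -setUA (setUC B) setUA.
- by rewrite disjoint_sym.
- by move=> x y xA yB; rewrite adj_sym AB.
Qed.

(** The image of [R] might stray into [C], so [R] is enlarged by [peel] to a set [Z] that absorbs
    every inseparable set of more than four vertices within [C :|: R]. The image of [Z] is too large
    for [C :|: D], hence lies in [C :|: R] and so in [Z]. *)
Lemma host_coinsep C D R u v : small a C -> {in D & R, forall x y, adj x y} -> D != set0 ->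
  C :|: D :|: R = setT -> #|C :|: D| <= 4 -> ~~ sep a true R -> 4 < #|R| ->
  u \in R -> v \in R -> adj u v -> hostable.
Proof.
move=> sC DR D0 cov CD4 nR R5 uR vR uv.
have DRd x : x \in D -> x \notin R by move=> xD; apply/negP => xR; have := DR _ _ xD xR; rewrite adj_irrefl.
have [||Z [RZ ZQ nZ Zmax]] := peel nR uR vR (Q := C :|: R).
- exact: subsetUr.
- have /andP[C2 _] := sC; apply: leq_trans C2; apply: subset_leq_card.
  by rewrite setDUl setDv setU0 subsetDl.
have Z5 : 4 < #|Z| by apply: leq_trans R5 (subset_leq_card RZ).
apply: (host_amalgam uv nZ); apply: not_fits; rewrite ?(subsetP RZ) // => f fI fP.
have nY := sep_imset fI fP nZ.
have Y5 : 4 < #|f @: Z| by rewrite card_in_imset.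
apply/eqP; rewrite eqEcard card_in_imset // leqnn andbT; apply: Zmax => //.
have [||YD|//] := insep_side nY (small_del u v sC) (A := D) (B := R).
- by rewrite cov subsetT.
- move=> x y xD yR; rewrite /del (DR _ _ xD yR) /edge_rel.
  by apply/negP => /orP[]/andP[/eqP xE _]; have := DRd _ xD; rewrite xE ?uR ?vR.
by have := leq_trans (subset_leq_card YD) CD4; rewrite leqNgt Y5.
Qed.

(** The image of [C :|: R] lies in itself or in [C :|: D], and the latter is too small. *)
Lemma host_coinsep_big C D R u v : small a C -> {in D & R, forall x y, adj x y} ->
  C :|: D :|: R = setT -> #|C :|: D| < #|C :|: R| -> ~~ sep a true (C :|: R) ->
  u \in C :|: R -> v \in C :|: R -> u \notin D -> v \notin D -> adj u v -> hostable.
Proof.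
move=> sC DR cov CDR nR uR vR uD vD uv.
apply: (host_amalgam uv nR); apply: not_fits => // f fI fP.
have nY := sep_imset fI fP nR.
apply/eqP; rewrite eqEcard card_in_imset // leqnn andbT.
have [||YD|//] := insep_side nY (small_del u v sC) (A := D) (B := R).
- by rewrite cov subsetT.
- move=> x y xD yR; rewrite /del (DR _ _ xD yR) /edge_rel.
  by apply/negP => /orP[]/andP[/eqP xE _]; [move: uD|move: vD]; rewrite -xE xD.
by have := subset_leq_card YD; rewrite card_in_imset // leqNgt CDR.
Qed.

(** [I] consists of the isolated vertices of [H[R]]. If there are three, one survives every
    separator and cannot be adjacent to a vertex of the other side. If the rest is disconnected, a
    separator spares a vertex in each of two parts; being nonadjacent, they are on the same side,
    and a vertex of the other side would be adjacent to both. *)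
Lemma coinsep_or_component R u v : u \in R -> v \in R -> adj u v ->
  let I := [set x in R | [forall y in R, ~~ adj x y]] in
  (unsplit a (R :\: I) /\ #|I| <= 2) \/
  (~~ sep a true R /\ (4 < #|R| \/ exists x1 x2 x3 x4,
     [/\ R =i [:: x1; x2; x3; x4], uniq [:: x1; x2; x3; x4],
         adj x1 x2, adj x3 x4 & [/\ ~~ adj x1 x3, ~~ adj x1 x4, ~~ adj x2 x3 & ~~ adj x2 x4]])).
Proof.
move=> uR vR uv I.
have IP x y : x \in I -> y \in R -> ~~ adj x y.
  by rewrite inE => /andP[_ /forall_inP]; apply.
have [I2|I2] := leqP #|I| 2; last first.
  right; split; last first.
    left; have uI : u \notin I by apply/negP => /IP/(_ vR); rewrite uv.
    have vI : v \notin I by apply/negP => /IP/(_ uR); rewrite adj_sym uv.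
    have uNv : u != v by apply: contraTneq uv => ->; rewrite adj_irrefl.
    have sub : [set u; v] :|: I \subset R.
      rewrite !subUset !sub1set uR vR; apply/subsetP => x; by rewrite inE => /andP[].
    apply: leq_trans (subset_leq_card sub); rewrite cardsU disjoint_setI0.
      by rewrite cards0 subn0 cards2 uNv (@ltn_add2l 2 2).
    by rewrite disjoints_subset subUset !sub1set !in_setC uI vI.
  apply/negP => /sepP[C [A [CR C2 Ci AR [A0 B0 AB]]]].
  have [z zI zC] : exists2 z, z \in I & z \notin C.
    by apply/subsetPn; apply: contraL I2 => /subset_leq_card IC; rewrite -leqNgt (leq_trans IC).
  have zR : z \in R by move: zI; rewrite inE => /andP[].
  have [x xA] := set0Pn _ A0; have [y yB] := set0Pn _ B0.
  have xR : x \in R by have := subsetP AR _ xA; rewrite inE => /andP[].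
  have yR : y \in R by move: yB; rewrite !inE => /and3P[].
  have [zA|zA] := boolP (z \in A).
    by have := IP _ _ zI yR; rewrite AB.
  by have := IP _ _ zI xR; rewrite adj_sym AB // !inE zA zC zR.
have [us|] := boolP [forall A : {set H}, forall B : {set H}, (A :|: B == R :\: I) ==>
   [disjoint A & B] ==> [forall x in A, forall y in B, ~~ adj x y] ==> (A == set0) || (B == set0)].
  left; split => // A B E0 dAB AB.
  have /forallP/(_ B)/implyP := forallP us A; rewrite E0 eqxx dAB => /(_ isT)/implyP.
  have AB' : [forall x in A, forall y in B, ~~ adj x y].
    by apply/forall_inP => x xA; apply/forall_inP => y yB; apply: AB.
  by move=> /(_ isT)/implyP/(_ AB')/orP[]/eqP; [left|right].
move=> nus; right.
have [A [B [E0 AB A0 B0]]] : exists A B, [/\ A :|: B = R :\: I, {in A & B, forall x y, ~~ adj x y},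
    A != set0 & B != set0].
  case/forallPn: nus => A /forallPn[B]; rewrite !negb_imply negb_or => /and4P[/eqP E0 _ AB /andP[A0 B0]].
  exists A, B; split => // x y xA yB.
  by have /forall_inP/(_ _ xA)/forall_inP/(_ _ yB) := AB.
have ABs x y : x \in B -> y \in A -> ~~ adj x y by move=> xB yA; rewrite adj_sym AB.
have inR1 x : x \in R -> x \notin I -> (x \in A) || (x \in B).
  by move=> xR xI; rewrite -in_setU E0 in_setD xI xR.
have ofR1 x : (x \in A) || (x \in B) -> x \in R /\ x \notin I.
  by rewrite -in_setU E0 in_setD => /andP[].
have nbI x : x \in R -> x \notin I -> exists2 y, y \in R & adj x y.
  rewrite inE => -> /=; case/forall_inPn => y yR; rewrite negbK => xy; by exists y.
have nbAB x y : x \in R -> y \in R -> adj x y -> y \notin I.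
  by move=> xR yR xy; apply/negP => /IP/(_ xR); rewrite adj_sym xy.
have [x1 x1A] := set0Pn _ A0; have [x3 x3B] := set0Pn _ B0.
have [x1R x1I] : x1 \in R /\ x1 \notin I by apply: ofR1; rewrite x1A.
have [x3R x3I] : x3 \in R /\ x3 \notin I by apply: ofR1; rewrite x3B orbT.
have [x2 x2R x12] := nbI _ x1R x1I; have [x4 x4R x34] := nbI _ x3R x3I.
have x2A : x2 \in A.
  by case/orP: (inR1 _ x2R (nbAB _ _ x1R x2R x12)) => // x2B; have := AB _ _ x1A x2B; rewrite x12.
have x4B : x4 \in B.
  by case/orP: (inR1 _ x4R (nbAB _ _ x3R x4R x34)) => // x4A; have := ABs _ _ x3B x4A; rewrite x34.
have ne x y : x \in A -> y \in B -> x != y.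
  move=> xA yB; apply: contraTneq yB => <-; apply/negP => xB.
  have [xR xI] : x \in R /\ x \notin I by apply: ofR1; rewrite xA.
  have [z zR xz] := nbI _ xR xI.
  case/orP: (inR1 _ zR (nbAB _ _ xR zR xz)) => [zA|zB].
    by have := ABs _ _ xB zA; rewrite xz.
  by have := AB _ _ xA zB; rewrite xz.
have nadj x y : adj x y -> x != y by move=> xy; apply: contraTneq xy => ->; rewrite adj_irrefl.
have uni : uniq [:: x1; x2; x3; x4].
  by rewrite /= !inE !negb_or (nadj _ _ x12) (nadj _ _ x34) (ne x1 x3) // (ne x1 x4) // (ne x2 x3) // (ne x2 x4).
have sub : [set x in [:: x1; x2; x3; x4]] \subset R.
  by apply/subsetP => x; rewrite !inE => /or4P[]/eqP->.
have c4 : #|[set x in [:: x1; x2; x3; x4]]| = 4 by rewrite cardsE (card_uniqP uni).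
split; last first.
  have := subset_leq_card sub; rewrite c4 leq_eqVlt => /orP[/eqP R4|]; last by left.
  right; exists x1, x2, x3, x4; split => //; last by split; apply: AB.
  have /eqP <- : [set x in [:: x1; x2; x3; x4]] == R by rewrite eqEcard sub c4 -R4.
  by move=> x; rewrite inE.
apply/negP => /sepP[C [S [CR C2 Ci SR [S0 T0 ST]]]].
set T := _ :\: S in T0 ST.
have out x y : adj x y -> x \in R -> y \in R -> exists z, [/\ z \notin C, z \in R & z = x \/ z = y].
  move=> xy xR yR; have [xC|xC] := boolP (x \in C); last by exists x; split => //; left.
  exists y; split => //; last by right.
  by apply/negP => yC; have := Ci _ _ xC yC; rewrite xy.
have [p [pC pR pE]] := out _ _ x12 x1R x2R; have [q [qC qR qE]] := out _ _ x34 x3R x4R.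
have pA : p \in A by case: pE => ->.
have qB : q \in B by case: qE => ->.
have STin x : x \in R -> x \notin C -> (x \in S) || (x \in T).
  by move=> xR xC; rewrite /T !in_setD xC xR andbT; case: (x \in S).
have SR' x : x \in S -> x \in R by move/(subsetP SR); rewrite in_setD => /andP[].
have TR' x : x \in T -> x \in R by rewrite !in_setD => /and3P[].
have both x : x \in R -> adj x p -> adj x q -> False.
  move=> xR xp xq; have xI : x \notin I by apply: (nbAB p); rewrite // adj_sym.
  case/orP: (inR1 _ xR xI) => [xA|xB].
    by have := AB _ _ xA qB; rewrite xq.
  by have := ABs _ _ xB pA; rewrite xp.
have npq : ~~ adj p q by apply: AB.
case/orP: (STin _ pR pC) => pS; case/orP: (STin _ qR qC) => qS.
- have [t tT] := set0Pn _ T0; apply: (both t); rewrite ?TR' // adj_sym ST //.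
- by rewrite ST in npq.
- by rewrite adj_sym ST in npq.
- have [t tS] := set0Pn _ S0; apply: (both t); rewrite ?SR' // ST //.
Qed.

End Graph.

(** * Joins with a connected set *)

Section Graph.
Variable H : sgraph.
Implicit Types (A B X Y Z C D R U : {set H}) (u v x y : H).
Local Notation hostable := (exists J, addition_host H J).
Local Notation a := (@adj H).

Lemma adjN x y : adj x y -> x != y.
Proof. by apply: contraTneq => ->; rewrite adj_irrefl. Qed.

(** Otherwise [C] would divide [x] from the rest of [Y]. *)
Lemma indep1_side b C X Y x y : ~~ sep a b X -> b = false -> small a C -> X \subset C :|: Y ->
  indep a Y -> x \in X -> y \in X -> x \in Y -> y \in Y -> x \notin C -> y \notin C -> x = y.
Proof.
move=> nX b0 sC XY /indepP iY xX yX xY yY xC yC; apply/eqP; apply: contraT => xy.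
have [||XA|XB] := insep_side nX sC (A := [set x]) (B := Y :\ x).
- apply: subset_trans XY _; apply/subsetP => z; rewrite !inE.
  by case: (z == x); case: (z \in C); case: (z \in Y).
- by move=> z t; rewrite !inE b0 => /eqP-> /andP[_ tY]; apply/negbTE/iY.
- by have := subsetP XA _ yX; rewrite !inE (negbTE yC) eq_sym (negbTE xy).
- by have := subsetP XB _ xX; rewrite !inE (negbTE xC) eqxx.
Qed.

(* An inseparable [Y] that meets the maximal set [X] above [D :|: K] in a small
   set contains some vertex of [D], hence none of [K]; so [Y] is small. *)
Lemma host_component C D K I u v : small a C -> D != set0 -> indep a D ->
  C :|: D :|: (K :|: I) = setT -> {in D & K :|: I, forall x y, adj x y} ->
  unsplit a K -> u \in K -> v \in K -> adj u v ->
  {in I & K :|: I, forall x y, ~~ adj x y} -> #|I| <= 2 ->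
  (forall P : {set H}, P \subset C :|: D -> unsplit a P -> 2 <= #|P| ->
     #|P| + #|I| < #|D :|: K|) -> hostable.
Proof.
move=> sC D0 iD cov DR usK uK vK uv iI I2 HP.
have DRd x : x \in D -> x \notin K :|: I.
  by move=> xD; apply/negP => xR; have := DR _ _ xD xR; rewrite adj_irrefl.
have n0 : ~~ sep a false (D :|: K).
  apply: join_insep => //; first exact: adj_sym.
  - by move=> x y xD yK; apply: DR => //; rewrite inE yK.
  - exact: edge_small uK vK uv.
  - by right.
have X3 : 2 < #|D :|: K|.
  have [d dD] := set0Pn _ D0; have := DRd _ dD; rewrite inE negb_or => /andP[dK _].
  have du : d != u by apply: contraNneq dK => ->.
  have dv : d != v by apply: contraNneq dK => ->.
  have sub : [set d; u; v] \subset D :|: K.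
    by rewrite !subUset !sub1set !inE dD uK vK !orbT.
  apply: leq_trans (subset_leq_card sub).
  by rewrite -setUA cardsU1 !inE negb_or du dv cards2 adjN.
apply: (host_insep_max n0 _ _ uv); rewrite ?inE ?uK ?vK ?orbT // => X Y X0X nX nY YX sYX.
have Y3 : 2 < #|Y| by rewrite YX; apply: leq_trans X3 (subset_leq_card X0X).
have /andP[_ /indepP iYX] := sYX.
set R := K :|: I in cov DR iI DRd *.
pose Q := Y :&: R; pose P := Y :\: R.
have YPQ : Y = Q :|: P by rewrite /Q /P setID.
have iQ : indep a Q.
  apply/indepP => x y /[!inE] /andP[xY xR] /andP[yY yR].
  case/orP: (xR) => [xK|xI]; last by apply: iI; rewrite ?inE.
  case/orP: (yR) => [yK|yI]; last by rewrite adj_sym iI ?inE.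
  by apply: iYX; rewrite inE ?xY ?yY (subsetP X0X) // inE ?xK ?yK orbT.
have card1 (S : {set H}) : (forall x y, x \in S -> y \in S -> x = y) -> #|S| <= 1.
  by move=> SE; apply/card_le1_eqP => x y xS yS; apply: SE.
have QP x : x \in Q -> [/\ x \in Y, x \in R & x \notin P].
  by rewrite /Q /P in_setI in_setD => /andP[-> ->].
have PP x : x \in P -> x \in Y /\ x \notin Q.
  by rewrite /Q /P in_setI in_setD => /andP[/negbTE-> ->].
have card1Q : small a P -> #|Q| <= 1.
  move=> sP; apply: card1 => x y xQ yQ; have [xY _ xP] := QP x xQ; have [yY _ yP] := QP y yQ.
  by apply: (indep1_side nY (erefl _) sP (Y := Q)); rewrite // {1}YPQ setUC.
have Pn1 : small a P -> #|P| <= 1 -> False.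
  move=> sP P1; have Q1 := card1Q sP.
  by move: Y3; rewrite YPQ ltnNge (leq_trans (leq_card_setU _ _)) // (@leq_add _ _ 1 1).
have PU : P \subset C :|: D.
  apply/subsetP => x; rewrite inE => /andP[xR _]; have := in_setT x.
  by rewrite -cov in_setU (negbTE xR) orbF.
(* Otherwise [P] lies in [C] and is small; then [Q] and [P] have at most one vertex each, too few
   for [Y]. *)
have [d dP dD] : exists2 d, d \in P & d \in D.
  apply/exists_inP; apply: contraT => /exists_inPn PD.
  have PC : P \subset C.
    apply/subsetP => x xP; have := subsetP PU _ xP; rewrite inE => /orP[//|xD].
    by have := PD _ xP; rewrite xD.
  have sP := smallS PC sC; exfalso; have /andP[P2 iP] := sP.
  have Q1 := card1Q sP.
  apply: Pn1 => //; apply: card1 => x y xP yP.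
  have [xY xQ] := PP x xP; have [yY yQ] := PP y yP.
  have sQ : small a Q by rewrite /small (leq_trans Q1).
  by apply: (indep1_side nY (erefl _) sQ (Y := P)); rewrite // {1}YPQ.
have QI : Q \subset I.
  apply/subsetP => q; rewrite inE => /andP[qY]; rewrite inE => /orP[qK|//].
  have dY : d \in Y by move: dP; rewrite inE => /andP[].
  have : ~~ adj d q by apply: iYX; rewrite inE ?dY ?qY (subsetP X0X) // inE ?dD ?qK ?orbT.
  by rewrite DR // inE qK.
have sQ : small a Q by rewrite /small (leq_trans (subset_leq_card QI)).
(* A division of [P] would be a division of [Y] by the small set [Q]. *)
have usP : unsplit a P.
  move=> A B AB dAB cr.
  have AY x : x \in A :|: B -> x \in Y /\ x \notin Q.
    by rewrite AB => /[!inE] /andP[/negbTE-> ->].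
  have [||XA|XB] := insep_side nY sQ (A := A) (B := B).
  - by rewrite -setUA AB -YPQ.
  - by move=> x y xA yB; apply/negbTE/cr.
  - right; apply/setP => x; rewrite inE; apply/negP => xB.
    have [xY xQ] : x \in Y /\ x \notin Q by apply: AY; rewrite inE xB orbT.
    have := subsetP XA _ xY; rewrite inE (negbTE xQ) /= => xA.
    by move: dAB; rewrite disjoint_subset => /subsetP/(_ _ xA); rewrite inE xB.
  left; apply/setP => x; rewrite inE; apply/negP => xA.
  have [xY xQ] : x \in Y /\ x \notin Q by apply: AY; rewrite inE xA.
  have := subsetP XB _ xY; rewrite inE (negbTE xQ) /= => xB.
  by move: dAB; rewrite disjoint_subset => /subsetP/(_ _ xA); rewrite inE xB.
have P2 : 2 <= #|P|.
  rewrite ltnNge; apply/negP => P1; apply: Pn1 => //; rewrite /small (leq_trans P1) //=.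
  apply/indepP => x y xP yP; have -> : x = y by apply: (card_le1_eqP P1).
  by rewrite adj_irrefl.
have := HP P PU usP P2; rewrite ltnNge => /negP[].
apply: leq_trans (subset_leq_card X0X) _; rewrite -YX YPQ.
by apply: leq_trans (leq_card_setU _ _) _; rewrite addnC leq_add2l subset_leq_card.
Qed.
End Graph.

(** * Triangle-free graphs with one or two hubs *)

Section Graph.
Variable H : sgraph.
Implicit Types (A B X Y Z C D R U : {set H}) (u v x y : H).
Local Notation hostable := (exists J, addition_host H J).
Local Notation a := (@adj H).

Lemma nb_del_sub u v x : nb (del u v) x \subset nb a x.
Proof. by apply/subsetP => y; rewrite !inE => /andP[]. Qed.

Lemma nb_del_lt u v : adj u v -> #|nb (del u v) u| < #|nb a u|.
Proof.
move=> uv; apply: proper_card; apply/properP; split; first exact: nb_del_sub.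
by exists v; rewrite !inE // /del /edge_rel !eqxx andbF.
Qed.

Lemma triangle_free_bip U : indep a U -> indep a (~: U) -> triangle_free H.
Proof.
move=> /indepP iU /indepP iR x y z xy yz xz.
have flip p q : adj p q -> (p \in U) = (q \notin U).
  move=> pq; case pU: (p \in U); case qU: (q \in U) => //.
    by have := iU p q pU qU; rewrite pq.
  by have := iR p q; rewrite !in_setC pU qU pq => /(_ isT isT).
by have := flip _ _ xz; rewrite (flip _ _ xy) (flip _ _ yz) negbK; case: (z \in U).
Qed.

(** The capacity is just below the degree of [d], and deleting [dx] brings all degrees down to it,
    so [M] is empty. *)
Lemma host_typed1 (d x : H) c : triangle_free H -> adj d x -> #|nb a d| = c.+1 ->
  (forall y, y != d -> y != x -> #|nb a y| <= c) -> #|nb a x| <= c.+1 -> hostable.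
Proof.
move=> tf dx cd cy cx; apply: (@host_typed H c false) => //; first by exists d; rewrite cd.
exists d, x, set0; split; rewrite ?inE ?eqxx //; split=> [p q|w _]; first by rewrite inE.
have [->|wval] := eqVneq w d; first by rewrite -ltnS -cd nb_del_lt.
have [->|wx] := eqVneq w x; last first.
  by apply: leq_trans (cy w wval wx); apply: subset_leq_card; apply: nb_del_sub.
rewrite -ltnS; apply: leq_trans cx; rewrite (_ : nb (del d x) x = nb (del x d) x).
  by apply: nb_del_lt; rewrite adj_sym.
by apply/setP => z; rewrite !inE delC.
Qed.

(** Deleting [d1 x] brings [d1] down to the capacity, and [d2] stays in [M]. For a frozen pair with
    an unlimited end, [x] joins [M], which remains a clique because [d2] and [x] are adjacent. *)
Lemma host_typed2 (d1 d2 x : H) c : triangle_free H -> d1 != d2 -> ~~ adj d1 d2 ->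
  adj d1 x -> adj d2 x -> #|nb a d1| = c.+1 -> #|nb a d2| = c.+1 ->
  (forall y, y != d1 -> y != d2 -> #|nb a y| <= c) -> hostable.
Proof.
move=> tf dd nd d1x d2x c1 c2 cy.
have x1 : x != d1 by rewrite eq_sym adjN.
have x2 : x != d2 by rewrite eq_sym adjN.
have dl w : #|nb (del d1 x) w| <= #|nb a w| by apply: subset_leq_card; apply: nb_del_sub.
have deg M w : d2 \in M -> w \notin M -> #|nb (del d1 x) w| <= c.
  move=> d2M wM; have [->|wd1] := eqVneq w d1; first by rewrite -ltnS -c1 nb_del_lt.
  by apply: leq_trans (dl w) (cy w wd1 _); apply: contraNneq wM => ->.
apply: (@host_typed H c true) => //.
- by exists d1, d2; rewrite c1 c2.
- exists d1, x, [set d2]; rewrite !inE (negbTE dd) (negbTE x2); split => //; split.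
    by move=> p q /[!inE] /eqP-> /eqP->; rewrite eqxx.
  by move=> w; apply: deg; rewrite inE.
move=> _; exists d1, x, [set d2; x]; rewrite !inE (negbTE dd) eqxx orbT eq_sym (negbTE x1).
split => //; split.
  move=> p q /[!inE] /orP[]/eqP-> /orP[]/eqP->; rewrite ?eqxx // => _.
  by rewrite adj_sym.
by move=> w; apply: deg; rewrite !inE eqxx.
Qed.

(** What matters is the number of vertices of [U] complete to [R]. Three of them form with [R] a
    large inseparable join. One or two are the only vertices of degree [#|R|], all other degrees
    being smaller because [#|U| < #|R|], and intersection graphs of capacity [#|R| - 1] apply. *)
Lemma host_bipartite U (d : H) : indep a U -> indep a (~: U) -> d \in U ->
  (forall x, x \notin U -> adj d x) -> #|U| <= 4 -> #|U| < #|~: U| -> hostable.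
Proof.
move=> iU iR dU dR U4 UR; set R := ~: U in iR UR.
have tf := triangle_free_bip iU iR.
have [/indepP iU' /indepP iR'] := (iU, iR).
have [c Rc] : exists c, #|R| = c.+1 by case: #|R| UR => // c _; exists c.
have nbU y : y \in U -> nb a y \subset R.
  move=> yU; apply/subsetP => z; rewrite !inE => yz; apply/negP => zU.
  by have := iU' _ _ yU zU; rewrite yz.
have nbR y : y \in R -> nb a y \subset U.
  move=> yR; apply/subsetP => z; rewrite inE => yz; apply: contraT => zU.
  by have := iR' y z yR; rewrite inE zU yz => /(_ isT).
have nbd : nb a d = R.
  by apply/eqP; rewrite eqEsubset nbU //=; apply/subsetP => x; rewrite !inE => /dR.
have [x xR] : exists x, x \in R by apply/set0Pn; rewrite -card_gt0 Rc.
have dx : adj d x by apply: dR; move: xR; rewrite inE.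
have degR y : y \in R -> #|nb a y| <= c.
  move=> yR; rewrite -ltnS -Rc; apply: leq_ltn_trans UR.
  by apply: subset_leq_card; apply: nbR.
pose F := [set y in U | R \subset nb a y].
have dF : d \in F by rewrite inE dU nbd subxx.
have degU y : y \in U -> y \notin F -> #|nb a y| <= c.
  rewrite inE => yU; rewrite yU /= => nf; rewrite -ltnS -Rc; apply: proper_card.
  by rewrite properE nbU.
have degF y : y \in F -> #|nb a y| = c.+1.
  by rewrite inE => /andP[yU Ry]; rewrite -Rc; apply/eqP; rewrite eqn_leq !subset_leq_card // nbU.
have deg y : y \notin F -> #|nb a y| <= c.
  move=> yF; have [yU|yU] := boolP (y \in U); first exact: degU.
  by apply: degR; rewrite inE.
have fullF y z : y \in F -> z \in R -> adj y z.
  by rewrite inE => /andP[_ /subsetP H0] /H0; rewrite inE.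
have FU : F \subset U by apply/subsetP => y; rewrite inE => /andP[].
have [F3|F3] := leqP 3 #|F|.
  have R3 : ~~ small a R.
    by apply: card3_small; apply: leq_trans F3 (leq_trans (subset_leq_card FU) (ltnW UR)).
  have nX : ~~ sep a false (F :|: R).
    apply: join_insep => //; [exact: adj_sym|by apply/set0Pn; exists d|].
    by left; apply: card3_small.
  have FRd : [disjoint F & R] by rewrite disjoints_subset setCK.
  apply: (host_insep_big nX (u := d) (v := x)); rewrite ?in_setU ?dF ?xR ?orbT //.
  - rewrite setCU setCK setIC -setDE cardsD (setIidPr FU).
    by rewrite leq_subLR; apply: leq_trans U4 _; rewrite (leq_add2r 2 2) ltnW.
  rewrite cardsU (disjoint_setI0 FRd) cards0 subn0.
  apply: leq_trans (leq_add F3 (leqnn _)).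
  by rewrite Rc; have := leq_trans (leq_trans F3 (subset_leq_card FU)) (ltnW UR); rewrite Rc; case: (c) => [|[|]].
have [F1|F1] := leqP #|F| 1.
  have Fd y : y != d -> y \notin F by apply: contraNN => yF; apply/eqP; apply: (card_le1_eqP F1).
  apply: (host_typed1 tf dx (degF _ dF)) => [y yd _|]; first exact/deg/Fd.
  by apply: leqW; apply: degR.
have [d2 d2F dd] : exists2 y, y \in F & y != d.
  apply/exists_inP; apply: contraT => /exists_inPn FE.
  move: F1; rewrite ltnNge => /negP[]; apply/card_le1_eqP => y z yF zF.
  by have := FE _ yF; have := FE _ zF; rewrite !negbK => /eqP-> /eqP->.
have Fe y : y != d -> y != d2 -> y \notin F.
  move=> yd yd2; apply: contraL F3 => yF; rewrite -leqNgt.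
  apply: leq_trans (subset_leq_card (_ : [set y; d2; d] \subset F)).
    by rewrite -setUA cardsU1 !inE negb_or yd yd2 cards2 dd.
  by rewrite !subUset !sub1set yF d2F dF.
apply: (host_typed2 tf (d1 := d) (d2 := d2) (x := x) (c := c)); rewrite ?degF //.
- by rewrite eq_sym.
- by apply: iU' => //; apply: (subsetP FU).
- exact: fullF.
by move=> y yd yd2; apply/deg/Fe.
Qed.

Lemma indep2 x y : ~~ adj x y -> indep a [set x; y].
Proof.
move=> xy; apply/indepP => p q /[!inE] /orP[]/eqP-> /orP[]/eqP->;
by rewrite ?adj_irrefl // adj_sym.
Qed.

Lemma small2 x y : ~~ adj x y -> small a [set x; y].
Proof. by move=> xy; rewrite /small indep2 // cards2 andbT; case: (_ != _). Qed.

Lemma mat_two_edges x1 x2 x3 x4 : adj x1 x2 -> adj x3 x4 -> ~~ adj x1 x3 -> ~~ adj x1 x4 ->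
  ~~ adj x2 x3 -> ~~ adj x2 x4 ->
  mat [:: x1; x2; x3; x4] [:: x1; x2; x3; x4] = two_edges.
Proof.
move=> e1 e2 n1 n2 n3 n4; rewrite /mat /= !adj_irrefl e1 e2 [adj x2 x1]adj_sym e1.
rewrite [adj x4 x3]adj_sym e2 (negbTE n1) (negbTE n2) (negbTE n3) (negbTE n4).
by rewrite ![adj x3 _]adj_sym ![adj x4 _]adj_sym (negbTE n1) (negbTE n2) (negbTE n3) (negbTE n4).
Qed.

Lemma mat_one_edge x1 x2 x3 x4 : adj x1 x2 -> ~~ adj x3 x4 -> ~~ adj x1 x3 -> ~~ adj x1 x4 ->
  ~~ adj x2 x3 -> ~~ adj x2 x4 ->
  mat [:: x1; x2; x3; x4] [:: x1; x2; x3; x4] = one_edge.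
Proof.
move=> e1 n0 n1 n2 n3 n4; rewrite /mat /= !adj_irrefl e1 [adj x2 x1]adj_sym e1.
rewrite [adj x4 x3]adj_sym (negbTE n0) (negbTE n1) (negbTE n2) (negbTE n3) (negbTE n4).
by rewrite ![adj x3 _]adj_sym ![adj x4 _]adj_sym (negbTE n1) (negbTE n2) (negbTE n3) (negbTE n4).
Qed.

Lemma mat_indep (us : seq H) : {in us &, forall x y, ~~ adj x y} ->
  mat us us = edgeless (size us).
Proof.
move=> ius; have sE : size (edgeless (size us)) = size us by rewrite size_map size_iota.
apply: (@eq_from_nth _ [::]); rewrite ?size_map ?size_iota // => i i_u.
have x0 : H by case: (us) i_u.
rewrite (nth_map x0) // (nth_map 0) ?size_iota //.
apply: (@eq_from_nth _ false); rewrite ?size_map ?size_iota // => j j_u.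
rewrite (nth_map x0) // (nth_map 0) ?size_iota //.
by apply/negbTE/ius; apply: mem_nth.
Qed.

Lemma indep_unsplit (P : {set H}) : indep a P -> unsplit a P -> #|P| <= 1.
Proof.
move=> /indepP iP uP; apply/card_le1_eqP => x y xP yP; apply/eqP; apply: contraT => xy.
have [|||E0|E0] := uP [set y] (P :\ y).
- by rewrite setD1K.
- by rewrite disjoint_subset; apply/subsetP => z /[!inE] /eqP->; rewrite eqxx.
- by move=> p q /[!inE] /eqP-> /andP[_ qP]; apply: iP.
- by have := set11 y; rewrite E0 inE.
- by have : x \in P :\ y; [rewrite !inE eq_sym xy | rewrite E0 inE].
Qed.

(** * Two nonadjacent hubs, matched to the separator or not *)

Section TwoHubs.
Variables (R : {set H}) (c1 c2 d1 d2 : H) (m : bool).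
Hypothesis cov : [set c1; c2] :|: [set d1; d2] :|: R = setT.
Hypothesis uni : uniq [:: d1; d2; c1; c2].
Hypothesis DR : {in [set d1; d2] & R, forall x y, adj x y}.
Hypotheses (ncc : ~~ adj c1 c2) (ndd : ~~ adj d1 d2).
Hypotheses (dc1 : adj d1 c1 = m) (dc2 : adj d2 c2 = m).
Hypotheses (dc12 : ~~ adj d1 c2) (dc21 : ~~ adj d2 c1).
Hypotheses (c1R : c1 \notin R) (c2R : c2 \notin R).

Let C := [set c1; c2].
Let D := [set d1; d2].

Let sC : small a C. Proof. exact: small2. Qed.
Let iD : indep a D. Proof. exact: indep2. Qed.
Let d1D : d1 \in D. Proof. exact: set21. Qed.
Let d2D : d2 \in D. Proof. exact: set22. Qed.
Let dR x : x \in D -> x \notin R.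
Proof. by move=> xD; apply/negP => xR; have := DR xD xR; rewrite adj_irrefl. Qed.
Let cR x : x \in C -> x \notin R. Proof. by rewrite !inE => /orP[]/eqP->. Qed.
Let cD x : x \in C -> x \notin D.
Proof.
move: uni; rewrite /= !inE !negb_or => /and4P[/and3P[_ n1 n2] /andP[n3 n4] _ _].
by case/orP=> /eqP->; rewrite ?negb_or ![_ == d1]eq_sym ![_ == d2]eq_sym ?n1 ?n2 ?n3 ?n4.
Qed.
Let c12 : c1 != c2. Proof. by move: uni; rewrite /= !inE => /and4P[]. Qed.
Let d12 : d1 != d2.
Proof. by move: uni; rewrite /= !inE !negb_or => /and4P[/and3P[]]. Qed.
Let covE x : [|| x \in C, x \in D | x \in R].
Proof. by have := in_setT x; rewrite -cov !in_setU -orbA. Qed.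
Let CD4 : #|C :|: D| <= 4.
Proof. by apply: leq_trans (leq_card_setU _ _) _; rewrite !cards2 c12 d12. Qed.
Let D0 : D != set0. Proof. by apply/set0Pn; exists d1. Qed.
Let C_nadj x y : x \in C -> y \in C -> ~~ adj x y.
Proof. by case/andP: sC => _ /indepP; apply. Qed.

(** Without edges between [C] and [R] the graph is bipartite with two hubs of degree [#|R| + 1].
    Otherwise [C :|: R] is indivisible, or a separation of it keeps the remaining vertices of the
    independent set [R] on one side; the other side is then part of [C] and gives, with [D], three
    vertices complete to those of [R]. *)
Lemma host_matched : m -> indep a R -> 4 < #|R| -> hostable.
Proof.
move=> m1 iR R5; have dc1' : adj d1 c1 by rewrite dc1.
have dc2' : adj d2 c2 by rewrite dc2.
have [/existsP[c /existsP[x /and3P[cC xR cx]]]|none] :=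
    boolP [exists c, exists x, [&& c \in C, x \in R & adj c x]]; last first.
  have nCR c x : c \in C -> x \in R -> ~~ adj c x.
    move=> cC xR; apply: contra none => cx; apply/existsP; exists c; apply/existsP; exists x.
    by rewrite cC xR.
  have iCR : indep a (~: D).
    have inCR x : x \in ~: D -> (x \in C) || (x \in R).
      by rewrite in_setC => /negbTE xD; have := covE x; rewrite xD.
    apply/indepP => x y /inCR/orP[xC|xR] /inCR/orP[yC|yR].
    - exact: C_nadj.
    - exact: nCR.
    - by rewrite adj_sym; apply: nCR.
    - by have /indepP := iR; apply.
  have [x xR] : exists x, x \in R by apply/set0Pn; rewrite -card_gt0 (leq_trans _ R5).
  have nbd d d' c c' : d \in D -> c \in C -> adj d c -> ~~ adj d c' -> ~~ adj d d' ->
      C = [set c; c'] -> D = [set d; d'] -> #|nb a d| = #|R|.+1.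
    move=> dD cC dc dc' dd' CE DE.
    have -> : nb a d = c |: R; last by rewrite cardsU1 cR.
    apply/setP => z; rewrite in_setU1 inE.
    case/or3P: (covE z); [rewrite CE|rewrite DE|].
    - rewrite !inE => /orP[]/eqP->; first by rewrite eqxx.
      have [E0|] := eqVneq c' c; first by rewrite -E0 (negbTE dc') in dc.
      by rewrite (negbTE dc') (negbTE (cR _)) // CE !inE eqxx orbT.
    - rewrite !inE => /orP[]/eqP->; rewrite ?adj_irrefl ?(negbTE dd') (negbTE (dR _)) ?orbF //.
      + by apply/esym/negbTE; apply: contraNneq (cD cC) => <-.
      + apply/esym/negbTE; apply: contraNneq (cD cC) => <-.
        by rewrite DE !inE eqxx orbT.
      + by rewrite DE !inE eqxx orbT.
    - by move=> zR; rewrite zR orbT; apply: DR.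
  apply: (host_typed2 (triangle_free_bip iD iCR) d12 ndd (x := x) (c := #|R|)).
  - exact: DR.
  - exact: DR.
  - by apply: (nbd d1 d2 c1 c2); rewrite ?inE ?eqxx.
  - apply: (nbd d2 d1 c2 c1); rewrite ?inE ?eqxx ?orbT //.
    + by rewrite adj_sym.
    + by rewrite setUC.
    + by rewrite setUC.
  move=> y yd1 yd2; have yD : y \notin D by rewrite !inE negb_or yd1.
  apply: leq_trans (subset_leq_card (_ : nb a y \subset D)) _; last first.
    by rewrite cards2 (leq_trans _ R5) //; case: (_ != _).
  apply/subsetP => z; rewrite inE => yz; apply: contraT => zD.
  by have /indepP/(_ y z) := iCR; rewrite !in_setC yD zD yz => /(_ isT isT).
have [sp|nQ] := boolP (sep a true (C :|: R)); last first.
  apply: (host_coinsep_big sC DR cov _ nQ (u := c) (v := x)) => //.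
  - by apply: leq_ltn_trans CD4 _; apply: leq_trans R5 _; apply/subset_leq_card/subsetUr.
  - by rewrite inE cC.
  - by rewrite inE xR orbT.
  - exact: cD.
  - by apply/negP => /dR; rewrite xR.
case/sepP: sp => [C0 [A [CQ C02 Ci AQ [A0 B0 AB]]]]; set B := _ :\: A in B0 AB.
have BP z : z \in B -> [/\ z \notin A, z \notin C0 & z \in C :|: R].
  by rewrite /B 2!in_setD => /and3P[].
have AP z : z \in A -> z \notin C0 /\ z \in C :|: R.
  by move/(subsetP AQ); rewrite in_setD => /andP.
have side z : z \in C :|: R -> z \notin C0 -> (z \in A) || (z \in B).
  by move=> zQ zC; rewrite /B 2!in_setD zC zQ andbT; case: (z \in A).
have R'3 : 2 < #|R :\: C0|.
  rewrite -(ltn_add2l 2); apply: leq_trans R5 _; rewrite -(cardsID C0 R) leq_add2r.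
  by apply: leq_trans C02; apply/subset_leq_card/subsetIr.
have main (S T : {set H}) : T != set0 -> {in S & T, forall x y, adj x y} ->
    (forall z, z \in T -> [/\ z \notin S, z \notin C0 & z \in C :|: R]) ->
    (forall z, z \in C :|: R -> z \notin C0 -> (z \in S) || (z \in T)) ->
    R :\: C0 \subset S -> hostable.
  move=> T0 ST TP STin RS.
  have TC z : z \in T -> z \in C.
    move=> zT; have [zS zC0] := TP z zT; rewrite inE => /orP[//|zR].
    by case/negP: zS; apply: (subsetP RS); rewrite inE zC0.
  have [t tT] := set0Pn _ T0.
  have DT3 : 2 < #|D :|: T|.
    apply: (@leq_trans #|t |: D|); first by rewrite cardsU1 (cD (TC _ tT)) cards2 d12.
    apply: subset_leq_card; rewrite setUC; apply: setUS.
    by rewrite sub1set.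
  have full : {in D :|: T & R :\: C0, forall x y, adj x y}.
    move=> p q; rewrite in_setU in_setD => /orP[pD|pT] /andP[qC0 qR]; first exact: DR.
    by rewrite adj_sym ST // (subsetP RS) // inE qC0.
  have nX : ~~ sep a false ((D :|: T) :|: (R :\: C0)).
    apply: join_insep => //; first exact: adj_sym.
    - by apply/set0Pn; exists d1; rewrite inE d1D.
    - exact: card3_small.
    - by left; apply: card3_small.
  have [y yR'] : exists y, y \in R :\: C0 by apply/set0Pn; rewrite -card_gt0 (leq_trans _ R'3).
  have dis : [disjoint D :|: T & R :\: C0].
    rewrite disjoint_subset; apply/subsetP => z zD; rewrite inE; apply/negP => zR'.
    by have := full _ _ zD zR'; rewrite adj_irrefl.
  apply: (host_insep_big nX (u := d1) (v := y)).
  - by rewrite 2!in_setU d1D.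
  - by rewrite in_setU yR' orbT.
  - by apply: full => //; rewrite inE d1D.
  - apply: leq_trans C02; apply: subset_leq_card; apply/subsetP => z.
    rewrite in_setC 2!in_setU in_setD !negb_or => /andP[/andP[zD zT] zR'].
    apply: contraT => zC0; rewrite zC0 /= in zR'.
    have zC : z \in C by have := covE z; rewrite (negbTE zD) (negbTE zR') !orbF.
    have := STin z; rewrite inE zC (negbTE zT) orbF => /(_ isT zC0) zS.
    by have := C_nadj zC (TC _ tT); rewrite ST.
  rewrite cardsU (disjoint_setI0 dis) cards0 subn0.
  by apply: leq_trans (leq_add DT3 R'3).
have [r /[dup] rR' /setDP[rR rC0]] : exists r, r \in R :\: C0.
  by apply/set0Pn; rewrite -card_gt0 (leq_trans _ R'3).
have /indepP iR' := iR.
have rQ z : z \in R -> z \in C :|: R by move=> zR; rewrite inE zR orbT.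
case/orP: (side r (rQ _ rR) rC0) => rS.
  apply: (main A B) => //.
  apply/subsetP => z /setDP[zR zC0]; case/orP: (side z (rQ _ zR) zC0) => // zB.
  by have := iR' _ _ rR zR; rewrite AB.
apply: (main B A) => //.
- by move=> p q pB qA; rewrite adj_sym AB.
- move=> z zA; have [zC zQ] := AP z zA; split => //.
  by apply/negP => /BP[]; rewrite zA.
- by move=> z zQ zC; rewrite orbC side.
apply/subsetP => z /setDP[zR zC0]; case/orP: (side z (rQ _ zR) zC0) => // zA.
by have := iR' _ _ zR rR; rewrite AB.
Qed.

Let us := [:: d1; d2; c1; c2].
Let mat_us : mat us us = if m then matching4 else edgeless 4.
Proof.
have [d21 c21 c1d2 c2d1] : [/\ adj d2 d1 = false, adj c2 c1 = false, adj c1 d2 = false & adj c2 d1 = false].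
  by split; apply/negbTE; rewrite adj_sym.
have [c1d1 c2d2] : adj c1 d1 = m /\ adj c2 d2 = m by split; rewrite adj_sym.
rewrite /us /mat /= !adj_irrefl (negbTE ncc) (negbTE ndd) (negbTE dc12) (negbTE dc21).
by rewrite dc1 dc2 d21 c21 c1d2 c2d1 c1d1 c2d2; case: m.
Qed.

Lemma host_family rs : uniq rs -> R =i rs ->
  (exists cs, family 2 (if m then matching4 else edgeless 4) (mat rs rs) cs) -> hostable.
Proof.
move=> urs Rrs [cs fam]; apply: (family_sound (us := us) (rs := rs) fam) => //.
- rewrite cat_uniq uni urs andbT /=; apply/hasPn => x; rewrite -Rrs => xR.
  rewrite !inE !negb_or; apply/and4P; split; apply: contraTneq xR => -> //; exact: dR.
- move=> x; rewrite mem_cat -Rrs; have := covE x; rewrite !inE.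
  by case: (x == d1); case: (x == d2); case: (x == c1); case: (x == c2).
by move=> x y xD; rewrite -Rrs => yR; apply: DR; rewrite // !inE; move: xD; rewrite /= !inE.
Qed.

Let CD_indep : m = false -> indep a (C :|: D).
Proof.
move=> mF; have n1 : ~~ adj d1 c1 by rewrite dc1 mF.
have n2 : ~~ adj d2 c2 by rewrite dc2 mF.
apply/indepP => x y; rewrite !inE -!orbA.
by case/or4P=> /eqP-> /or4P[]/eqP->; rewrite ?adj_irrefl //; rewrite adj_sym.
Qed.

Lemma host_two_hubs : R != set0 -> hostable.
Proof.
move=> R0; have [/exists_inP[u uR /exists_inP[v vR uv]]|noe] :=
    boolP [exists u in R, exists v in R, adj u v]; last first.
  have iR : indep a R.
    apply/indepP => x y xR yR; apply: contra noe => xy.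
    by apply/exists_inP; exists x => //; apply/exists_inP; exists y.
  have fam4 rs : uniq rs -> R =i rs -> size rs = #|R|.
    by move=> urs Rrs; rewrite -(card_uniqP urs); apply: eq_card => x; rewrite Rrs.
  have [R4|R5] := leqP #|R| 4.
    apply: (host_family (enum_uniq _) (rs := enum R)).
      by move=> x; rewrite mem_enum.
    rewrite mat_indep; last by move=> x y; rewrite !mem_enum; move/indepP: iR; apply.
    rewrite -cardE; have Rr : #|R| \in [:: 1; 2; 3; 4].
      by move: R0 R4; rewrite -card_gt0; case: #|R| => [|[|[|[|[|k]]]]].
    case: (m); eexists; first exact: (allP family_matched _ Rr).
    exact: (allP family_hubs _ Rr).
  case mE: m; first exact: host_matched.
  have inCR : ~: (C :|: D) = R.
    apply/setP => x; rewrite in_setC in_setU negb_or; apply/andP/idP => [[xC xD]|xR].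
      by have := covE x; rewrite (negbTE xC) (negbTE xD).
    split; first by apply/negP => /cR; rewrite xR.
    by apply/negP => /dR; rewrite xR.
  apply: (host_bipartite (U := C :|: D) (d := d1)); rewrite ?inCR //.
  - exact: CD_indep.
  - by rewrite inE d1D orbT.
  - move=> x; rewrite -in_setC inCR; exact: DR.
  exact: leq_ltn_trans CD4 R5.
have := coinsep_or_component uR vR uv; set I := [set x in R | _].
case=> [[usK I2]|[nR [R5|[x1 [x2 [x3 [x4 [Rx ux x12 x34 [n13 n14 n23 n24]]]]]]]]]; first 1 last.
- exact: (host_coinsep sC DR D0 cov CD4 nR R5 uR vR uv).
- apply: (host_family ux Rx); rewrite mat_two_edges //.
  case: (m); eexists; [exact: family_matched_two_edges | exact: family_hubs_two_edges].
have IP x y : x \in I -> y \in R -> ~~ adj x y.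
  by rewrite inE => /andP[_ /forall_inP]; apply.
have IR : I \subset R by apply/subsetP => x; rewrite inE => /andP[].
have RE : (R :\: I) :|: I = R.
  by rewrite setUC -{1}(setIidPr IR) setIC -[RHS](setID R I) setIC.
set K := R :\: I in usK RE.
have uK : u \in K by rewrite inE uR andbT; apply/negP => /IP/(_ vR); rewrite uv.
have vK : v \in K by rewrite inE vR andbT; apply/negP => /IP/(_ uR); rewrite adj_sym uv.
have uv' : u != v by apply: adjN.
have K2 : 2 <= #|K|.
  apply: leq_trans (subset_leq_card (_ : [set u; v] \subset K)); first by rewrite cards2 uv'.
  by rewrite subUset !sub1set uK vK.
(* The count below asks for [#|I| < #|K|] when [m] holds; this fails only for one edge beside two
   isolated vertices, a case left to computation. *)
have [/and3P[m1 I2' K2']|hyp] := boolP [&& m, #|I| == 2 & #|K| <= 2].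
  have KE : K = [set u; v].
    apply/esym/eqP; rewrite eqEcard subUset !sub1set uK vK /=.
    by rewrite cards2 uv'.
  case/cards2P: I2' => x3 [x4 [x34 IE]].
  have x3I : x3 \in I by rewrite IE set21.
  have x4I : x4 \in I by rewrite IE set22.
  have x3R := subsetP IR _ x3I; have x4R := subsetP IR _ x4I.
  have KI x y : x \in K -> y \in I -> x != y by rewrite !in_setD => /andP[xI _]; apply: contraTneq => <-.
  apply: (@host_family [:: u; v; x3; x4]).
  - by rewrite /= !inE !negb_or uv' x34 !KI.
  - move=> x; rewrite -RE KE IE !inE; by rewrite !orbA.
  rewrite mat_one_edge //; try by [apply: IP | rewrite adj_sym; apply: IP].
  by rewrite m1; eexists; exact: family_matched_edge.
apply: (host_component sC D0 iD _ _ usK uK vK uv _ I2); rewrite ?RE //.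
have dDK : #|D :|: K| = 2 + #|K|.
  rewrite cardsU disjoint_setI0 ?cards0 ?subn0 ?cards2 ?d12 //.
  rewrite disjoint_subset; apply/subsetP => x /dR xR; rewrite inE; apply: contra xR.
  by rewrite in_setD => /andP[].
move=> P PU uP P2; rewrite dDK.
have cl x : x \in P -> [\/ x = c1, x = c2, x = d1 | x = d2].
  move/(subsetP PU); rewrite !inE -orbA => /or4P[]/eqP->;
  by [constructor 1|constructor 2|constructor 3|constructor 4].
have sides x y : x \in [set c1; d1] -> y \in [set c2; d2] -> ~~ adj x y.
  by move=> /[!inE] /orP[]/eqP-> /orP[]/eqP->; rewrite // adj_sym.
have [mE|mE] := boolP m; last first.
  have iP : indep a P by apply: indepS PU _; apply: CD_indep; apply: negbTE.
  by have := indep_unsplit iP uP; rewrite leqNgt P2.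
(* The only edges within [C :|: D] are [c1 d1] and [c2 d2], so a connected [P] lies in one of
   them. *)
have P2' : #|P| <= 2.
  have c2S x y : #|[set x; y]| <= 2 by rewrite cards2; case: (_ != _).
  have PE : (P :&: [set c1; d1]) :|: (P :&: [set c2; d2]) = P.
    apply/setP => x; rewrite !inE -andb_orr; case xP: (x \in P) => //=.
    by case: (cl x xP) => ->; rewrite !eqxx ?orbT.
  have [||E0|E0] := uP _ _ PE.
  - rewrite disjoint_subset; apply/subsetP => x; rewrite !inE => /andP[xP xc].
    rewrite xP /=; move: xc; move: uni; rewrite /= !inE !negb_or.
    case/and4P=> /and3P[n1 n2 n3] /andP[n4 n5] n6 _.
    by case/orP=> /eqP->; rewrite ?n1 ?n3 ?n6 // eq_sym n4.
  - move=> x y; rewrite [x \in _]in_setI [y \in _]in_setI => /andP[_ xs] /andP[_ ys].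
    exact: sides.
  - rewrite -PE E0 set0U; apply: leq_trans (c2S c2 d2); apply/subset_leq_card/subsetIr.
  - rewrite -PE E0 setU0; apply: leq_trans (c2S c1 d1); apply/subset_leq_card/subsetIr.
rewrite mE /= negb_and -ltnNge in hyp.
have IK : #|I| < #|K|.
  case/orP: hyp => [I1|K3]; last exact: leq_ltn_trans K3.
  by apply: leq_trans K2; rewrite ltn_neqAle I1.
by apply: leq_ltn_trans (leq_add P2' (leqnn _)) _; rewrite ltn_add2l.
Qed.

End TwoHubs.
End Graph.

(** * One hub, and the case distinction *)

Section Graph.
Variable H : sgraph.
Implicit Types (A B X Y Z C D R U : {set H}) (u v x y : H).
Local Notation hostable := (exists J, addition_host H J).
Local Notation a := (@adj H).

(** With its nonneighbours the hub forms an independent set of at most three vertices. Its connected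
    subsets are at most single vertices, so nothing competes in [host_component]. *)
Lemma host_hub (d : H) : small a [set x | (x != d) && ~~ adj d x] ->
  (exists x y : H, adj x y) -> hostable.
Proof.
set W := [set x | _] => sW [x0 [y0 xy0]]; pose R := nb a d.
have /andP[W2 /indepP iW] := sW.
have WP x : x \in W -> x != d /\ ~~ adj d x by rewrite inE => /andP.
have dW : d \notin W by rewrite inE eqxx.
have covE x : [|| x == d, x \in W | x \in R].
  by rewrite !inE; case: (x == d) => //=; case: (adj d x).
have WR x : x \in W -> x \notin R by case/WP=> _; rewrite inE.
have dR : d \notin R by rewrite inE adj_irrefl.
pose U := d |: W.
have iU : indep a U.
  apply/indepP => x y; rewrite !in_setU1 => /orP[/eqP->|xW] /orP[/eqP->|yW].
  - by rewrite adj_irrefl.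
  - by case: (WP _ yW).
  - by rewrite adj_sym; case: (WP _ xW).
  - exact: iW.
have UR : ~: U = R.
  apply/setP => x; rewrite in_setC in_setU1 negb_or; apply/andP/idP => [[xd xW]|xR].
    by have := covE x; rewrite (negbTE xd) (negbTE xW).
  split; first by apply: contraTneq xR => ->.
  by apply/negP => /WR; rewrite xR.
have cU : #|U| = #|W|.+1 by rewrite cardsU1 dW.
have cov : W :|: [set d] :|: R = setT by rewrite setUC -UR setUC setUC [W :|: _]setUC setUC setUCr.
have dDR : {in [set d] & R, forall x y, adj x y}.
  by move=> x y /set1P->; rewrite inE.
have d0 : [set d] != set0 by apply/set0Pn; exists d; rewrite inE.
have fam rs cs : uniq rs -> R =i rs -> family 1 (edgeless #|U|) (mat rs rs) cs -> hostable.
  move=> urs Rrs fam; apply: (family_sound (us := d :: enum W) (rs := rs) fam) => //.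
  - rewrite cat_uniq urs /= mem_enum dW enum_uniq /= andbT; apply/hasPn => x.
    rewrite -Rrs in_cons mem_enum negb_or => xR; apply/andP; split.
      by apply: contraTneq xR => ->.
    by apply/negP => /WR; rewrite xR.
  - by move=> x; rewrite mem_cat in_cons mem_enum -Rrs -orbA.
  - rewrite mat_indep /= -?cardE ?cU // => x y.
    by rewrite !in_cons !mem_enum -!in_setU1; move/indepP: iU; apply.
  by move=> x y; rewrite /= take0 inE -Rrs => /eqP->; rewrite inE.
have U3 : #|U| \in [:: 1; 2; 3] by rewrite cU; case: #|W| W2 => [|[|[|]]].
have [/exists_inP[u uR /exists_inP[v vR uv]]|noe] :=
    boolP [exists u in R, exists v in R, adj u v]; last first.
  have iR : indep a R.
    apply/indepP => x y xR yR; apply: contra noe => xy.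
    by apply/exists_inP; exists x => //; apply/exists_inP; exists y.
  have [UR'|RU] := ltnP #|U| #|R|.
    apply: (host_bipartite iU _ (setU11 d W)); rewrite ?UR //; last first.
      by rewrite cU ltnS (leq_trans W2).
    by move=> x; rewrite -in_setC UR inE.
  have R0 : R != set0.
    apply/eqP => R0; have := xy0; apply/negP; move/indepP: iU; apply;
    by rewrite -[U]setCK UR R0 setC0.
  have R3 : #|R| \in [:: 1; 2; 3].
    by move: R0 RU; rewrite cU -card_gt0; case: #|W| W2 => [|[|[|//]]] _; case: #|R| => [|[|[|[|k]]]].
  apply: (fam (enum R) _ (enum_uniq _)); first by move=> x; rewrite mem_enum.
  rewrite mat_indep -?cardE; last by move=> x y; rewrite !mem_enum; move/indepP: iR; apply.
  exact: (allP (allP family_hub _ U3) _ R3).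
have WD4 : #|W :|: [set d]| <= 4 by rewrite setUC cU ltnS (leq_trans W2).
have := coinsep_or_component uR vR uv; set I := [set x in R | _].
case=> [[usK I2]|[nR [R5|[x1 [x2 [x3 [x4 [Rx ux x12 x34 [n13 n14 n23 n24]]]]]]]]]; first 1 last.
- exact: (host_coinsep sW dDR d0 cov WD4 nR R5 uR vR uv).
- apply: (fam _ _ ux Rx); rewrite mat_two_edges //.
  exact: (allP family_hub_two_edges _ U3).
have IP x y : x \in I -> y \in R -> ~~ adj x y.
  by rewrite inE => /andP[_ /forall_inP]; apply.
have IR : I \subset R by apply/subsetP => x; rewrite inE => /andP[].
have RE : (R :\: I) :|: I = R.
  by rewrite setUC -{1}(setIidPr IR) setIC -[RHS](setID R I) setIC.
have uK : u \in R :\: I by rewrite inE uR andbT; apply/negP => /IP/(_ vR); rewrite uv.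
have vK : v \in R :\: I by rewrite inE vR andbT; apply/negP => /IP/(_ uR); rewrite adj_sym uv.
apply: (host_component sW d0 _ _ _ usK uK vK uv _ I2); rewrite ?RE //.
  by apply/indepP => x y /set1P-> /set1P->; rewrite adj_irrefl.
move=> P PU uP P2; have iP : indep a P by apply: indepS iU; rewrite /U setUC.
by have := indep_unsplit iP uP; rewrite leqNgt P2.
Qed.

Theorem host_of_edge : has_edge H -> hostable.
Proof.
move=> e; have [x0 [y0 xy0]] := e.
have [|ns] := boolP (sep a true setT); last exact: (host_setT xy0 ns).
case/sepP=> C [A [_ C2 Ci AT [A0 B0 AB]]]; set B := _ :\: A in B0 AB.
have sC : small a C by rewrite /small C2; apply/indepP.
have ABs : {in B & A, forall x y, adj x y} by move=> x y xB yA; rewrite adj_sym AB.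
have cov x : [|| x \in C, x \in A | x \in B].
  by rewrite /B !in_setD in_setT andbT; case: (x \in A); case: (x \in C).
have AC x : x \in A -> x \notin C by move/(subsetP AT); rewrite in_setD => /andP[].
have BC x : x \in B -> x \notin C /\ x \notin A by rewrite /B !in_setD => /and3P[].
pose nn d : {set H} := [set x | (x != d) && ~~ adj d x].
have nsmall d p q : ~~ small a (nn d) -> ~~ adj p q ->
    (forall x, x \in nn d -> x = p \/ x = q) -> False.
  move=> s pq sub; case/negP: s; apply: smallS (small2 pq); apply/subsetP => x /sub.
  by rewrite !inE => -[]->; rewrite eqxx ?orbT.
have main (D R : {set H}) : D != set0 -> R != set0 -> {in D & R, forall x y, adj x y} ->
    (forall x, [|| x \in C, x \in D | x \in R]) -> (forall x, x \in D -> x \notin C) ->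
    (forall x, x \in R -> x \notin C) -> #|D| <= 2 -> hostable.
  move=> D0 R0 DR covE DC RC D2.
  have nnP d x : d \in D -> x \in nn d -> x != d /\ ((x \in C) || (x \in D)) /\ ~~ adj d x.
    move=> dD; rewrite inE => /andP[-> dx]; do 2!split => //.
    have := covE x; case xR: (x \in R); last by rewrite orbF.
    by rewrite (DR _ _ dD xR) in dx.
  have [d1 d1D] := set0Pn _ D0.
  have [D1|D1] := leqP #|D| 1.
    have DE x : x \in D -> x = d1 by move=> xD; apply: (card_le1_eqP D1).
    apply: (host_hub (d := d1)) => //; apply: smallS sC; apply/subsetP => x.
    by move=> /(nnP _ _ d1D)[xd [/orP[//|/DE xE] _]]; rewrite xE eqxx in xd.
  have /cards2P[d1' [d2 [d12 DE]]] : #|D| == 2 by rewrite eqn_leq D2.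
  move=> {d1 d1D}; move: d1' d12 DE => d1 d12 DE.
  have d1D : d1 \in D by rewrite DE set21.
  have d2D : d2 \in D by rewrite DE set22.
  have [s1|s1] := boolP (small a (nn d1)); first exact: host_hub s1 e.
  have [s2|s2] := boolP (small a (nn d2)); first exact: host_hub s2 e.
  have ndd : ~~ adj d1 d2.
    apply: contra s1 => dd; apply: smallS sC; apply/subsetP => x.
    move=> /(nnP _ _ d1D)[xd []]; rewrite DE !inE (negbTE xd) => /orP[//|/eqP->].
    by rewrite dd.
  have sub1 x : x \in nn d1 -> x = d2 \/ x \in C /\ ~~ adj d1 x.
    move=> /(nnP _ _ d1D)[xd []]; rewrite DE !inE (negbTE xd) /= => /orP[xC|/eqP->]; last by left.
    by right.
  have sub2 x : x \in nn d2 -> x = d1 \/ x \in C /\ ~~ adj d2 x.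
    move=> /(nnP _ _ d2D)[xd []]; rewrite DE !inE (negbTE xd) orbF => /orP[xC|/eqP->]; last by left.
    by right.
  (* The nonneighbours of a hub fail to be small only through a vertex of [C] that it misses and the
     other hub sees; a single vertex cannot serve both hubs. *)
  have [C1|C1] := leqP #|C| 1.
    have key d d' : ~~ small a (nn d) -> (forall x, x \in nn d -> x = d' \/ x \in C /\ ~~ adj d x) ->
        exists c, [/\ c \in C, ~~ adj d c & adj d' c].
      move=> s sub; have [/exists_inP[c cC /andP[? ?]]|/exists_inPn none] :=
        boolP [exists c in C, ~~ adj d c && adj d' c]; first by exists c.
      have [C00|[c cC]] := set_0Vmem C.
        case: (nsmall _ d' d' s); rewrite ?adj_irrefl // => x /sub[|[]]; first by left.
        by rewrite C00 inE.
      have CE x : x \in C -> x = c by move=> xC; apply: (card_le1_eqP C1).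
      have [dc|dc] := boolP (adj d c).
        case: (nsmall _ d' d' s); rewrite ?adj_irrefl // => x /sub[|[/CE->]]; first by left.
        by rewrite dc.
      have := none _ cC; rewrite dc /= => d'c.
      by case: (nsmall _ d' c s) => // x /sub[|[/CE-> _]]; [left|right].
    have [c [cC n1 a2]] := key _ _ s1 sub1; have [c' [c'C n2 a1]] := key _ _ s2 sub2.
    have E0 : c = c' by apply: (card_le1_eqP C1).
    by rewrite -E0 a2 in n2.
  have /cards2P[c1 [c2 [c12 CE]]] : #|C| == 2 by rewrite eqn_leq C2.
  have c1C : c1 \in C by rewrite CE set21.
  have c2C : c2 \in C by rewrite CE set22.
  have ncc : ~~ adj c1 c2 by apply: Ci.
  have inC x : x \in C -> x = c1 \/ x = c2.
    by rewrite CE !inE => /orP[]/eqP->; [left|right].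
  (* A hub that sees one vertex of [C] must miss the other, and the other hub must see that one; so
     the edges between hubs and [C] form a perfect matching or are absent, as [host_two_hubs]
     requires. *)
  have cond d d' c c' : ~~ small a (nn d) ->
      (forall x, x \in nn d -> x = d' \/ x \in C /\ ~~ adj d x) ->
      (forall x, x \in C -> x = c \/ x = c') -> adj d c -> ~~ adj d c' /\ adj d' c'.
    move=> s sub CE' dc; have N0 : ~~ adj d c'.
      apply/negP => dc'; case: (nsmall _ d' d' s); rewrite ?adj_irrefl // => x.
      by case/sub=> [|[/CE'[]->]]; rewrite ?dc ?dc' //; left.
    split=> //; apply: contraT => d'c'; case: (nsmall _ d' c' s) => // x.
    by case/sub=> [|[/CE'[]->]]; rewrite ?dc //; [left|right].
  have inC' x : x \in C -> x = c2 \/ x = c1 by move=> /inC[]; [right|left].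
  have uni c c' : c \in C -> c' \in C -> c != c' -> uniq [:: d1; d2; c; c'].
    move=> cC c'C cc; have ne d p : d \in D -> p \in C -> d != p.
      by move=> dD pC; apply: contraTneq pC => <-; apply: DC.
    by rewrite /= !inE !negb_or d12 cc !ne.
  have covS c c' : C = [set c; c'] -> [set c; c'] :|: [set d1; d2] :|: R = setT.
    by move=> <-; rewrite -DE; apply/setP => x; rewrite !in_setU in_setT -orbA covE.
  have DR' : {in [set d1; d2] & R, forall x y, adj x y} by rewrite -DE.
  have CR c : c \in C -> c \notin R by move=> cC; apply/negP => /RC; rewrite cC.
  have CE' : C = [set c2; c1] by rewrite CE setUC.
  have c21 : c2 != c1 by rewrite eq_sym.
  have ncc' : ~~ adj c2 c1 by rewrite adj_sym.
  have [b11|b11] := boolP (adj d1 c1).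
    have [b12 b22] := cond _ _ _ _ s1 sub1 inC b11.
    have [b21 _] := cond _ _ _ _ s2 sub2 inC' b22.
    exact: (host_two_hubs (covS _ _ CE) (uni _ _ c1C c2C c12) DR' ncc ndd b11 b22 b12 b21 (CR _ c1C) (CR _ c2C) R0).
  have [b12|b12] := boolP (adj d1 c2).
    have [_ b21] := cond _ _ _ _ s1 sub1 inC' b12.
    have [b22 _] := cond _ _ _ _ s2 sub2 inC b21.
    exact: (host_two_hubs (covS _ _ CE') (uni _ _ c2C c1C c21) DR' ncc' ndd b12 b21 b11 b22 (CR _ c2C) (CR _ c1C) R0).
  have [b21|b21] := boolP (adj d2 c1).
    by have [_] := cond _ _ _ _ s2 sub2 inC b21; rewrite (negbTE b12).
  have [b22|b22] := boolP (adj d2 c2).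
    by have [_] := cond _ _ _ _ s2 sub2 inC' b22; rewrite (negbTE b11).
  exact: (host_two_hubs (covS _ _ CE) (uni _ _ c1C c2C c12) DR' ncc ndd (negbTE b11) (negbTE b22) b12 b21 (CR _ c1C) (CR _ c2C) R0).
have [A2|A3] := leqP #|A| 2; first by apply: (main A B) => // x /BC[].
have [B2|B3] := leqP #|B| 2.
  apply: (main B A) => // [x|x /BC[]//].
  by rewrite [(x \in B) || _]orbC.
have nX : ~~ sep a false (A :|: B).
  apply: join_insep => //; first exact: adj_sym.
    exact: card3_small.
  by left; apply: card3_small.
have [x xA] := set0Pn _ A0; have [y yB] := set0Pn _ B0.
apply: (host_insep_big nX (u := x) (v := y)).
- by rewrite inE xA.
- by rewrite inE yB orbT.
- exact: AB.
- apply: leq_trans C2; apply/subset_leq_card/subsetP => z; rewrite in_setC in_setU negb_or.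
  by case/andP=> zA zB; have := cov z; rewrite (negbTE zA) (negbTE zB) !orbF.
apply: (@leq_trans (3 + 3)) => //; rewrite cardsU disjoint_setI0 ?cards0 ?subn0 ?leq_add //.
by rewrite disjoint_subset; apply/subsetP => z zA; rewrite inE; apply/negP => /BC[_]; rewrite zA.
Qed.
End Graph.

(** * The converse *)

(** A copy of an edgeless [H] in [J] plus an edge cannot contain both ends of that edge, so it is
    already induced in [J]; and a nonedge to add exists because [J] is not complete. *)
Lemma edge_of_host (H J : sgraph) : addition_host H J -> has_edge H.
Proof.
case=> ncomp nJ hostJ.
have [/existsP[x /existsP[y xy]]|noe] := boolP [exists x : H, exists y : H, adj x y].
  by exists x, y.
have noH (a b : H) : adj a b = false.
  apply: contraNF noe => ab; apply/existsP; exists a; apply/existsP; exists b => //.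
have [/existsP[x /existsP[y xy]]|compl] := boolP [exists x : J, exists y : J, nonedge x y].
  have /contains_inducedP/embedsP[f f_inj fP] := hostJ x y xy.
  case: nJ; apply/contains_inducedP/embedsP; exists f => // a b.
  have := fP a b; rewrite noH -[LHS]/(add_edge_adj x y (f a) (f b)).
  by rewrite /add_edge_adj => /negbT; rewrite negb_or => /andP[/negbTE].
case: ncomp => x y xy; apply: contraNT compl => nxy.
by apply/existsP; exists x; apply/existsP; exists y; apply/andP.
Qed.

Theorem corollary9p1 (H : sgraph) :
  (exists J : sgraph, addition_host H J) <-> has_edge H.
Proof. by split=> [[J /edge_of_host]|/host_of_edge]. Qed.
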